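(* Assume $g$ satisfies A1, A2, A1* and A3w and suppose $u\in C^0(\Omega)$ is $g$-convex in the bounded domain $\Omega\subset\mathbb{R}^n$, with $\Omega$ sub $g$-convex with respect to $(y,z_y)$ for all $y\in\Sigma_0$, for some $x_0\in\Omega$, where $\Sigma_0=Y(x_0,u(x_0),\partial u(x_0))$ and $z_y=g^*(x_0,y,u(x_0))$. Then $Tu(x_0)=\Sigma_0$.
   Context: Generating functions. $\Gamma\subset\mathbb{R}^n\times\mathbb{R}^n\times\mathbb{R}$ is a domain with points $(x,y,z)$ such that the sets $I(x,y)=\{z:(x,y,z)\in\Gamma\}$ are open intervals (possibly empty); $\Gamma_x=\{(y,z):(x,y,z)\in\Gamma\}$, $\Gamma_{y,z}=\{x:(x,y,z)\in\Gamma\}$. A generating function is $g\in C^2(\Gamma)$ with $g_z\neq0$; throughout it is normalised so that $g_z<0$. Subscripts denote partial derivatives. Conditions: A1: for each $x$, the map $(g_x,g)(x,\cdot,\cdot)$ is one-to-one on $\Gamma_x$. A2: $\det E\ne0$ in $\Gamma$, where $E=g_{x,y}-(g_z)^{-1}g_{x,z}\otimes g_y$. A1*: for all $(y,z)$, the map $Q(\cdot,y,z)=-\frac{g_y}{g_z}(\cdot,y,z)$ is one-to-one on $\Gamma_{y,z}$. Let $J(x,y)=g(x,y,I(x,y))$, $\Gamma^*=\{(x,y,u):u\in J(x,y)\}$. The dual generating function $g^*$ on $\Gamma^*$ is defined by $g(x,y,g^*(x,y,u))=u$. Let $\mathcal{U}=\{(x,u,p): u=g(x,y,z),\ p=g_x(x,y,z)\text{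 for some }(x,y,z)\in\Gamma\}$. Under A1, A2 there are $C^1$ maps $Y,Z$ on $\mathcal{U}$ with $g_x(x,Y,Z)=p$, $g(x,Y,Z)=u$. Put $A(x,u,p)=g_{xx}(x,Y(x,u,p),Z(x,u,p))$, assumed twice differentiable. A3w: $(D_{p_kp_l}A_{ij})\xi_i\xi_j\eta_k\eta_l\ge0$ on $\mathcal{U}$ for all $\xi,\eta\in\mathbb{R}^n$ with $\xi\cdot\eta=0$. Convexity. $I(\Omega,y_0)=\bigcap_{x\in\Omega}I(x,y_0)$. A function $u\in C^0(\Omega)$ is $g$-convex in $\Omega$ if for each $x_0\in\Omega$ there are $y_0\in\mathbb{R}^n$, $z_0\in I(\Omega,y_0)$ with $u(x_0)=g(x_0,y_0,z_0)$ and $u\ge g(\cdot,y_0,z_0)$ in $\Omega$. Such $u$ is locally semi-convex; $\partial u(x_0)$ denotes its subdifferential at $x_0$, i.e. the set of $p$ with $u(x)\ge u(x_0)+p\cdot(x-x_0)+o(|x-x_0|)$ as $x\to x_0$. It is understood that $\{(x_0,u(x_0))\}\times\partial u(x_0)\subset\mathcal{U}$, so that $\Sigma_0$ is defined. The $g$-normal mapping of $u$ at $x_0$ is $$Tu(x_0)=\{y_0\in\mathbb{R}^n:\ \Omega\subset\Gamma_{y_0,z_0}\text{ and }u(x)\ge g(x,y_0,z_0)\text{ for all }x\in\Omega\},\quad z_0=g^*(x_0,y_0,u(x_0)).$$ $\Omega$ is sub $g$-convex with respect to $(y_0,z_0)$, $z_0\in I(\Omega,y_0)$, if the convex hull of $Q(\cdot,y_0,z_0)(\Omega)$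 is contained in $Q(\cdot,y_0,z_0)(\Gamma_{y_0,z_0})$. *)

(* Defs.v *)
From HB Require Import structures.
From mathcomp Require Import all_boot all_order all_algebra.
From mathcomp Require Import all_classical all_reals all_analysis.

Set Implicit Arguments.
Unset Strict Implicit.
Unset Printing Implicit Defensive.

Import Order.TTheory GRing.Theory Num.Theory.
Import numFieldNormedType.Exports.

Local Open Scope classical_set_scope.
Local Open Scope ring_scope.

Section regularity.
Context {R : realType}.

Definition is_domain (T : topologicalType) (D : set T) : Prop :=
  [/\ open D, connected D & D !=set0].

(* The three predicates below are meant for open D, so that the (two-sided)
   derivatives at a point of D only depend on f restricted to D. *)
Definition differentiable_on (V : normedModType R) (D : set V) (f : V -> R)
    : Prop :=
  forall a, D a -> differentiable f a.

Definition C1_on (V : normedModType R) (D : set V) (f : V -> R) : Prop :=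
  differentiable_on D f /\
  forall v a, D a -> {for a, continuous ('D_v f)}.

Definition C2_on (V : normedModType R) (D : set V) (f : V -> R) : Prop :=
  C1_on D f /\ forall v, C1_on D ('D_v f).

Definition twice_differentiable_on (V : normedModType R) (D : set V)
    (f : V -> R) : Prop :=
  differentiable_on D f /\ forall v, differentiable_on D ('D_v f).

Definition dotv (n : nat) (a b : 'rV[R]_n) : R := \sum_i a 0 i * b 0 i.

(* The Euclidean square |w|^2 is used, since the library norm on 'rV_n is
   the sup norm. *)
Definition locally_semiconvex (n : nat) (Omega : set 'rV[R]_n)
    (u : 'rV[R]_n -> R) : Prop :=
  forall x, Omega x -> exists r C : R,
    [/\ 0 < r, ball x r `<=` Omega
      & convex_function (ball x r) (fun w => u w + C * dotv w w)].

Definition subdifferential (n : nat) (u : 'rV[R]_n -> R) (x0 : 'rV[R]_n)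
    : set 'rV[R]_n :=
  [set p | forall e : R, 0 < e ->
    \forall x \near x0, u x0 + dotv p (x - x0) - e * `|x - x0| <= u x].

Definition convex_hull (n : nat) (A : set 'rV[R]_n) : set 'rV[R]_n :=
  smallest (fun B : set 'rV[R]_n => convex_set B) A.

End regularity.

Section generating_functions.
Context {R : realType} {n : nat}.
Notation X := 'rV[R]_n.

(* g is a total function, but only its values on Gamma are meaningful. *)
Implicit Types (Gamma : set (X * X * R)) (g : X * X * R -> R).

Definition basis_vec (i : 'I_n) : X := delta_mx 0 i.

Definition g_x g (x y : X) (z : R) : X :=
  \row_i 'D_(basis_vec i) (fun x' => g (x', y, z)) x.

Definition g_y g (x y : X) (z : R) : X :=
  \row_j 'D_(basis_vec j) (fun y' => g (x, y', z)) y.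

Definition g_z g (x y : X) (z : R) : R := derive1 (fun z' => g (x, y, z')) z.

Definition g_xx g (x y : X) (z : R) : 'M[R]_n :=
  \matrix_(i, j) 'D_(basis_vec j) (fun x' => g_x g x' y z 0 i) x.

Definition g_xy g (x y : X) (z : R) : 'M[R]_n :=
  \matrix_(i, j) 'D_(basis_vec j) (fun y' => g_x g x y' z 0 i) y.

Definition g_xz g (x y : X) (z : R) : X :=
  \row_i derive1 (fun z' => g_x g x y z' 0 i) z.

Definition Iset Gamma (x y : X) : set R := [set z | Gamma (x, y, z)].

Definition Gamma_yz Gamma (y : X) (z : R) : set X := [set x | Gamma (x, y, z)].

Definition generating_function Gamma g : Prop :=
  [/\ is_domain Gamma,
      forall x y, open (Iset Gamma x y) /\ is_interval (Iset Gamma x y),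
      C2_on Gamma g
    & forall x y z, Gamma (x, y, z) -> g_z g x y z < 0].

Definition A1 Gamma g : Prop :=
  forall x y1 z1 y2 z2, Gamma (x, y1, z1) -> Gamma (x, y2, z2) ->
    g_x g x y1 z1 = g_x g x y2 z2 -> g (x, y1, z1) = g (x, y2, z2) ->
    (y1, z1) = (y2, z2).

Definition Emx g (x y : X) (z : R) : 'M[R]_n :=
  g_xy g x y z - (g_z g x y z)^-1 *: ((g_xz g x y z)^T *m g_y g x y z).

Definition A2 Gamma g : Prop :=
  forall x y z, Gamma (x, y, z) -> \det (Emx g x y z) != 0.

Definition Qmap g (y : X) (z : R) (x : X) : X :=
  - ((g_z g x y z)^-1 *: g_y g x y z).

Definition A1star Gamma g : Prop :=
  forall y z x1 x2, Gamma_yz Gamma y z x1 -> Gamma_yz Gamma y z x2 ->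
    Qmap g y z x1 = Qmap g y z x2 -> x1 = x2.

Definition Jset Gamma g (x y : X) : set R :=
  (fun z => g (x, y, z)) @` Iset Gamma x y.

Definition Gamma_star Gamma g : set (X * X * R) :=
  [set w | Jset Gamma g w.1.1 w.1.2 w.2].

(* The z in I(x, y) with g (x, y, z) = u (unique as g_z < 0); junk value 0
   outside Gamma_star. *)
Definition g_star Gamma g (x y : X) (u : R) : R :=
  xget 0 [set z | Iset Gamma x y z /\ g (x, y, z) = u].

Definition Uset Gamma g : set (X * R * X) :=
  [set w | exists y z, [/\ Gamma (w.1.1, y, z),
     w.1.2 = g (w.1.1, y, z) & w.2 = g_x g w.1.1 y z]].

(* The (y, z) solving g_x (x, y, z) = p, g (x, y, z) = u (unique under A1);
   junk value (0, 0) outside Uset. *)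
Definition YZmap Gamma g (x : X) (u : R) (p : X) : X * R :=
  xget (0, 0) [set yz | [/\ Gamma (x, yz.1, yz.2),
     g_x g x yz.1 yz.2 = p & g (x, yz.1, yz.2) = u]].

Definition Ymap Gamma g x u p : X := (YZmap Gamma g x u p).1.

Definition Zmap Gamma g x u p : R := (YZmap Gamma g x u p).2.

Definition Amx Gamma g (x : X) (u : R) (p : X) : 'M[R]_n :=
  g_xx g x (Ymap Gamma g x u p) (Zmap Gamma g x u p).

Definition A_twice_differentiable Gamma g : Prop :=
  forall i j, twice_differentiable_on (Uset Gamma g)
    (fun w => Amx Gamma g w.1.1 w.1.2 w.2 i j).

Definition A3w Gamma g : Prop :=
  forall x u p, Uset Gamma g (x, u, p) ->
  forall xi eta : X, dotv xi eta = 0 ->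
    0 <= \sum_i \sum_j \sum_k \sum_l
      'D_(basis_vec k) ('D_(basis_vec l) (fun q => Amx Gamma g x u q i j)) p
        * xi 0 i * xi 0 j * eta 0 k * eta 0 l.

Definition I_Omega Gamma (Omega : set X) (y0 : X) : set R :=
  \bigcap_(x in Omega) Iset Gamma x y0.

Definition g_convex Gamma g (Omega : set X) (u : X -> R) : Prop :=
  forall x0, Omega x0 -> exists y0 z0,
    [/\ I_Omega Gamma Omega y0 z0, u x0 = g (x0, y0, z0)
      & forall x, Omega x -> g (x, y0, z0) <= u x].

(* The first conjunct says that z0 = g_star x0 y0 (u x0) is defined. *)
Definition g_normal_mapping Gamma g (Omega : set X) (u : X -> R) (x0 : X)
    : set X :=
  [set y0 | let z0 := g_star Gamma g x0 y0 (u x0) in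
    [/\ Gamma_star Gamma g (x0, y0, u x0), Omega `<=` Gamma_yz Gamma y0 z0
      & forall x, Omega x -> g (x, y0, z0) <= u x]].

Definition sub_g_convex Gamma g (Omega : set X) (y0 : X) (z0 : R) : Prop :=
  I_Omega Gamma Omega y0 z0 /\
  convex_hull (Qmap g y0 z0 @` Omega)
    `<=` Qmap g y0 z0 @` Gamma_yz Gamma y0 z0.

Definition Sigma0 Gamma g (u : X -> R) (x0 : X) : set X :=
  Ymap Gamma g x0 (u x0) @` subdifferential u x0.

End generating_functions.

(* Main.v *)
(** The inclusion [Tu(x0) `<=` Sigma_0] is differentiation at [x0].  Conversely,
    let [S] be the set of [p \in \partial u(x0)] whose function [g(., Y, Z)] stays
    below [u] on [Omega].  It is closed, and for every direction [e] it contains a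
    maximiser of [p . e] over [\partial u(x0)]: a limit, as [t -> 0+], of
    gradients of [g]-supports of [u] at [x0 + t e].  If [S] is convex, then
    [S = \partial u(x0)] by separation.

    Convexity of [S] is Loeper's maximum principle.  Along a segment [p_s], let
    [theta] be the first maximiser of [h(s) = g(x, Y, Z)(p_s)], and join [x0] to
    [x] by the curve [x_t] on which [Q(., y_theta, z_theta)] is affine, which
    exists by sub [g]-convexity.  For [s] near [theta], let [k] and [pi] be the
    differences of [g] and [g_x] along the curve between the parameters [s] and
    [theta].  Then [v = - k / g_z] satisfies
      [v'' = (A(u + k, p + pi) - A(u, p) - A_u k - A_p . pi) x' . x' / (- g_z)].
    As [A] is convex in [p] only in directions orthogonal to [x'], [pi] is split
    into a part orthogonal to [x'] and a multiple of [x']; this yields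
    [v'' >= - eps (|v| + |v'|)] with [eps -> 0] as [s -> theta], uniformly in [t].
    From [v(0) = 0] and [v'(0) >= 0] one gets [v(1) >= 0], with strict inequality
    if [v'(0) > 0].  The sign of [v'(0)] is that of [s - theta] times a constant
    [a]: if [a <= 0] there is a maximiser of [h] smaller than [theta], and if
    [a > 0] then [h] exceeds its maximum to the right of [theta]. *)

From HB Require Import structures.
Require Import Defs.
From mathcomp Require Import all_boot all_order all_algebra.
From mathcomp Require Import all_classical all_reals all_analysis.
From mathcomp Require Import ring lra.
Import Order.TTheory GRing.Theory Num.Theory.
Import numFieldNormedType.Exports.
Local Open Scope classical_set_scope.
Local Open Scope ring_scope.

Set Implicit Arguments.
Unset Strict Implicit.
Unset Printing Implicit Defensive.

(** * One-variable calculus and mixed derivatives *)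

Section Curves.
Context {R : realType}.

(** The division by [- g_z] and the choice of the curve have one reason. For a fixed variation
    [(eta, zeta)] of [(y, z)], the quotient [(g_y . eta + g_z zeta) / (- g_z)] is [Q . eta - zeta],
    hence affine in [t] where [Q] is. So first order variations drop out of [v''], and what remains
    is the second order remainder of [A], to which A3w applies. Two obstacles shape the argument.
    Regularity: [g] is only C2, so [x_t] is only known to be C1, and the third derivatives of [g]
    that enter [v''] must be shown to exist; they come from differentiating [A] along [(x, g, g_x)]
    and a symmetry theorem that assumes one mixed derivative only. Geometry: the domain of [A] need
    not be convex in [p], so A3w is used only in small balls around the points [(x, g, g_x)] of the
    curve. The comparison is therefore local in [s], and the first maximiser turns it into a
    statement on the whole segment. On the unit interval [eps = 1/4] is already small enough. *)

Lemma is_derive_curve (V W : normedModType R) (f : V -> W) (c : R -> V)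
    (t : R) (c' : V) :
  is_derive t 1 c c' -> differentiable f (c t) ->
  is_derive t 1 (f \o c) ('D_c' f (c t)).
Proof.
move=> [dc <-] df.
have dc' : differentiable c t by apply/derivable1_diffP.
have dfc : differentiable (f \o c) t by exact: differentiable_comp.
apply: DeriveDef; first exact: diff_derivable.
by rewrite !deriveE// diff_comp.
Qed.

Lemma is_derive_line (V : normedModType R) (a v : V) (t : R) :
  is_derive t 1 (fun s : R => a + s *: v) v.
Proof.
have h : differentiable ( *:%R^~ v : R -> V) t by exact: ex_diff.
have dv : is_derive t 1 ( *:%R^~ v : R -> V) v.
  apply: DeriveDef; first exact: diff_derivable.
  by rewrite deriveE// diff_val scale1r.
by have := is_deriveD (is_derive_cst a t 1) dv; rewrite add0r.
Qed.

Lemma deriveDdir (V W : normedModType R) (f : V -> W) (a v w : V) :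
  differentiable f a -> 'D_(v + w) f a = 'D_v f a + 'D_w f a.
Proof. by move=> df; rewrite !deriveE// linearD. Qed.

Lemma deriveZdir (V : normedModType R) (f : V -> R) (a v : V) (k : R) :
  differentiable f a -> 'D_(k *: v) f a = k * 'D_v f a.
Proof. by move=> df; rewrite !deriveE// linearZ. Qed.

Lemma MVT_line (V : normedModType R) (f : V -> R) (a v : V) :
  (forall s : R, 0 <= s <= 1 -> differentiable f (a + s *: v)) ->
  exists2 s : R, 0 < s < 1 & f (a + v) - f a = 'D_v f (a + s *: v).
Proof.
move=> df.
have drv (s : R) : 0 <= s <= 1 ->
    is_derive s 1 (fun s : R => f (a + s *: v)) ('D_v f (a + s *: v)).
  by move=> s01; apply: (is_derive_curve (is_derive_line a v s)); exact: df.
have [s||s s01] := @MVT R (fun s : R => f (a + s *: v)) (fun s : R => 'D_v f (a + s *: v)) 0 1 ltr01.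
- by rewrite in_itv/= => /andP[s0 s1]; apply: drv; rewrite !ltW.
- apply: derivable_within_continuous => s; rewrite in_itv/= => s01.
  by have [] := drv _ s01.
rewrite /= scale1r scale0r addr0 subr0 mulr1 => ->.
by exists s => //; rewrite in_itv/= in s01.
Qed.

(** Two applications of the mean value theorem instead of an integral remainder: [f''] need not be
    continuous, since [A] is only twice differentiable. *)
Lemma tangent_le (f f' f'' : R -> R) :
  (forall t : R, 0 <= t <= 1 -> is_derive t 1 f (f' t)) ->
  (forall t : R, 0 <= t <= 1 -> is_derive t 1 f' (f'' t)) ->
  (forall t : R, 0 <= t <= 1 -> 0 <= f'' t) ->
  f 0 + f' 0 <= f 1.
Proof.
move=> df df' f''0.
have in01 (a b s : R) : 0 <= a -> b <= 1 -> s \in `]a, b[ -> 0 <= s <= 1.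
  by rewrite in_itv/= => a0 b1 /andP[??]; apply/andP; split; lra.
have cont (h h' : R -> R) (a b : R) : 0 <= a -> b <= 1 ->
    (forall t : R, 0 <= t <= 1 -> is_derive t 1 h (h' t)) ->
    {within `[a, b], continuous h}.
  move=> a0 b1 dh; apply: derivable_within_continuous => s.
  rewrite in_itv/= => /andP[??].
  by have [] := dh s; rewrite ?(le_trans a0)//=; lra.
have [s /[dup] s01 /(in01 0 1 _ (lexx _) (lexx _)) s01' e] :
    exists2 s, s \in `]0, 1[ & f 1 - f 0 = f' s * (1 - 0).
  apply: MVT => // [s /in01 h|]; first by apply: df; exact: h.
  exact: cont df.
move: (s01); rewrite in_itv/= => /andP[s0 s1].
have [r /[dup] r01 /(in01 0 s _ (lexx _) (ltW s1)) r01' e'] :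
    exists2 r, r \in `]0, s[ & f' s - f' 0 = f'' r * (s - 0).
  apply: MVT => // [r /in01 h|]; first by apply: df'; apply: h => //; lra.
  by apply: cont df' => //; lra.
have := mulr_ge0 (f''0 r r01') (ltW s0); lra.
Qed.

(* Evaluate [v'] at a point where [|v'|] is maximal on [[0, t]]: on this interval [|v| + |v'| <= 2 |v'|max], so [v'] drops by at most half of its maximal size. *)
Lemma small_lower_bound_derivative (v v' v'' : R -> R) :
  (forall t : R, 0 <= t <= 1 -> is_derive t 1 v (v' t)) ->
  (forall t : R, 0 <= t <= 1 -> is_derive t 1 v' (v'' t)) ->
  (forall t : R, 0 <= t <= 1 -> - (4%:R^-1 * (`|v t| + `|v' t|)) <= v'' t) ->
  v 0 = 0 -> 0 <= v' 0 ->
  forall t : R, 0 <= t <= 1 -> v' 0 / 2%:R <= v' t.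
Proof.
move=> dv dv' lb v0 v'0 t /andP[t0 t1].
have cont (h h' : R -> R) (a b : R) : 0 <= a -> b <= 1 ->
    (forall t : R, 0 <= t <= 1 -> is_derive t 1 h (h' t)) ->
    {within `[a, b], continuous h}.
  move=> a0 b1 dh; apply: derivable_within_continuous => s.
  rewrite in_itv/= => /andP[??].
  by have [] := dh s; rewrite ?(le_trans a0)//=; lra.
have mvt (h h' : R -> R) (a b : R) : 0 <= a -> a <= b -> b <= 1 ->
    (forall t : R, 0 <= t <= 1 -> is_derive t 1 h (h' t)) ->
    exists2 c, a <= c <= b & h b - h a = h' c * (b - a).
  move=> a0 ab b1 dh.
  have [|//|c] := MVT_segment ab (f := h) (df := h'); last first.
  - by rewrite in_itv/=; exists c.
  - exact: cont dh.
  - by move=> s; rewrite in_itv/= => /andP[??]; apply: dh; lra.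
have [t2] : exists2 c, c \in `[0, t]%R &
    forall s, s \in `[0, t]%R -> `|v' s| <= `|v' c|.
  apply: EVT_max => // s.
  by apply: continuous_comp; [exact: (cont _ _ _ _ (lexx 0) t1 dv')|exact: norm_continuous].
rewrite in_itv/= => /andP[t20 t2t] M.
set K := `|v' t2| in M.
have K0 : 0 <= K by exact: normr_ge0.
have vK (s : R) : 0 <= s <= t -> `|v s| <= K.
  move=> /andP[s0 st].
  have [c /andP[c0 cs]] := mvt _ _ _ _ (lexx 0) s0 (le_trans st t1) dv.
  rewrite v0 !subr0 => ->; rewrite normrM (ger0_norm s0).
  have := M c; rewrite in_itv/= c0 (le_trans cs st) => /(_ isT) cK.
  have s1 : s <= 1 by exact: le_trans st t1.
  by rewrite -[K]mulr1 ler_pM.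
have drop (a b : R) : 0 <= a -> a <= b -> b <= t -> v' b >= v' a - K / 2%:R.
  move=> a0 ab bt.
  have [c /andP[ac cb] e] := mvt _ _ _ _ a0 ab (le_trans bt t1) dv'.
  have ct : 0 <= c <= t by apply/andP; split; lra.
  have c1 : 0 <= c <= 1 by apply/andP; split; lra.
  have lbc : - (K / 2%:R) <= v'' c.
    have := M c; rewrite in_itv/= => /(_ ct) Mc.
    by apply: le_trans (lb c c1); have := vK c ct; lra.
  have ba : 0 <= b - a <= 1 by apply/andP; split; lra.
  have : - (K / 2%:R) <= v'' c * (b - a) by nra.
  lra.
(* If [v' t2] were negative, the drop from [0] to [t2] would give [- K >= v' 0 - K / 2] with
   [K > 0], which is impossible. So [v' t2 = K], and the drop from [t2] to [t] leaves at least
   [K / 2 >= v' 0 / 2]. *)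
have h1 := drop _ _ (lexx _) t20 t2t.
have h2 := drop _ _ t20 t2t (lexx _).
have := M 0; rewrite in_itv/= lexx t0 => /(_ isT); rewrite (ger0_norm v'0) => h3.
by move: h1 h2 h3 K0; rewrite /K; case: (ger0P (v' t2)) => *; lra.
Qed.

(** The explicit bound serves twice: it gives [v 1 >= 0] in all cases, and [v 1 > 0] when
    [v' 0 > 0]. *)
Lemma small_lower_bound_ge0 (v v' v'' : R -> R) :
  (forall t : R, 0 <= t <= 1 -> is_derive t 1 v (v' t)) ->
  (forall t : R, 0 <= t <= 1 -> is_derive t 1 v' (v'' t)) ->
  (forall t : R, 0 <= t <= 1 -> - (4%:R^-1 * (`|v t| + `|v' t|)) <= v'' t) ->
  v 0 = 0 -> 0 <= v' 0 ->
  v' 0 / 2%:R <= v 1.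
Proof.
move=> dv dv' lb v0 v'0.
have v'ge := small_lower_bound_derivative dv dv' lb v0 v'0.
have [|//|c] := @MVT_segment R v v' 0 1 ler01.
- by move=> s; rewrite in_itv/= => /andP[??]; apply: dv; lra.
- apply: derivable_within_continuous => s; rewrite in_itv/= => s01.
  by have [] := dv _ s01.
by rewrite in_itv/= v0 !subr0 mulr1 => /v'ge + ->.
Qed.

Lemma MVT_real (f f' : R -> R) (a h : R) :
  (forall t : R, `|t - a| <= `|h| -> is_derive t 1 f (f' t)) ->
  exists2 t, `|t - a| <= `|h| & f (a + h) - f a = f' t * h.
Proof.
move=> df.
have ball (s : R) : 0 <= s <= 1 -> `|a + s *: h - a| <= `|h|.
  move=> /andP[s0 s1]; rewrite addrC addKr normrZ (ger0_norm s0).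
  by rewrite ler_piMl.
have dfs (s : R) : 0 <= s <= 1 -> differentiable f (a + s *: h).
  by move=> /ball/df[+ _] => /derivable1_diffP.
have [s /andP[s0 s1] e] := MVT_line dfs.
have s01 : 0 <= s <= 1 by rewrite !ltW.
exists (a + s *: h); first exact: ball.
have [_ <-] := df _ (ball _ s01); rewrite e.
have := deriveZdir (1 : R) h (dfs _ s01).
by rewrite (_ : h *: 1 = h) ?(mulrC h)// -[LHS]/(h * 1) mulr1.
Qed.

(** Peano's version of the symmetry theorem: only one mixed derivative is assumed to exist, and the
    derivability of [f2] is part of the conclusion. The increment of [f2] is the limit in [l] of a
    second difference divided by [l], and two mean value steps turn this quotient into [h * f12] at
    a point close to [(a, b)]. *)
Lemma schwarz_derive (f f1 f12 : R -> R -> R) (f2 : R -> R) (a b : R) :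
  (\forall p \near ((a, b) : R * R), is_derive (p.1 : R) 1 (f ^~ p.2) (f1 p.1 p.2)) ->
  (\forall p \near ((a, b) : R * R), is_derive (p.2 : R) 1 (f1 p.1) (f12 p.1 p.2)) ->
  {for ((a, b) : R * R), continuous (fun p : R * R => f12 p.1 p.2)} ->
  (\forall t \near (a : R), is_derive b 1 (f t) (f2 t)) ->
  is_derive a 1 f2 (f12 a b).
Proof.
move=> df1 df12 c12 df2.
have df2a := nbhs_singleton df2.
suff lim : h^-1 *: ((f2 \o shift a) (h *: 1) - f2 a) @[h --> 0^'] --> f12 a b.
  apply: DeriveDef; first by apply/cvg_ex; exists (f12 a b).
  by apply/cvg_lim.
apply/cvgrPdist_le => /= e e0.
have near_ab : \forall p \near ((a, b) : R * R),
    [/\ is_derive (p.1 : R) 1 (f ^~ p.2) (f1 p.1 p.2),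
      is_derive (p.2 : R) 1 (f1 p.1) (f12 p.1 p.2)
      & `|f12 a b - f12 p.1 p.2| <= e].
  near=> p; split; [near: p; exact: df1|near: p; exact: df12|].
  by near: p; move/cvgrPdist_le : c12 => /(_ e e0).
move/nbhs_ballP : near_ab => [r /= r0 Hr].
have [r2 /= r20 Hr2] := df2.
have sq (t s : R) : `|t - a| < r -> `|s - b| < r -> 
    [/\ is_derive t 1 (f ^~ s) (f1 t s),
      is_derive s 1 (f1 t) (f12 t s)
      & `|f12 a b - f12 t s| <= e].
  by move=> ta sb; apply: (Hr (t, s)); split; rewrite /ball/= distrC.
near=> h.
have hr : `|h| < r by near: h; exact: dnbhs0_lt.
have h0 : h != 0 by near: h; exact: nbhs_dnbhs_neq.
have h2 : `|h| < r2 by near: h; exact: dnbhs0_lt.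
have df2h : is_derive b 1 (f (a + h)) (f2 (a + h)).
  by apply: Hr2; rewrite /ball/= opprD addNKr normrN.
suff le_he : `|h * f12 a b - (f2 (a + h) - f2 a)| <= `|h| * e.
  rewrite /= [h *: 1]mulr1 (addrC h) -(ler_pM2l (_ : 0 < `|h|)) ?normr_gt0//.
  by rewrite -normrM mulrBr -[h * (_ *: _)]/(h * (_ * _)) mulrA divff// mul1r.
have dphi := is_deriveB df2h df2a.
have [/cvg_ex[/= y cy] dy] := dphi.
have {}dy : y = f2 (a + h) - f2 a by rewrite -dy; apply/esym/cvg_lim.
rewrite {}dy in cy; apply/ler_addgt0Pr => d d0.
pose Q (l : R) :=
  l^-1 * ((f (a + h) (b + l) - f a (b + l)) - (f (a + h) b - f a b)).
have Qd : \forall l \near (0 : R)^', `|f2 (a + h) - f2 a - Q l| <= d.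
  move/cvgrPdist_le : cy => /(_ d d0); apply: filterS => l.
  by rewrite /= [l *: 1]mulr1 (addrC l).
near (0 : R)^' => l.
have lr : `|l| < r by near: l; exact: dnbhs0_lt.
have l0 : l != 0 by near: l; exact: nbhs_dnbhs_neq.
have qd : `|f2 (a + h) - f2 a - Q l| <= d by near: l.
have [t ta et] : exists2 t, `|t - a| <= `|h| &
    (f (a + h) (b + l) - f (a + h) b) - (f a (b + l) - f a b) =
    (f1 t (b + l) - f1 t b) * h.
  apply: (@MVT_real (fun t => f t (b + l) - f t b)
    (fun t => f1 t (b + l) - f1 t b)) => t ta.
  have tr : `|t - a| < r by exact: le_lt_trans ta _.
  apply: is_deriveB; first by have [] := sq t (b + l) tr; rewrite // (addrC b) addrK.
  by have [] := sq t b tr; rewrite // subrr normr0.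
have tr : `|t - a| < r by exact: le_lt_trans ta _.
have [s sb es] : exists2 s, `|s - b| <= `|l| &
    f1 t (b + l) - f1 t b = f12 t s * l.
  apply: MVT_real => s sb.
  by have [] := sq t s tr (le_lt_trans sb lr).
have eq : Q l = h * f12 t s.
  rewrite /Q.
  have -> : f (a + h) (b + l) - f a (b + l) - (f (a + h) b - f a b) =
     (f (a + h) (b + l) - f (a + h) b) - (f a (b + l) - f a b) by ring.
  by rewrite et es; field.
have [_ _ He] := sq t s tr (le_lt_trans sb lr).
have -> : h * f12 a b - (f2 (a + h) - f2 a) =
    h * (f12 a b - f12 t s) - (f2 (a + h) - f2 a - Q l) by rewrite eq; ring.
by rewrite (le_trans (ler_normB _ _))// lerD// normrM ler_wpM2l.
Unshelve. all: by end_near. Qed.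

End Curves.

(** * Local inversion *)

Section InverseMapping.
Context {R : realType}.

Lemma is_derive_bigsum (V : normedModType R) (I : Type) (r : seq I)
    (h : I -> V -> R) (dh : I -> R) (x v : V) :
  (forall i, is_derive x v (h i) (dh i)) ->
  is_derive x v (fun w => \sum_(i <- r) h i w) (\sum_(i <- r) dh i).
Proof.
move=> dhi; elim: r => [|i r IHr].
  rewrite big_nil (_ : (fun _ => _) = cst 0); last by apply/funext => w; rewrite big_nil.
  exact: is_derive_cst.
rewrite big_cons (_ : (fun _ => _) = h i + (fun w => \sum_(i <- r) h i w)).
  exact: is_deriveD.
by apply/funext => w; rewrite big_cons.
Qed.

Lemma differentiable_bigsum (V : normedModType R) (I : Type) (r : seq I)
    (h : I -> V -> R) (x : V) :
  (forall i, differentiable (h i) x) ->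
  differentiable (fun w => \sum_(i <- r) h i w) x.
Proof.
move=> dhi; elim: r => [|i r IHr].
  rewrite (_ : (fun _ => _) = cst 0); first exact: differentiable_cst.
  by apply/funext => w; rewrite big_nil.
rewrite (_ : (fun _ => _) = h i + (fun w => \sum_(i <- r) h i w)).
  exact: differentiableD.
by apply/funext => w; rewrite big_cons.
Qed.

(* Minimise [sum_i (F_i - t_i)^2] over a small closed ball: by injectivity the minimum is not on the sphere, and at an interior minimum the transposed derivative kills [F - t]. *)
Lemma open_at_injective_nondegenerate (V : normedModType R) (I : finType)
    (F : I -> V -> R) (D : set V) (w0 : V) :
  (forall r : R, 0 < r -> compact (closed_ball w0 r)) ->
  open D -> D w0 ->
  (forall i w, D w -> differentiable (F i) w) ->
  (forall w, D w -> (forall i, F i w = F i w0) -> w = w0) ->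
  (forall w, D w -> forall a : I -> R,
     (forall v, \sum_i a i * 'D_v (F i) w = 0) -> forall i, a i = 0) ->
  forall N, nbhs w0 N -> exists2 e : R, 0 < e &
    forall t : I -> R, (forall i, `|t i - F i w0| < e) ->
      exists w, [/\ N w, D w & forall i, F i w = t i].
Proof.
move=> cB oD Dw0 dF inj nd N Nw0.
have /nbhs_closedballP[r rND] : nbhs w0 (N `&` D).
  by apply: filterI => //; exact: open_nbhs_nbhs.
set B := closed_ball w0 r%:num in rND.
have cptB : compact B by exact: cB.
have BD : B `<=` D by move=> w /rND[].
pose G (t : I -> R) w := \sum_i (F i w - t i) ^+ 2.
have dsq i c w : D w -> differentiable (fun w => (F i w - c) ^+ 2) w.
  move=> Dw.
  have dFc : differentiable (F i - cst c) w.
    by apply: differentiableB; [exact: dF|exact: differentiable_cst].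
  rewrite (_ : (fun _ => _) = (F i - cst c) * (F i - cst c)).
    exact: differentiableM.
  by apply/funext => v; rewrite expr2.
have dG t w : D w -> differentiable (G t) w.
  by move=> Dw; apply: differentiable_bigsum => i; exact: dsq.
have cG t : {within B, continuous (G t)}.
  apply: continuous_in_subspaceT => w; rewrite inE => /BD Dw.
  exact/differentiable_continuous/dG.
have G0 t w : 0 <= G t w by apply: sumr_ge0 => i _; exact: sqr_ge0.
have Geq t w : G t w = 0 -> forall i, F i w = t i.
  move=> e i; apply/eqP; rewrite -subr_eq0 -sqrf_eq0; apply/eqP.
  by apply: (psumr_eq0P _ e) => // j _; exact: sqr_ge0.
(* This is [|F w - F w0|^2 <= 2 |F w - t|^2 + 2 |F w0 - t|^2]: a lower bound for the single target
   [F w0] controls all nearby targets [t]. *)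
have half t w : G (F^~ w0) w / 2%:R - G t w0 <= G t w.
  rewrite mulr_suml -sumrB ler_sum// => i _.
  have := sqr_ge0 (F i w0 - t i + (F i w0 - t i) + (F i w - F i w0)); nra.
pose S := B `&` ~` ball w0 r%:num.
have cptS : compact S.
  apply: compact_closedI => //; exact/open_closedC/ball_open.
have [c c0 cS] : exists2 c : R, 0 < c & forall w, S w -> c <= G (F^~ w0) w.
  have [S0|/set0P S0] := eqVneq S set0.
    by exists 1 => // w; rewrite S0.
  have cGS : {within S, continuous (G (F^~ w0))}.
    apply: continuous_subspaceW (cG _); exact: subIsetl.
  have [w wS wmin] := compact_EVT_min S0 cptS cGS.
  exists (G (F^~ w0) w); last by move=> v Sv; apply: wmin; rewrite inE.
  rewrite lt_neqAle G0 andbT eq_sym; apply/eqP => /Geq e.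
  move: wS; rewrite inE => -[/BD Dw]; apply; rewrite (inj w Dw e).
  exact: ballxx.
(* With [e <= 1] each summand of [G t w0] is at most [e], so [G t w0 < c / 4]; the extra [1] makes
   this strict, also for empty [I]. On [S], [half] then gives [G t w > c / 4], so the minimiser lies
   in the open ball. *)
pose e := Num.min 1 (c / (4%:R * (#|I|%:R + 1))).
have k0 : 0 < (#|I|%:R + 1 : R) by rewrite ltr_wpDl.
have e0 : 0 < e by rewrite lt_min ltr01/= divr_gt0// mulr_gt0.
have e1 : e <= 1 by rewrite ge_min lexx.
have ec : (#|I|%:R + 1) * e <= c / 4%:R.
  rewrite -ler_pdivlMl// (le_trans (_ : e <= c / (4%:R * (#|I|%:R + 1))))//.
    by rewrite ge_min lexx orbT.
  by rewrite invfM mulrA mulrC.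
exists e => // t te.
have Gt0 : G t w0 < c / 4%:R.
  apply: lt_le_trans ec.
  apply: (@le_lt_trans _ _ (\sum_(i : I) e)).
    apply: ler_sum => i _; apply: (@le_trans _ _ (`|t i - F i w0| ^+ 2)).
      by rewrite -(sqrrN (_ - _)) opprB real_normK// num_real.
    have := te i; have := normr_ge0 (t i - F i w0); nra.
  by rewrite sumr_const -[e *+ _]mulr_natl ltr_pM2r// ltrDl.
have Bw0 : B w0 by exact: closed_ballxx.
have B0 : B !=set0 by exists w0.
have [w] := compact_EVT_min B0 cptB (cG t).
rewrite inE => Bw wmin.
have bw : ball w0 r%:num w.
  apply: contrapT => nbw.
  have := half t w; have := cS w (conj Bw nbw).
  have := wmin w0; rewrite inE => /(_ Bw0); lra.
have Dw := BD _ Bw.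
exists w; split=> //; first by have [] := rND _ Bw.
suff h i : 2%:R * (F i w - t i) = 0.
  by move=> i; apply/eqP; rewrite -subr_eq0; have /eqP := h i; rewrite mulf_eq0 pnatr_eq0.
move: i; apply: (nd w Dw) => v.
have dGv : is_derive w v (G t) (\sum_i 2%:R * (F i w - t i) * 'D_v (F i) w).
  apply: is_derive_bigsum => i.
  have dFi : is_derive w v (F i) ('D_v (F i) w).
    by apply/derivableP/diff_derivable/dF.
  have dFc := is_deriveB dFi (is_derive_cst (t i) w v).
  have := is_deriveX 2 dFc; rewrite subr0 expr1.
  by rewrite (_ : (F i - cst (t i)) ^+ 2 = (fun w => (F i w - t i) ^+ 2))//.
have [_ <-] := dGv.
have : \forall s \near (0 : R), ball w0 r%:num (w + s *: v).
  have cv : {for 0, continuous (fun s : R => w + s *: v)}.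
    by apply/differentiable_continuous/derivable1_diffP; have [] := is_derive_line w v 0.
  apply: cv; rewrite /= scale0r addr0.
  by apply: open_nbhs_nbhs; split=> //; exact: ball_open.
move=> /nbhs_ballP[/= d d0 wd].
have dl (s : R) : s \in `]-d, d[%R -> is_derive s (1:R) (fun s : R => G t (w + s *: v)) ('D_v (G t) (w + s *: v)).
  rewrite in_itv/= -ltr_norml => sd.
  apply: (is_derive_curve (is_derive_line w v s)); apply/dG/BD/subset_closed_ball.
  by apply: wd; rewrite /ball/= sub0r normrN.
have : is_derive (0:R) (1:R) (fun s : R => G t (w + s *: v)) 0.
  apply: (@derive1_at_min _ _ (- d) d); first by rewrite ge0_cp// ltW.
  - by move=> s /dl[].
  - by rewrite in_itv/= oppr_lt0 d0.
  move=> s; rewrite in_itv/= -ltr_norml => sd.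
  rewrite scale0r addr0; apply: wmin; rewrite inE.
  by apply/subset_closed_ball/wd; rewrite /ball/= sub0r normrN.
have [|_ e2] := dl 0; first by rewrite in_itv/= oppr_lt0 d0.
by move=> [_]; rewrite e2 scale0r addr0.
Qed.

End InverseMapping.

(** * Limits of determinants and of inverse matrices *)

Section MatrixLimits.
Context {R : realType}.

Lemma coord_le_mx_norm m n (A : 'M[R]_(m, n)) i j : `|A i j| <= `|A|.
Proof.
rewrite [leRHS]/Num.Def.normr/= mx_normrE.
exact: (le_bigmax _ (fun k : 'I_m * 'I_n => `|A k.1 k.2|) (i, j)).
Qed.

Lemma mx_norm_lt m n (A : 'M[R]_(m, n)) (e : R) :
  0 < e -> (forall i j, `|A i j| < e) -> `|A| < e.
Proof.
move=> e0 Ae; rewrite [ltLHS]/Num.Def.normr/= mx_normrE.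
by apply: bigmax_lt => //= -[i j] _; exact: Ae.
Qed.

Context {T : Type} {F : set_system T} {FF : Filter F}.

Lemma det_cvg n (M : T -> 'M[R]_n) (M0 : 'M[R]_n) :
  (forall i j, M x i j @[x --> F] --> M0 i j) ->
  \det (M x) @[x --> F] --> \det M0.
Proof.
move=> cM; rewrite /determinant.
apply: cvg_big => [|s _]; first exact: add_continuous.
apply: cvgMr; apply: cvg_big => [|i _]; first exact: mul_continuous.
exact: cM.
Qed.

Lemma invmx_cvg n (M : T -> 'M[R]_n) (M0 : 'M[R]_n) : M0 \in unitmx ->
  (forall i j, M x i j @[x --> F] --> M0 i j) ->
  forall i j, invmx (M x) i j @[x --> F] --> invmx M0 i j.
Proof.
move=> uM0 cM i j.
have d0 : \det M0 != 0 by rewrite -unitfE -unitmxE.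
have cd := det_cvg cM.
(* [invmx] returns its argument on singular matrices, so the adjugate formula is valid only where
   the determinant stays nonzero. *)
have near_unit : \forall x \near F, M x \in unitmx.
  near=> x; rewrite unitmxE unitfE; near: x.
  exact: cvgr_neq0 cd d0.
apply: (@cvg_trans _ ((\det (M x))^-1 * \adj (M x) i j @[x --> F])).
  apply: near_eq_cvg; near=> x; have ux : M x \in unitmx by near: x.
  by rewrite /invmx ux [RHS]mxE.
rewrite /invmx uM0 !mxE; apply: cvgM; first exact: cvgV.
under eq_cvg do rewrite mxE.
rewrite /cofactor; apply: cvgMr; apply: det_cvg => k l.
by under eq_cvg do rewrite !mxE; rewrite !mxE; exact: cM.
Unshelve. all: by end_near. Qed.

Lemma mulmx_cvg m n p (A : 'M[R]_(m, n)) (M : T -> 'M[R]_(n, p))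
    (M0 : 'M[R]_(n, p)) :
  (forall i j, M x i j @[x --> F] --> M0 i j) ->
  forall i j, (A *m M x) i j @[x --> F] --> (A *m M0) i j.
Proof.
move=> cM i j; rewrite mxE; under eq_cvg do rewrite mxE.
by apply: cvg_big => [|k _]; [exact: add_continuous|exact: cvgMr].
Qed.

Lemma mx_cvg m n (M : T -> 'M[R]_(m, n)) (M0 : 'M[R]_(m, n)) :
  (forall i j, M x i j @[x --> F] --> M0 i j) -> M x @[x --> F] --> M0.
Proof.
move=> cM; apply/cvgrPdist_lt => e e0.
have : \forall x \near F, forall k : 'I_m * 'I_n, `|M0 k.1 k.2 - M x k.1 k.2| < e.
  apply: filter_forall => k.
  by have /cvgrPdist_lt/(_ e e0) := cM k.1 k.2.
apply: filterS => x Mx; apply: mx_norm_lt => // i j.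
by rewrite !mxE; exact: (Mx (i, j)).
Qed.

End MatrixLimits.

(** * Curves mapped to straight lines by an injective C1 map with invertible Jacobian *)

Section InverseCurve.
Context {R : realType} {n : nat}.
Notation X := 'rV[R]_n.

(** [L] stands for the identity or for the inclusion of a factor of a product, so that one expansion
    serves the variables [x], [y] and [p] alike. *)
Lemma derive_coord (V : normedModType R) (L : X -> V) (f : V -> R) (a : V) (v : X) :
  (forall k u w, L (k *: u + w) = k *: L u + L w) ->
  differentiable f a ->
  'D_(L v) f a = \sum_i v 0 i * 'D_(L (basis_vec i)) f a.
Proof.
move=> linL df.
pose LL : {linear X -> V} := HB.pack L (GRing.isLinear.Build R X V _ L linL).
rewrite -[L]/(LL : X -> V) {1}(row_sum_delta v) linear_sum deriveE// linear_sum.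
by apply: eq_bigr => i _; rewrite !linearZ/= deriveE.
Qed.

Variables (D : set X) (F : 'I_n -> X -> R).
Hypothesis oD : open D.
Hypothesis F_C1 : forall j, C1_on D (F j).
Hypothesis F_inj : forall x y, D x -> D y -> (forall j, F j x = F j y) -> x = y.
Let J (x : X) : 'M[R]_n := \matrix_(i, j) 'D_(basis_vec i) (F j) x.
Hypothesis J_unit : forall x, D x -> J x \in unitmx.

Lemma closed_ball_rV_compact (x : X) (r : R) : 0 < r -> compact (closed_ball x r).
Proof.
move=> r0; apply: bounded_closed_compact; last exact: closed_ball_closed.
rewrite closed_ballE//; exists (`|x| + r); split; first exact: num_real.
move=> M xM y /= xy; rewrite (le_trans _ (ltW xM))// -(addrNK x y) addrC.
by rewrite (le_trans (ler_normD _ _))// lerD// distrC.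
Qed.

Lemma inverse_open (x : X) (N : set X) : D x -> nbhs x N ->
  exists2 e : R, 0 < e & forall t : 'I_n -> R, (forall i, `|t i - F i x| < e) ->
    exists w, [/\ N w, D w & forall i, F i w = t i].
Proof.
move=> Dx; apply: open_at_injective_nondegenerate => //.
- exact: closed_ball_rV_compact.
- by move=> i w; have [+ _] := F_C1 i; exact.
- by move=> w Dw; exact: F_inj.
move=> w Dw a a0 i.
have Ja : J w *m \col_j a j = 0.
  apply/matrixP => k l; rewrite !mxE -[RHS](a0 (basis_vec k)).
  by apply: eq_bigr => j _; rewrite !mxE mulrC.
have /matrixP/(_ i 0) : \col_j a j = 0 by rewrite -(mulKmx (J_unit Dw) (\col_j a j)) Ja mulmx0.
by rewrite !mxE.
Qed.

Variables (q0 dq : X) (c : R -> X) (T : set R).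
Hypothesis oT : open T.
Hypothesis Dc : forall t, T t -> D (c t).
Hypothesis Fc : forall t j, T t -> F j (c t) = q0 0 j + t * dq 0 j.

(** Apart from staying in [D], [c] is known only through the values of [F] on it. Openness of [F] at
    [c t] yields a point near [c t] with the values [F (c s)], and injectivity identifies this point
    with [c s]. *)
Lemma inverse_curve_continuous (t : R) : T t -> {for t, continuous c}.
Proof.
move=> Tt N Nct; have [e e0 He] := inverse_open (Dc Tt) Nct.
have d0 : 0 < `|dq| + 1 by rewrite ltr_wpDl.
suff : \forall s \near t, N (c s) by [].
near=> s.
have Ts : T s by near: s; exact: open_nbhs_nbhs.
have [i|w [Nw Dw Fw]] := He (fun i => F i (c s)).
  rewrite !Fc//.
  have -> : q0 0 i + s * dq 0 i - (q0 0 i + t * dq 0 i) = (s - t) * dq 0 i by ring.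
  rewrite normrM.
  have st : `|s - t| < e / (`|dq| + 1).
    by near: s; apply: cvgr_distC_lt; [exact: cvg_id|exact: divr_gt0].
  rewrite ltr_pdivlMr// in st; apply: le_lt_trans st.
  by rewrite ler_wpM2l// (le_trans (coord_le_mx_norm _ _ _))// lerDl.
by rewrite -(F_inj Dw (Dc Ts) Fw).
Unshelve. all: by end_near. Qed.

(** The mean value theorem is applied to each [F j] at its own intermediate point, so the columns of
    [B] are evaluated at different points. All these points tend to [c t], hence [B] tends to
    [J (c t)], and [v *m B = h *: dq] is solved for the increment [v]. *)
Lemma is_derive_inverse_curve (t : R) :
  T t -> is_derive t 1 c (dq *m invmx (J (c t))).
Proof.
move=> Tt.
suff lim : h^-1 *: ((c \o shift t) (h *: 1) - c t) @[h --> 0^'] -->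
    dq *m invmx (J (c t)).
  apply: DeriveDef; first by apply/cvg_ex; eexists; exact: lim.
  by apply/cvg_lim.
apply/cvgrPdist_lt => e e0.
have : \forall B \near J (c t),
    B \in unitmx /\ `|dq *m invmx (J (c t)) - dq *m invmx B| < e.
  have uJ := J_unit (Dc Tt).
  have cB i j : (fun B : 'M[R]_n => B i j) @ J (c t) --> J (c t) i j.
    exact: coord_continuous.
  near=> B; split.
    rewrite unitmxE unitfE; near: B; apply: cvgr_neq0 (det_cvg cB) _.
    by rewrite -unitfE -unitmxE.
  near: B; move: e e0; apply/cvgrPdist_lt.
  by apply: mx_cvg; apply: mulmx_cvg; exact: invmx_cvg.
move=> /nbhs_normP[d /= d0 Hd].
have : \forall x \near c t, D x /\ forall ij : 'I_n * 'I_n,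
    `|J (c t) ij.1 ij.2 - 'D_(basis_vec ij.1) (F ij.2) x| < d.
  near=> x; split.
    by near: x; apply: open_nbhs_nbhs; split=> //; exact: Dc.
  near: x; apply: filter_forall => -[i j]; rewrite mxE/=.
  have [_ cF] := F_C1 j.
  by have /cvgrPdist_lt/(_ d d0) := cF (basis_vec i) _ (Dc Tt).
move=> /nbhs_normP[r /= r0 Hr].
have ct : \forall h \near (0 : R)^', `|c t - c (h + t)| < r.
  have /cvgrPdist_lt/(_ r r0) := inverse_curve_continuous Tt.
  move=> /nbhs_normP[r' /= r'0 Hr'].
  near=> h; apply: Hr'; rewrite /= opprD addrCA subrr addr0 normrN.
  by near: h; exact: dnbhs0_lt.
have Tth : \forall h \near (0 : R)^', T (h + t).
  have /nbhs_normP[r' /= r'0 Hr'] : \forall s \near t, T s by exact: open_nbhs_nbhs.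
  near=> h; apply: Hr'; rewrite /= opprD addrCA subrr addr0 normrN.
  by near: h; exact: dnbhs0_lt.
near=> h.
have h0 : h != 0 by near: h; exact: nbhs_dnbhs_neq.
have Th : T (h + t) by near: h.
rewrite /= [h *: 1]mulr1; set v := c (h + t) - c t.
have vr : `|v| < r by rewrite distrC; near: h.
have inr (s : R) : 0 <= s <= 1 -> `|c t - (c t + s *: v)| < r.
  move=> /andP[s0 s1]; rewrite opprD addrA subrr sub0r normrN normrZ ger0_norm//.
  by apply: le_lt_trans vr; rewrite ler_piMl.
have /choice[s Hs] : forall j, exists s : R, 0 <= s <= 1 /\
    F j (c (h + t)) - F j (c t) = 'D_v (F j) (c t + s *: v).
  move=> j; have [|s /andP[s0 s1] es] := @MVT_line _ _ (F j) (c t) v.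
    by move=> s /inr/Hr[Ds _]; have [+ _] := F_C1 j; exact.
  by exists s; rewrite -es (_ : c t + v = c (h + t)) ?ltW// /v addrC subrK.
pose B : 'M[R]_n := \matrix_(i, j) 'D_(basis_vec i) (F j) (c t + s j *: v).
have JB : `|J (c t) - B| < d.
  apply: mx_norm_lt => // i j; rewrite [_ i j]mxE [(- B) i j]mxE [B i j]mxE.
  by have [_ /(_ (i, j))] := Hr _ (inr _ (Hs j).1).
have [uB HB] := Hd _ JB.
suff -> : v = (h *: dq) *m invmx B by rewrite -scalemxAl scalerK.
suff <- : v *m B = h *: dq by rewrite mulmxK.
apply/rowP => j; have [s01 es] := Hs j.
have [Ds _] := Hr _ (inr _ s01).
have dFj : differentiable (F j) (c t + s j *: v) by have [+ _] := F_C1 j; exact.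
have -> : (h *: dq) 0 j = 'D_v (F j) (c t + s j *: v).
  by rewrite -es !Fc// mxE; ring.
rewrite mxE.
rewrite (@derive_coord _ id)//.
by apply: eq_bigr => i _; rewrite [B i j]mxE.
Unshelve. all: by end_near. Qed.

Lemma inverse_curve_derive_continuous (t : R) : T t ->
  forall j, {for t, continuous (fun s => (dq *m invmx (J (c s))) 0 j)}.
Proof.
move=> Tt j.
apply: (mulmx_cvg (A := dq)); apply: (invmx_cvg (J_unit (Dc Tt))) => i k.
rewrite mxE; under eq_cvg do rewrite [J _ _ _]mxE.
have [_ cF] := F_C1 k.
have := @continuous_comp _ _ _ c ('D_(basis_vec i) (F k)) t.
by apply; [exact: inverse_curve_continuous|exact/cF/Dc].
Qed.

End InverseCurve.

(* Locked, because unifying two unlocked derivatives unfolds their limits. *)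
HB.lock Definition ddir1 (R : realType) (V : normedModType R) (f : V -> R)
  (v w : V) : R := 'D_v f w.

HB.lock Definition ddir2 (R : realType) (V : normedModType R) (f : V -> R)
  (v a w : V) : R := 'D_v ('D_a f) w.

Lemma ddir1E (R : realType) (V : normedModType R) (f : V -> R) v :
  ddir1 f v = 'D_v f.
Proof. by rewrite ddir1.unlock. Qed.

Lemma ddir1_at (R : realType) (V : normedModType R) (f : V -> R) v w :
  ddir1 f v w = 'D_v f w.
Proof. by rewrite ddir1E. Qed.

Lemma ddir2E (R : realType) (V : normedModType R) (f : V -> R) v a :
  ddir2 f v a = 'D_v (ddir1 f a).
Proof. by rewrite ddir2.unlock ddir1.unlock. Qed.

(** * Symmetry of second directional derivatives *)

Section C2.
Context {R : realType} {V : normedModType R}.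
Variables (D : set V) (f : V -> R).
Hypotheses (oD : open D) (f_C2 : C2_on D f).

Notation D1 := (ddir1 f).
Notation D2 := (ddir2 f).

Lemma C2_differentiable w : D w -> differentiable f w.
Proof. by have [[+ _] _] := f_C2; exact. Qed.

Lemma C2_differentiable1 v w : D w -> differentiable (D1 v) w.
Proof. by rewrite ddir1E; have [_ /(_ v)[+ _]] := f_C2; exact. Qed.

Lemma C2_continuous2 u v w : D w -> {for w, continuous (D2 u v)}.
Proof. by rewrite ddir2.unlock; have [_ /(_ v)[_ +]] := f_C2; exact. Qed.

Lemma ddir1D v a w : D w -> D1 (v + a) w = D1 v w + D1 a w.
Proof. by move=> Dw; rewrite !ddir1E deriveDdir//; exact: C2_differentiable. Qed.

Lemma ddir1Z k v w : D w -> D1 (k *: v) w = k * D1 v w.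
Proof. by move=> Dw; rewrite !ddir1E deriveZdir//; exact: C2_differentiable. Qed.

Lemma ddir2Dl v b a w : D w -> D2 (v + b) a w = D2 v a w + D2 b a w.
Proof. by move=> Dw; rewrite !ddir2E deriveDdir//; exact: C2_differentiable1. Qed.

Lemma ddir2Zl k v a w : D w -> D2 (k *: v) a w = k * D2 v a w.
Proof. by move=> Dw; rewrite !ddir2E deriveZdir//; exact: C2_differentiable1. Qed.

Lemma ddir2_sym a b w : D w -> D2 a b w = D2 b a w.
Proof.
move=> Dw; rewrite !ddir2E.
have cw : (fun p : R * R => w + p.1 *: a + p.2 *: b) @ ((0, 0) : R * R) --> w.
  have -> : nbhs w = nbhs (w + (0 : R) *: a + (0 : R) *: b).
    by rewrite !scale0r !addr0.
  apply: cvgD; last by apply: cvgZr_tmp; exact: cvg_snd.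
  by apply: cvgD; [exact: cvg_cst|apply: cvgZr_tmp; exact: cvg_fst].
have nearD : \forall p \near ((0, 0) : R * R), D (w + p.1 *: a + p.2 *: b).
  by apply: cw; exact: open_nbhs_nbhs.
have nearD0 : \forall t \near (0 : R), D (w + t *: a).
  have cw0 : (fun t : R => w + t *: a) @ (0 : R) --> w.
    have -> : nbhs w = nbhs (w + (0 : R) *: a) by rewrite scale0r addr0.
    by apply: cvgD; [exact: cvg_cst|apply: cvgZr_tmp; exact: cvg_id].
  by apply: cw0; exact: open_nbhs_nbhs.
have H := @schwarz_derive R (fun t s => f (w + t *: a + s *: b))
  (fun t s => D1 a (w + t *: a + s *: b))
  (fun t s => D2 b a (w + t *: a + s *: b))
  (fun t => D1 b (w + t *: a)) 0 0.
have {H}[||||_ e] := H.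
- near=> p.
  rewrite (_ : (fun _ => _) = (fun t : R => f ((w + p.2 *: b) + t *: a))); last first.
    by apply/funext => t; rewrite addrAC.
  rewrite ddir1E (addrAC w); apply: (is_derive_curve (is_derive_line _ a p.1)).
  by rewrite addrAC; apply: C2_differentiable; near: p.
- near=> p; rewrite ddir2E.
  apply: (is_derive_curve (is_derive_line _ b p.2)).
  by apply: C2_differentiable1; near: p.
- have := @cvg_comp _ _ _ (fun p : R * R => w + p.1 *: a + p.2 *: b)
    (D2 b a) _ _ _ cw (@C2_continuous2 b a _ Dw).
  by rewrite /= /prop_for /continuous_at /= !scale0r !addr0.
- near=> t; rewrite ddir1E -[X in 'D_b f X]addr0.
  rewrite -[X in 'D_b f (_ + X)](scale0r b).
  apply: (is_derive_curve (is_derive_line _ b 0)).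
  by rewrite scale0r addr0; apply: C2_differentiable; near: t.
have d2 : is_derive (0 : R) (1 : R) (fun t : R => D1 b (w + t *: a))
    ('D_a (D1 b) (w + 0 *: a)).
  apply: (is_derive_curve (is_derive_line _ a 0)).
  by rewrite scale0r addr0; exact: C2_differentiable1.
have w0 : w + (0 : R) *: a = w by rewrite scale0r addr0.
have w00 : w + (0 : R) *: a + (0 : R) *: b = w by rewrite w0 scale0r addr0.
have [_ e2] := d2; rewrite w0 in e2; rewrite w00 in e.
by rewrite -e2 e ddir2E.
Unshelve. all: by end_near. Qed.

End C2.

Lemma differentiable_fst (R : realType) (U W : normedModType R) (p : U * W) :
  differentiable (fst : U * W -> U) p.
Proof.
have /linear_differentiable : continuous (fst : {linear (U * W)%type -> U}).
  by move=> q; exact: cvg_fst.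
exact.
Qed.

Lemma closed_ball_prod_compact (R : realType) (U W : normedModType R)
    (p : U * W) :
  (forall r : R, 0 < r -> compact (closed_ball p.1 r)) ->
  (forall r : R, 0 < r -> compact (closed_ball p.2 r)) ->
  forall r : R, 0 < r -> compact (closed_ball p r).
Proof.
move=> c1 c2 r r0; apply: subclosed_compact (compact_setX (c1 r r0) (c2 r r0)) _.
  exact: closed_ball_closed.
rewrite !closed_ballE// => q; rewrite /closed_ball_/= prod_normE ge_max/=.
by move=> /andP[].
Qed.

(** * Partial derivatives of [g] as directional derivatives *)

Section GeneratingFunction.
Context {R : realType} {n : nat}.
Notation X := 'rV[R]_n.
Notation V := (X * X * R)%type.

Definition xdir (v : X) : V := (v, 0, 0).
Definition ydir (v : X) : V := (0, v, 0).
Definition zdir : V := (0, 0, 1).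

Lemma yz_dirE (v : X) (r : R) : (0, v, r) = ydir v + r *: zdir :> V.
Proof. by rewrite /ydir /zdir; congr (_, _, _); rewrite /= ?scaler0 ?addr0 ?add0r// [_ *: _]mulr1. Qed.

Lemma derive_xslice (f : V -> R) x y z v :
  'D_v (fun x' => f (x', y, z)) x = 'D_(xdir v) f (x, y, z).
Proof.
rewrite /derive.
have -> : (fun h : R => h^-1 *: (((fun x' => f (x', y, z)) \o shift x) (h *: v) - f (x, y, z))) =
    (fun h : R => h^-1 *: ((f \o shift (x, y, z)) (h *: xdir v) - f (x, y, z))).
  apply/funext => h; congr (_ *: (f _ - _)).
  by congr (_, _, _); rewrite /= scaler0 add0r.
by [].
Qed.

Lemma derive_yslice (f : V -> R) x y z v :
  'D_v (fun y' => f (x, y', z)) y = 'D_(ydir v) f (x, y, z).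
Proof.
rewrite /derive.
have -> : (fun h : R => h^-1 *: (((fun y' => f (x, y', z)) \o shift y) (h *: v) - f (x, y, z))) =
    (fun h : R => h^-1 *: ((f \o shift (x, y, z)) (h *: ydir v) - f (x, y, z))).
  apply/funext => h; congr (_ *: (f _ - _)).
  by congr (_, _, _); rewrite /= scaler0 add0r.
by [].
Qed.

Lemma derive_zslice (f : V -> R) x y z :
  derive1 (fun z' => f (x, y, z')) z = 'D_zdir f (x, y, z).
Proof.
rewrite derive1E /derive.
have -> : (fun h : R => h^-1 *: (((fun z' => f (x, y, z')) \o shift z) (h *: 1) - f (x, y, z))) =
    (fun h : R => h^-1 *: ((f \o shift (x, y, z)) (h *: zdir) - f (x, y, z))).
  apply/funext => h; congr (_ *: (f _ - _)).
  by congr (_, _, _); rewrite /= scaler0 add0r.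
by [].
Qed.

Lemma xdir_linear k (u v : X) : xdir (k *: u + v) = k *: xdir u + xdir v.
Proof. by congr (_, _, _); rewrite /= scaler0 addr0. Qed.

Lemma ydir_linear k (u v : X) : ydir (k *: u + v) = k *: ydir u + ydir v.
Proof. by congr (_, _, _); rewrite /= scaler0 addr0. Qed.

Lemma xdir0 : xdir 0 = 0. Proof. by []. Qed.


Implicit Types (g : V -> R) (w : V).

Lemma g_xE g x y z i : g_x g x y z 0 i = ddir1 g (xdir (basis_vec i)) (x, y, z).
Proof. by rewrite mxE derive_xslice ddir1E. Qed.

Lemma g_yE g x y z i : g_y g x y z 0 i = ddir1 g (ydir (basis_vec i)) (x, y, z).
Proof. by rewrite mxE derive_yslice ddir1E. Qed.

Lemma g_zE g x y z : g_z g x y z = ddir1 g zdir (x, y, z).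
Proof. by rewrite ddir1E; exact: derive_zslice. Qed.

Lemma g_xxE g x y z i j :
  g_xx g x y z i j = ddir2 g (xdir (basis_vec j)) (xdir (basis_vec i)) (x, y, z).
Proof.
rewrite mxE ddir2E -derive_xslice; congr (derive _ _ _).
by apply/funext => x'; rewrite g_xE.
Qed.

Lemma g_xyE g x y z i j :
  g_xy g x y z i j = ddir2 g (ydir (basis_vec j)) (xdir (basis_vec i)) (x, y, z).
Proof.
rewrite mxE ddir2E -derive_yslice; congr (derive _ _ _).
by apply/funext => x'; rewrite g_xE.
Qed.

Lemma g_xzE g x y z i :
  g_xz g x y z 0 i = ddir2 g zdir (xdir (basis_vec i)) (x, y, z).
Proof.
rewrite mxE ddir2E -derive_zslice; congr (derive1 _ _).
by apply/funext => x'; rewrite g_xE.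
Qed.

End GeneratingFunction.

(** * The map [(x, y, z) |-> (x, g, g_x)] *)

Section Nondegeneracy.
Context {R : realType} {n : nat}.
Notation X := 'rV[R]_n.
Notation V := (X * X * R)%type.
Variables (Gamma : set V) (g : V -> R).
Hypotheses (hg : generating_function Gamma g) (hA1 : A1 Gamma g)
  (hA2 : A2 Gamma g).

Let oG : open Gamma. Proof. by case: hg => -[]. Qed.
Let gC2 : C2_on Gamma g. Proof. by case: hg. Qed.

Notation D1 := (ddir1 g).
Notation D2 := (ddir2 g).

Lemma g_z_neq0 w : Gamma w -> D1 zdir w != 0.
Proof.
case: w => [[x y] z] Gw; rewrite -g_zE lt_eqF//.
by case: hg => _ _ _; exact.
Qed.

Lemma ddir1_coord (L : X -> V) w (xi : X) :
  (forall k a b, L (k *: a + b) = k *: L a + L b) -> Gamma w ->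
  D1 (L xi) w = \sum_i xi 0 i * D1 (L (basis_vec i)) w.
Proof.
move=> linL Gw; rewrite ddir1E (derive_coord xi linL (C2_differentiable gC2 Gw)).
by apply: eq_bigr => i _; rewrite ddir1E.
Qed.

Lemma ddir2_coordl (L : X -> V) v w (xi : X) :
  (forall k a b, L (k *: a + b) = k *: L a + L b) -> Gamma w ->
  D2 (L xi) v w = \sum_i xi 0 i * D2 (L (basis_vec i)) v w.
Proof.
move=> linL Gw; rewrite ddir2E (derive_coord xi linL (C2_differentiable1 gC2 v Gw)).
by apply: eq_bigr => i _; rewrite ddir2E.
Qed.

Lemma ddir2_coordr (L : X -> V) v w (xi : X) :
  (forall k a b, L (k *: a + b) = k *: L a + L b) -> Gamma w ->
  D2 v (L xi) w = \sum_i xi 0 i * D2 v (L (basis_vec i)) w.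
Proof.
move=> linL Gw; rewrite (ddir2_sym oG gC2 v (L xi) Gw) (ddir2_coordl v xi linL Gw).
by apply: eq_bigr => i _; rewrite (ddir2_sym oG gC2 (L (basis_vec i)) v Gw).
Qed.

Definition gx (w : V) : X := g_x g w.1.1 w.1.2 w.2.

Lemma gxE w i : gx w 0 i = D1 (xdir (basis_vec i)) w.
Proof. by case: w => [[x y] z]; rewrite /gx g_xE. Qed.

Lemma ddir1_xdir w xi : Gamma w -> D1 (xdir xi) w = dotv (gx w) xi.
Proof.
move=> Gw; rewrite (ddir1_coord xi xdir_linear Gw).
by apply: eq_bigr => i _; rewrite gxE mulrC.
Qed.

Lemma ddir1_yz w eta (zeta : R) : Gamma w ->
  D1 (0, eta, zeta) w = D1 (ydir eta) w + zeta * D1 zdir w.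
Proof. by move=> Gw; rewrite yz_dirE (ddir1D gC2)// (ddir1Z gC2). Qed.

Lemma ddir2_yz w v eta (zeta : R) : Gamma w ->
  D2 (0, eta, zeta) v w = D2 (ydir eta) v w + zeta * D2 zdir v w.
Proof. by move=> Gw; rewrite yz_dirE (ddir2Dl gC2)// (ddir2Zl gC2). Qed.

Definition E (w : V) : 'M[R]_n := Emx g w.1.1 w.1.2 w.2.

Lemma E_unit w : Gamma w -> E w \in unitmx.
Proof. by case: w => [[x y] z] Gw; rewrite unitmxE unitfE; exact: hA2. Qed.

Lemma E_coord w i j : E w i j = D2 (ydir (basis_vec j)) (xdir (basis_vec i)) w
  - (D1 zdir w)^-1 * (D2 zdir (xdir (basis_vec i)) w * D1 (ydir (basis_vec j)) w).
Proof.
case: w => [[x y] z]; rewrite /E /Emx/= -g_xyE -g_zE -g_xzE -g_yE.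
move: (g_xy _ _ _ _) (g_xz _ _ _ _) (g_y _ _ _ _) => A B C.
by rewrite !mxE big_ord1 mxE.
Qed.

Lemma mul_row_E w xi j : Gamma w -> (xi *m E w) 0 j =
  D2 (ydir (basis_vec j)) (xdir xi) w
  - (D1 zdir w)^-1 * (D2 zdir (xdir xi) w * D1 (ydir (basis_vec j)) w).
Proof.
move=> Gw; rewrite mxE !(ddir2_coordr _ xi xdir_linear Gw).
rewrite mulr_suml mulr_sumr -sumrB; apply: eq_bigr => i _.
by rewrite E_coord; ring.
Qed.

Lemma mul_E_col w eta i : Gamma w -> (E w *m eta^T) i 0 =
  D2 (ydir eta) (xdir (basis_vec i)) w
  - (D1 zdir w)^-1 * (D2 zdir (xdir (basis_vec i)) w * D1 (ydir eta) w).
Proof.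
move=> Gw; rewrite mxE (ddir1_coord eta ydir_linear Gw).
rewrite (ddir2_coordl _ eta ydir_linear Gw).
rewrite !mulr_sumr -sumrB; apply: eq_bigr => j _.
by rewrite E_coord mxE; ring.
Qed.

(** [E] is the derivative of [g_x] in [y] when [z] varies so as to keep [g] constant. Eliminating
    [c] through the direction [zdir] therefore turns the relation into [xi *m E w = 0]. *)
Lemma yz_derivative_nondegenerate w xi c : Gamma w ->
  (forall eta zeta, D2 (0, eta, zeta) (xdir xi) w + c * D1 (0, eta, zeta) w = 0) ->
  xi = 0 /\ c = 0.
Proof.
move=> Gw H.
have gz0 := g_z_neq0 Gw.
have Hy j := H (basis_vec j) 0.
have zdirE : (0, 0, 1) = zdir :> V by [].
have := H 0 1; rewrite zdirE => Hz.
have xi0 : xi = 0.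
  rewrite -(mulmxK (E_unit Gw) xi) (_ : xi *m E w = 0) ?mul0mx//.
  apply/rowP => j; rewrite mul_row_E// [RHS]mxE.
  have := Hy j; rewrite ddir1_yz// ddir2_yz// !mul0r !addr0 => Hj.
  have -> : D2 zdir (xdir xi) w = - (c * D1 zdir w) by apply/eqP; rewrite -addr_eq0 Hz.
  by rewrite -[RHS]Hj; field.
split=> //.
move: Hz; rewrite xi0 xdir0 (_ : D2 zdir 0 w = 0).
  by rewrite add0r => /eqP; rewrite mulf_eq0 => /orP[/eqP//|]; rewrite (negbTE gz0).
by rewrite (ddir2_sym oG gC2)// ddir2E derive0.
Qed.

(** Solving the first equation for [zeta] leaves the system [E w *m eta^T = b], solvable by A2. So
    every first order change of [(g, g_x)] comes from a variation of [(y, z)]. *)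
Lemma yz_derivative_surjective w (pi : X) (phi : R) : Gamma w ->
  exists eta zeta, D1 (0, eta, zeta) w = phi /\
    forall i, D2 (0, eta, zeta) (xdir (basis_vec i)) w = pi 0 i.
Proof.
move=> Gw.
have gz0 := g_z_neq0 Gw.
pose b : 'cV[R]_n := \col_i (pi 0 i - phi / D1 zdir w * D2 zdir (xdir (basis_vec i)) w).
pose eta : X := (invmx (E w) *m b)^T.
pose zeta := (phi - D1 (ydir eta) w) / D1 zdir w.
exists eta, zeta; split; first by rewrite ddir1_yz// /zeta; field.
move=> i; rewrite ddir2_yz//.
have := mul_E_col eta i Gw.
rewrite {1}/eta trmxK mulKVmx ?E_unit// mxE => e.
have -> : D2 (ydir eta) (xdir (basis_vec i)) w =
  pi 0 i - phi / D1 zdir w * D2 zdir (xdir (basis_vec i)) w +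
  (D1 zdir w)^-1 * (D2 zdir (xdir (basis_vec i)) w * D1 (ydir eta) w).
  by rewrite e; ring.
by rewrite /zeta; field.
Qed.

Definition Phi (w : V) : X * R * X := (w.1.1, g w, gx w).

Lemma Phi_inj w w' : Gamma w -> Gamma w' -> Phi w = Phi w' -> w = w'.
Proof.
case: w w' => [[x y] z] [[x' y'] z'] Gw Gw' [exx eg egx].
by rewrite -exx in Gw' eg egx *; have [-> ->] := hA1 Gw Gw' egx eg.
Qed.

Lemma closed_ball_V_compact (w : V) (r : R) : 0 < r -> compact (closed_ball w r).
Proof.
apply: closed_ball_prod_compact => r'; last exact: closed_ballR_compact.
by apply: closed_ball_prod_compact => r''; exact: closed_ball_rV_compact.
Qed.

(** The coordinates of [Phi]. Those of [x] are kept so that the inverse is continuous jointly in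
    [(x, u, p)]: supports at points other than [x0] will be followed to [x0]. *)
Let PhiF (i : 'I_n + ('I_n + unit)) : V -> R :=
  match i with
  | inl j => fun w => w.1.1 0 j
  | inr (inl j) => D1 (xdir (basis_vec j))
  | inr (inr _) => g
  end.

Let is_derive_x0 j w v :
  is_derive w v (PhiF (inl j)) (v.1.1 0 j) /\ differentiable (PhiF (inl j)) w.
Proof.
have d : differentiable (fun w : V => w.1.1 0 j) w.
  apply: (@differentiable_comp _ _ _ _ (fun w : V => w.1.1) (fun x : X => x 0 j)).
    by apply: (@differentiable_comp _ _ _ _ (fst : V -> X * X) (fst : X * X -> X));
      exact: differentiable_fst.
  exact: differentiable_coord.
split=> //; apply: DeriveDef; first exact: diff_derivable.
apply/cvg_lim => //.
apply: (@cvg_trans _ (cst (v.1.1 0 j) @ (0 : R)^')); last exact: cvg_cst.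
apply: near_eq_cvg; near=> h.
have h0 : h != 0 by near: h; exact: nbhs_dnbhs_neq.
by rewrite /= !mxE addrK -[RHS]/(_ * _) mulrA mulVf// mul1r.
Unshelve. all: by end_near. Qed.

Lemma Phi_open w N : Gamma w -> nbhs w N ->
  exists2 e : R, 0 < e & forall P : X * R * X, `|P - Phi w| < e ->
    exists w', [/\ N w', Gamma w' & Phi w' = P].
Proof.
move=> Gw Nw.
have [|i w' Gw'|w' Gw' e|w' Gw' a a0|e e0 He] :=
    @open_at_injective_nondegenerate R V _ PhiF Gamma w _ oG Gw _ _ _ N Nw.
- exact: closed_ball_V_compact.
- case: i => [j|[j|[]]].
  + by have [] := is_derive_x0 j w' 0.
  + exact: (C2_differentiable1 gC2).
  + exact: (C2_differentiable gC2).
- apply: Phi_inj => //; congr (_, _, _).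
  + by apply/rowP => j; exact: (e (inl j)).
  + exact: (e (inr (inr tt))).
  + by apply/rowP => j; rewrite !gxE; exact: (e (inr (inl j))).
- pose xi : X := \row_j a (inr (inl j)).
  have sumE v : \sum_i a i * 'D_v (PhiF i) w' =
      \sum_j a (inl j) * v.1.1 0 j +
      (\sum_j xi 0 j * D2 v (xdir (basis_vec j)) w' + a (inr (inr tt)) * D1 v w').
    rewrite big_sumType/= big_sumType/=; congr (_ + (_ + _)).
    + by apply: eq_bigr => j _; have [[_ ->] _] := is_derive_x0 j w' v.
    + by apply: eq_bigr => j _; rewrite mxE ddir2E.
    + by rewrite (bigD1 tt)//= big1 ?addr0 ?ddir1E// => -[].
  (* The directions [(0, eta, zeta)] do not see the coordinates of [x], so the coefficients of [g]
     and [g_x] vanish first; the directions [xdir] then give those of [x]. *)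
  have [|xi0 c0] := @yz_derivative_nondegenerate w' xi (a (inr (inr tt))) Gw'.
    move=> eta zeta; rewrite (ddir2_coordr _ xi xdir_linear Gw') -[RHS](a0 (0, eta, zeta)).
    by rewrite sumE [X in _ = X + _]big1 ?add0r// => j _; rewrite mxE mulr0.
  move=> [j|[j|[]]] //; last first.
    by move/rowP : xi0 => /(_ j); rewrite !mxE.
  have := a0 (xdir (basis_vec j)); rewrite sumE xi0 c0 mul0r addr0.
  rewrite [X in _ + X]big1 ?addr0; last by move=> k _; rewrite mxE mul0r.
  rewrite (bigD1 j)//= big1 ?addr0 => [|k kj]; rewrite !mxE eqxx/=.
    by rewrite eqxx mulr1.
  by rewrite (negbTE kj) mulr0.
exists e => // P Pe.
pose t (i : 'I_n + ('I_n + unit)) : R :=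
  match i with inl j => P.1.1 0 j | inr (inl j) => P.2 0 j | inr (inr _) => P.1.2 end.
have [i|w' [Nw' Gw' Hw']] := He t.
  apply: le_lt_trans Pe; rewrite prod_normE le_max prod_normE le_max.
  case: i => [j|[j|[]]].
  + have := coord_le_mx_norm (P.1.1 - w.1.1) 0 j.
    by rewrite !mxE => /= ->.
  + have := coord_le_mx_norm (P.2 - gx w) 0 j.
    by rewrite [_ 0 j]mxE [(- gx w) 0 j]mxE gxE => /= ->; rewrite orbT.
  + by rewrite lexx orbT.
exists w'; split=> //; rewrite [P]surjective_pairing [P.1]surjective_pairing.
congr (_, _, _).
+ by apply/rowP => j; exact: (Hw' (inl j)).
+ exact: (Hw' (inr (inr tt))).
+ by apply/rowP => j; rewrite gxE; exact: (Hw' (inr (inl j))).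
Qed.

Lemma Uset_Phi w : Gamma w -> Uset Gamma g (Phi w).
Proof. by case: w => [[x y] z] Gw; exists y, z. Qed.

Lemma UsetP P : Uset Gamma g P -> exists2 w, Gamma w & Phi w = P.
Proof.
by case: P => [[x u] p] [y [z /= [Gw -> ->]]]; exists (x, y, z).
Qed.

Definition Psi (P : X * R * X) : V :=
  (P.1.1, Ymap Gamma g P.1.1 P.1.2 P.2, Zmap Gamma g P.1.1 P.1.2 P.2).

Lemma Psi_Phi w : Gamma w -> Psi (Phi w) = w.
Proof.
case: w => [[x y] z] Gw; rewrite /Psi /Ymap /Zmap/=.
suff -> : YZmap Gamma g x (g (x, y, z)) (gx (x, y, z)) = (y, z) by [].
apply: xget_unique; first by split.
by move=> [y' z'] /= [Gw' egx eg]; exact: (hA1 Gw' Gw).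
Qed.

Lemma Phi_Psi P : Uset Gamma g P -> Gamma (Psi P) /\ Phi (Psi P) = P.
Proof. by move=> /UsetP[w Gw <-]; rewrite Psi_Phi. Qed.

Lemma Uset_open : open (Uset Gamma g).
Proof.
rewrite openE => P /UsetP[w Gw <-].
have [e e0 He] := Phi_open Gw (open_nbhs_nbhs (conj oG Gw)).
suff : \forall Q \near Phi w, Uset Gamma g Q by [].
apply/nbhs_normP; exists e => //= Q Qe.
have /He[w' [_ Gw' <-]] : `|Q - Phi w| < e by rewrite distrC.
exact: Uset_Phi.
Qed.

Lemma Psi_continuous P : Uset Gamma g P -> {for P, continuous Psi}.
Proof.
move=> /UsetP[w Gw <-] N; rewrite Psi_Phi// => Nw.
have [e e0 He] := Phi_open Gw Nw.
suff : \forall Q \near Phi w, N (Psi Q) by [].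
apply/nbhs_normP; exists e => //= Q Qe.
have /He[w' [Nw' Gw' <-]] : `|Q - Phi w| < e by rewrite distrC.
by rewrite /= Psi_Phi.
Qed.

(** Only uniqueness is at stake. As [I(x, y)] is an interval, the segment between two solutions
    stays in [Gamma], where [g_z < 0] makes [g] strictly decreasing. *)
Lemma g_star_eq x y z : Gamma (x, y, z) -> g_star Gamma g x y (g (x, y, z)) = z.
Proof.
move=> Gw; apply: xget_unique; first by split.
suff mono z1 z2 : Gamma (x, y, z1) -> Gamma (x, y, z2) -> z1 < z2 ->
    g (x, y, z2) < g (x, y, z1).
  move=> z' [Gz' e]; have [zz'|zz'|//] := ltgtP z' z.
    by have := mono _ _ Gz' Gw zz'; rewrite e ltxx.
  by have := mono _ _ Gw Gz' zz'; rewrite e ltxx.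
move=> G1 G2 z12.
have [_ /(_ x y)[_ itv] _ gz] := hg.
pose v : V := (0, 0, z2 - z1).
have line (s : R) : (x, y, z1) + s *: v = (x, y, z1 + s * (z2 - z1)) :> V.
  by congr (_, _, _); rewrite /= scaler0 addr0.
have Gs (s : R) : 0 <= s <= 1 -> Gamma ((x, y, z1) + s *: v).
  move=> /andP[s0 s1]; rewrite line; apply: (itv z1 z2) => //.
  by apply/andP; split; nra.
have [s /Gs Gsv|s /andP[s0 s1] e] := @MVT_line R V g (x, y, z1) v.
  exact: (C2_differentiable gC2).
have Gsv := Gs s; rewrite !ltW// in Gsv; have {}Gsv := Gsv isT.
rewrite -subr_lt0.
have <- : (x, y, z1) + v = (x, y, z2) by congr (_, _, _); rewrite /= ?addr0// addrC subrK.
have vE : v = (z2 - z1) *: zdir.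
  by congr (_, _, _); rewrite /= ?scaler0// [RHS]mulr1.
rewrite e -ddir1_at {1}vE (ddir1Z gC2 _ _ Gsv) pmulr_rlt0 ?subr_gt0//.
by rewrite line -g_zE; apply: gz; rewrite -line.
Qed.

End Nondegeneracy.

(** * Segments in the coordinates [Q] *)

Section QCoordinates.
Context {R : realType} {n : nat}.
Notation X := 'rV[R]_n.
Notation V := (X * X * R)%type.
Variables (Gamma : set V) (g : V -> R).
Hypotheses (hg : generating_function Gamma g) (hA1 : A1 Gamma g)
  (hA2 : A2 Gamma g) (hA1star : A1star Gamma g).

Let oG : open Gamma. Proof. by case: hg => -[]. Qed.
Let gC2 : C2_on Gamma g. Proof. by case: hg. Qed.

Notation D1 := (ddir1 g).
Notation D2 := (ddir2 g).
Notation gx := (gx g).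
Notation Phi := (Phi g).
Notation E := (E g).

Lemma differentiable_lift (y x : X) (z : R) :
  differentiable (fun x : X => (x, y, z) : V) x.
Proof.
have di : differentiable (id : X -> X) x by exact: ex_diff.
have d1 : differentiable (fun x : X => (x, y)) x.
  exact: (differentiable_pair di (differentiable_cst y x)).
exact: (differentiable_pair d1 (differentiable_cst z x)).
Qed.

Lemma lift_continuous (y : X) (z : R) : continuous (fun x : X => (x, y, z) : V).
Proof. by move=> x; apply/differentiable_continuous/differentiable_lift. Qed.

Lemma differentiable_slice (f : V -> R) (x y : X) (z : R) :
  differentiable f (x, y, z) -> differentiable (fun x => f (x, y, z)) x.
Proof.
move=> df; apply: (@differentiable_comp _ _ _ _ (fun x : X => (x, y, z) : V) f).
  exact: differentiable_lift.
exact: df.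
Qed.

Lemma is_derive_slice (f : V -> R) (x y : X) (z : R) v :
  differentiable f (x, y, z) ->
  is_derive x v (fun x => f (x, y, z)) ('D_(xdir v) f (x, y, z)).
Proof.
move=> df; apply: DeriveDef; last exact: derive_xslice.
exact/diff_derivable/differentiable_slice.
Qed.

Section Segment.
Variables (y : X) (z : R).
Let D := Gamma_yz Gamma y z.
Let lift (x : X) : V := (x, y, z).
Let Q (j : 'I_n) (x : X) := - ((D1 zdir (lift x))^-1 * D1 (ydir (basis_vec j)) (lift x)).

Lemma Qmap_coord x j : Qmap g y z x 0 j = Q j x.
Proof. by rewrite /Qmap !mxE -/(g_y _ _ _ _) derive_yslice -ddir1_at g_zE. Qed.

Lemma Gamma_yz_open : open D.
Proof. by apply: open_comp => // x _; exact: lift_continuous. Qed.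

(** Arranged so that the inner bracket is [(xi *m E) 0 j]: the Jacobian of [Q] is [- E / g_z],
    invertible by A2. *)
Let dQ xi j x := - ((D1 zdir (lift x))^-1 * (D2 (ydir (basis_vec j)) (xdir xi) (lift x)
  - (D1 zdir (lift x))^-1 * (D2 zdir (xdir xi) (lift x) * D1 (ydir (basis_vec j)) (lift x)))).

Lemma is_derive_Q xi j x : D x -> is_derive x xi (Q j) (dQ xi j x).
Proof.
move=> Dx; have m0 : D1 zdir (lift x) != 0 by exact: (g_z_neq0 hg).
have dm : is_derive x xi (fun x => D1 zdir (lift x)) (D2 (xdir xi) zdir (lift x)).
  by rewrite ddir2E; apply/is_derive_slice/(C2_differentiable1 gC2).
have db : is_derive x xi (fun x => D1 (ydir (basis_vec j)) (lift x))
    (D2 (xdir xi) (ydir (basis_vec j)) (lift x)).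
  by rewrite ddir2E; apply/is_derive_slice/(C2_differentiable1 gC2).
have [dmd dme] := dm.
have dv : is_derive x xi (fun x => (D1 zdir (lift x))^-1)
    (- (D1 zdir (lift x)) ^- 2 *: D2 (xdir xi) zdir (lift x)).
  by apply: DeriveDef; [exact: derivableV|rewrite deriveV// dme].
have h := is_deriveN (is_deriveM dv db); apply: (is_derive_eq h).
rewrite /dQ (ddir2_sym oG gC2 (xdir xi) zdir Dx).
rewrite (ddir2_sym oG gC2 (xdir xi) (ydir (basis_vec j)) Dx).
rewrite -![_ *: _]/(_ * _).
by field.
Qed.

Lemma D1_lift_continuous v x : D x -> {for x, continuous (fun x => D1 v (lift x))}.
Proof.
move=> Dx; apply/differentiable_continuous/differentiable_slice.
exact: (C2_differentiable1 gC2).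
Qed.

Lemma D2_lift_continuous v a x : D x -> {for x, continuous (fun x => D2 v a (lift x))}.
Proof.
move=> Dx; apply: (@continuous_comp _ _ _ lift (D2 v a)).
  exact: lift_continuous.
exact: (C2_continuous2 gC2).
Qed.

Lemma Q_C1 j : C1_on D (Q j).
Proof.
split=> [x Dx|v x Dx].
  have m0 : D1 zdir (lift x) != 0 by exact: (g_z_neq0 hg).
  apply: differentiableN; apply: differentiableM.
    apply: differentiableV => //; apply: differentiable_slice.
    exact: (C2_differentiable1 gC2).
  by apply: differentiable_slice; exact: (C2_differentiable1 gC2).
have m0 : D1 zdir (lift x) != 0 by exact: (g_z_neq0 hg).
have cV : {for x, continuous (fun x' => (D1 zdir (lift x'))^-1)}.
  exact: (@continuousV _ _ (fun x' => D1 zdir (lift x')) x m0 (@D1_lift_continuous zdir x Dx)).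
have cp := continuousM (@D2_lift_continuous zdir (xdir v) x Dx)
  (@D1_lift_continuous (ydir (basis_vec j)) x Dx).
have cs := continuousB (@D2_lift_continuous (ydir (basis_vec j)) (xdir v) x Dx)
  (continuousM cV cp).
have cQ : {for x, continuous (dQ v j)} := continuousN (continuousM cV cs).
have e : \forall x' \near x, dQ v j x' = 'D_v (Q j) x'.
  near=> x'; have [|_ ->//] := @is_derive_Q v j x'.
  by near: x'; apply: open_nbhs_nbhs; split=> //; exact: Gamma_yz_open.
rewrite /prop_for /continuous_at -(nbhs_singleton e).
apply: cvg_trans; first exact: (near_eq_cvg e).
exact: cQ.
Unshelve. all: by end_near. Qed.

Lemma Q_inj x x' : D x -> D x' -> (forall j, Q j x = Q j x') -> x = x'.
Proof.
move=> Dx Dx' e; apply: (hA1star Dx Dx').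
by apply/rowP => j; rewrite !Qmap_coord.
Qed.

Lemma Q_unit x : D x -> \matrix_(i, j) 'D_(basis_vec i) (Q j) x \in unitmx.
Proof.
move=> Dx; have m0 : D1 zdir (lift x) != 0 by exact: (g_z_neq0 hg).
rewrite (_ : \matrix_(i, j) _ = (- (D1 zdir (lift x))^-1) *: E (lift x)).
  by rewrite unitmxZ ?(E_unit hA2)// unitfE oppr_eq0 invr_eq0.
apply/matrixP => i j; rewrite mxE; have [_ ->] := is_derive_Q (basis_vec i) j Dx.
rewrite /dQ -(mul_row_E hg)// -rowE !mxE.
by rewrite mulNr.
Qed.

(** The times form an open set [T] around [[0, 1]], so that two-sided derivatives exist at both
    ends. The curve is chosen pointwise, and injectivity of [Q] makes the choice unique. Its
    velocity is [dq] times an invertible matrix, hence nonzero because [x0 != x1]. *)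
Lemma Q_curve (x0 x1 : X) : D x0 -> D x1 -> x0 != x1 ->
  (forall t : R, 0 <= t <= 1 -> exists2 x, D x &
     Qmap g y z x = (1 - t) *: Qmap g y z x0 + t *: Qmap g y z x1) ->
  exists (c c' : R -> X) (T : set R) (dq : X),
    [/\ open T, (forall t : R, 0 <= t <= 1 -> T t), c 0 = x0, c 1 = x1 &
      forall t, T t -> [/\ D (c t), is_derive t 1 c (c' t), c' t != 0,
        (forall j, {for t, continuous (fun s => c' s 0 j)}) &
        forall j, Q j (c t) = Q j x0 + t * dq 0 j]].
Proof.
move=> Dx0 Dx1 x01 seg.
pose dq : X := Qmap g y z x1 - Qmap g y z x0.
have dqE j : dq 0 j = Q j x1 - Q j x0.
  have sub (a b : X) : (a - b) 0 j = a 0 j - b 0 j by rewrite !mxE.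
  by rewrite /dq sub !Qmap_coord.
pose Seg t x := D x /\ forall j, Q j x = Q j x0 + t * dq 0 j.
pose T := [set t : R | exists x, Seg t x].
pose c t := xget x0 (Seg t).
have Tc t : T t -> Seg t (c t) by move=> [x Sx]; exact: (xgetPex x0 (ex_intro _ x Sx)).
have uniq t x x' : Seg t x -> Seg t x' -> x = x'.
  by move=> [Dx ex] [Dx' ex']; apply: Q_inj => // j; rewrite ex ex'.
have T01 t : 0 <= t <= 1 -> T t.
  move=> /seg[x Dx e]; exists x; split=> // j.
  rewrite -(Qmap_coord x) e dqE.
  have comb (a b : X) : ((1 - t) *: a + t *: b) 0 j = (1 - t) * a 0 j + t * b 0 j.
    by rewrite !mxE.
  by rewrite comb !Qmap_coord; ring.
have oT : open T.
  rewrite openE => t [x [Dx ex]].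
  have [e e0 He] := inverse_open Gamma_yz_open Q_C1 Q_inj Q_unit Dx (open_nbhs_nbhs (conj Gamma_yz_open Dx)).
  have d0 : 0 < `|dq| + 1 by rewrite ltr_wpDl.
  suff : \forall s \near t, T s by [].
  near=> s.
  have [i|w [_ Dw ew]] := He (fun j => Q j x0 + s * dq 0 j); last by exists w.
  rewrite ex.
  have -> : Q i x0 + s * dq 0 i - (Q i x0 + t * dq 0 i) = (s - t) * dq 0 i by ring.
  rewrite normrM.
  have st : `|s - t| < e / (`|dq| + 1).
    by near: s; apply: cvgr_distC_lt; [exact: cvg_id|exact: divr_gt0].
  rewrite ltr_pdivlMr// in st; apply: le_lt_trans st.
  by rewrite ler_wpM2l// (le_trans (coord_le_mx_norm _ _ _))// lerDl.
pose J x : 'M[R]_n := \matrix_(i, j) 'D_(basis_vec i) (Q j) x.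
pose q0 : X := \row_j Q j x0.
have Dc t : T t -> D (c t) by move=> /Tc[].
have Fc t j : T t -> Q j (c t) = q0 0 j + t * dq 0 j by move=> /Tc[_ ->]; rewrite [q0 0 j]mxE.
exists c, (fun t => dq *m invmx (J (c t))), T, dq; split=> //.
- apply: (uniq 0); first by apply/Tc/T01; rewrite lexx ler01.
  by split=> // j; rewrite mul0r addr0.
- apply: (uniq 1); first by apply/Tc/T01; rewrite lexx ler01.
  by split=> // j; rewrite dqE; ring.
move=> t Tt; split.
- exact: Dc.
- exact: (is_derive_inverse_curve Gamma_yz_open Q_C1 Q_inj Q_unit oT Dc Fc).
- apply: contra_neqN x01 => /eqP e; apply: Q_inj => // j.
  have : dq = 0 by rewrite -(mulmxKV (Q_unit (Dc t Tt)) dq) -/(J (c t)) e mul0mx.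
  by move/rowP/(_ j); rewrite dqE mxE => /eqP; rewrite subr_eq0 => /eqP ->.
- exact: (inverse_curve_derive_continuous Gamma_yz_open Q_C1 Q_inj Q_unit oT Dc Fc).
- by have [] := Tc t Tt.
Unshelve. all: by end_near. Qed.

End Segment.
End QCoordinates.

Lemma ddir2_at (R : realType) (V : normedModType R) (f : V -> R) v a w :
  ddir2 f v a w = 'D_v (ddir1 f a) w.
Proof. by rewrite ddir2E. Qed.

(** * Derivatives of pairs, rows and products along curves *)

Section ProductCurves.
Context {R : realType}.

Lemma is_derive_pair (U W : normedModType R) (f : R -> U) (h : R -> W) (t : R) df dh :
  is_derive t 1 f df -> is_derive t 1 h dh ->
  is_derive t 1 (fun s => (f s, h s)) (df, dh).
Proof.
move=> [/derivable1_diffP df1 ef] [/derivable1_diffP dh1 eh].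
have dfh := differentiable_pair df1 dh1.
apply: DeriveDef; first exact: diff_derivable.
by rewrite deriveE// diff_pair// -!deriveE// ef eh.
Qed.

Lemma is_derive_fst (U W : normedModType R) (f : R -> U * W) (t : R) df :
  is_derive t 1 f df -> is_derive t 1 (fun s => (f s).1) df.1.
Proof.
move=> df1; have cf : continuous (fst : {linear (U * W)%type -> U}).
  by move=> q; exact: cvg_fst.
have := is_derive_curve df1 (linear_differentiable (f t) cf).
by rewrite deriveE ?(diff_lin _ cf)//; exact: linear_differentiable.
Qed.

Lemma is_derive_shift_const (V' : normedModType R) (w : R -> V') (t : R) w' (v : V') :
  is_derive t 1 w w' -> is_derive t 1 (fun s => w s + v) w'.
Proof.
by move=> dw; have := is_deriveD dw (is_derive_cst v t 1); rewrite addr0.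
Qed.

Lemma is_derive_row n (M : R -> 'rV[R]_n) (t : R) (dM : 'rV[R]_n) :
  (forall k, is_derive t 1 (fun s => M s 0 k) (dM 0 k)) -> is_derive t 1 M dM.
Proof.
move=> dMk; have dM1 : derivable M t 1.
  by apply/derivable_mxP => i k; rewrite (ord1 i); have [] := dMk k.
apply: DeriveDef => //; rewrite derive_mx//.
by apply/rowP => k; rewrite mxE; have [] := dMk k.
Qed.

(** As [r] vanishes at [t], the difference quotient of the product is that of [r] times the value of
    [b] at the displaced point. *)
Lemma is_derive_vanishing_mul (r b : R -> R) (t dr : R) :
  is_derive t 1 r dr -> r t = 0 -> {for t, continuous b} ->
  is_derive t 1 (fun s => r s * b s) (dr * b t).
Proof.
move=> [+ edr] r0 cb => /cvg_ex[/= l cl].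
have {edr} edr : l = dr by rewrite -edr; apply/esym/cvg_lim.
rewrite {}edr in cl.
suff lim : h^-1 *: (((fun s => r s * b s) \o shift t) (h *: 1) - r t * b t) @[h --> 0^'] --> dr * b t.
  apply: DeriveDef; first by apply/cvg_ex; exists (dr * b t).
  by apply/cvg_lim.
have cbt : b (h + t) @[h --> (0 : R)^'] --> b t.
  apply: cvg_trans cb; move=> N /nbhs_normP[e /= e0 He].
  suff : \forall h \near (0 : R)^', N (b (h + t)) by [].
  near=> h; apply: He; rewrite /= opprD addrCA subrr addr0 normrN.
  by near: h; exact: dnbhs0_lt.
apply: cvg_trans (cvgM cl cbt); apply: near_eq_cvg; near=> h.
by rewrite /= r0 mul0r !subr0 [h *: 1]mulr1 -mulrA.
Unshelve. all: by end_near. Qed.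

End ProductCurves.

Lemma is_derive_inv {R : realType} (f : R -> R) (t df : R) :
  is_derive t 1 f df -> f t != 0 ->
  is_derive t 1 (fun s => (f s)^-1) (- (df / f t ^+ 2)).
Proof.
move=> [d e] f0; apply: DeriveDef; first exact: derivableV.
by rewrite deriveV// e -[_ *: _]/(_ * _) mulNr mulrC.
Qed.

Lemma is_derive_unique {R : realType} (f : R -> R) (t a b : R) :
  is_derive t 1 f a -> is_derive t 1 f b -> a = b.
Proof. by move=> [_ <-] [_ <-]. Qed.

(** * The second derivative of [v] along a curve on which [Q] is affine *)

Section SecondDerivative.
Context {R : realType} {n : nat}.
Notation X := 'rV[R]_n.
Notation V := (X * X * R)%type.
Variables (Gamma : set V) (g : V -> R).
Hypotheses (hg : generating_function Gamma g) (hA1 : A1 Gamma g)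
  (hA2 : A2 Gamma g) (hA : A_twice_differentiable Gamma g).

Let oG : open Gamma. Proof. by case: hg => -[]. Qed.
Let gC2 : C2_on Gamma g. Proof. by case: hg. Qed.

Notation D1 := (ddir1 g).
Notation D2 := (ddir2 g).
Notation gx := (gx g).
Notation Phi := (Phi g).
Notation U := (Uset Gamma g).

Definition Acoef i j (P : X * R * X) : R := Amx Gamma g P.1.1 P.1.2 P.2 i j.

Lemma Acoef_differentiable i j P : U P -> differentiable (Acoef i j) P.
Proof. by move=> UP; have [h _] := hA i j; exact: h. Qed.

Lemma Acoef_differentiable1 i j v P : U P -> differentiable (ddir1 (Acoef i j) v) P.
Proof. by move=> UP; rewrite ddir1E; have [_ h] := hA i j; exact: h. Qed.

Lemma Acoef_Phi i j w : Gamma w ->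
  Acoef i j (Phi w) = D2 (xdir (basis_vec j)) (xdir (basis_vec i)) w.
Proof.
move=> Gw; have := Psi_Phi hA1 Gw; rewrite /Acoef /Amx.
case: w Gw => [[x y] z] Gw; rewrite /Psi/= => -[-> ->].
exact: g_xxE.
Qed.

Lemma is_derive_Phi (w : R -> V) (t : R) w' : is_derive t 1 w w' -> Gamma (w t) ->
  is_derive t 1 (fun s => Phi (w s))
    (w'.1.1, D1 w' (w t), \row_k D2 w' (xdir (basis_vec k)) (w t)).
Proof.
move=> dw Gw; apply: is_derive_pair; first apply: is_derive_pair.
- exact: (is_derive_fst (is_derive_fst dw)).
- by rewrite ddir1_at; exact: (is_derive_curve dw (C2_differentiable gC2 Gw)).
- apply: is_derive_row => k; rewrite mxE ddir2E.
  rewrite (_ : (fun s => _) = (fun s => D1 (xdir (basis_vec k)) (w s))).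
    exact: (is_derive_curve dw (C2_differentiable1 gC2 _ Gw)).
  by apply/funext => s; rewrite gxE.
Qed.
Lemma Phi_continuous w : Gamma w -> {for w, continuous Phi}.
Proof.
move=> Gw; apply/cvgrPdist_lt => e e0; near=> w'.
rewrite prod_normE gt_max prod_normE gt_max /= -andbA; apply/and3P; split.
- apply: (@le_lt_trans _ _ `|w - w'|); first by rewrite !prod_normE !le_max lexx.
  by near: w'; apply: cvgr_dist_lt => //; exact: cvg_id.
- near: w'; move: e e0; apply/cvgrPdist_lt/differentiable_continuous.
  exact: (C2_differentiable gC2 Gw).
- have : forall k : 'I_n, `|D1 (xdir (basis_vec k)) w - D1 (xdir (basis_vec k)) w'| < e.
    near: w'; apply: filter_forall => k; move: e e0.
    apply/cvgrPdist_lt/differentiable_continuous.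
    exact: (C2_differentiable1 gC2 _ Gw).
  move=> h; apply: mx_norm_lt => // i k; rewrite (ord1 i).
  by rewrite [_ 0 k]mxE [(- gx w') 0 k]mxE !gxE.
Unshelve. all: by end_near. Qed.

Definition udir : X * R * X := (0, 1, 0).
Definition pdir (b : X) : X * R * X := (0, 0, b).

Lemma pdir_linear k (a b : X) : pdir (k *: a + b) = k *: pdir a + pdir b.
Proof. by congr (_, _, _); rewrite /= ?scaler0 ?addr0. Qed.

Lemma updirE (a : R) (b : X) : (0, a, b) = a *: udir + pdir b.
Proof. by congr (_, _, _); rewrite /= ?scaler0 ?addr0 ?add0r// [RHS]mulr1. Qed.

Lemma ddir1_updir (f : X * R * X -> R) a b P : differentiable f P ->
  ddir1 f (0, a, b) P = a * ddir1 f udir P + ddir1 f (pdir b) P.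
Proof. by move=> df; rewrite !ddir1E updirE deriveDdir// deriveZdir. Qed.

Lemma ddir1_pdir (f : X * R * X -> R) b P : differentiable f P ->
  ddir1 f (pdir b) P = \sum_k b 0 k * ddir1 f (pdir (basis_vec k)) P.
Proof.
move=> df; rewrite ddir1E (derive_coord b pdir_linear df).
by apply: eq_bigr => k _; rewrite ddir1E.
Qed.

Lemma cvg_sum_ord (T : Type) (F : set_system T) (FF : Filter F) m
    (f : 'I_m -> T -> R) (l : 'I_m -> R) :
  (forall k, f k x @[x --> F] --> l k) ->
  \sum_k f k x @[x --> F] --> \sum_k l k.
Proof. by move=> fl; apply: cvg_big => //; exact: add_continuous. Qed.

Section AlongCurve.
Variables (c c' : R -> X) (T : set R) (oT : open T).
Hypothesis dc : forall t, T t -> is_derive t 1 c (c' t).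
Hypothesis cc' : forall t, T t -> forall j, {for t, continuous (fun s => c' s 0 j)}.

Lemma is_derive_lift_curve (y : X) (z : R) (t : R) : T t ->
  is_derive t 1 (fun s => (c s, y, z) : V) (xdir (c' t)).
Proof.
move=> Tt.
exact: (is_derive_pair (is_derive_pair (dc Tt) (is_derive_cst y t 1)) (is_derive_cst z t 1)).
Qed.

Variables (y : X) (z : R).
Let w (s : R) : V := (c s, y, z).
Hypothesis Gw : forall t, T t -> Gamma (w t).

(** This is a third derivative of [g], which is only C2. It exists because the derivative of [g_x]
    along the curve is [A] composed with [Phi], contracted with the velocity, and this can be
    differentiated once more in the direction [(0, eta, zeta)]; the symmetry theorem exchanges the
    two differentiations. *)
Lemma is_derive_D2_curve (eta : X) (zeta : R) i t : T t ->
  is_derive t 1 (fun s => D2 (0, eta, zeta) (xdir (basis_vec i)) (w s))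
    (\sum_j c' t 0 j * ddir1 (Acoef i j) (0, D1 (0, eta, zeta) (w t),
       \row_k D2 (0, eta, zeta) (xdir (basis_vec k)) (w t)) (Phi (w t))).
Proof.
move=> Tt; set d : V := (0, eta, zeta).
pose W (p : R * R) : V := w p.1 + p.2 *: d.
have Wt0 s : W (s, 0) = w s by rewrite /W scale0r addr0.
have cW : {for ((t, 0) : R * R), continuous W}.
  rewrite /prop_for /continuous_at; apply: cvgD; last by apply: cvgZr_tmp; exact: cvg_snd.
  have cw : {for t, continuous w}.
    by apply/differentiable_continuous/derivable1_diffP; have [] := is_derive_lift_curve y z Tt.
  have := @continuous_comp _ _ _ (fst : R * R -> R) w ((t, 0) : R * R).
  by apply; [exact: cvg_fst|exact: cw].
have nearG : \forall p \near ((t, 0) : R * R), Gamma (W p).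
  by apply: cW; apply: open_nbhs_nbhs; rewrite Wt0; split=> //; exact: Gw.
have nearT : \forall p \near ((t, 0) : R * R), T p.1.
  by apply: cvg_fst; exact: open_nbhs_nbhs.
pose dP p : X * R * X :=
  (0, D1 d (W p), \row_k D2 d (xdir (basis_vec k)) (W p)).
have := @schwarz_derive R (fun s r => D1 (xdir (basis_vec i)) (W (s, r)))
  (fun s r => \sum_j c' s 0 j * Acoef i j (Phi (W (s, r))))
  (fun s r => \sum_j c' s 0 j * ddir1 (Acoef i j) (dP (s, r)) (Phi (W (s, r))))
  (fun s => D2 d (xdir (basis_vec i)) (w s)) t 0.
rewrite /dP Wt0; apply.
- near=> p.
  have Gp : Gamma (W p) by near: p.
  have Tp : T p.1 by near: p.
  have := is_derive_curve
    (is_derive_shift_const (p.2 *: d) (is_derive_lift_curve y z Tp))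
    (C2_differentiable1 gC2 (xdir (basis_vec i)) Gp).
  rewrite -ddir2_at (ddir2_coordl hg _ _ xdir_linear Gp).
  under eq_bigr do rewrite -Acoef_Phi//.
  exact.
- near=> p.
  have Gp : Gamma (W p) by near: p.
  apply: is_derive_bigsum => j.
  have dPhi := is_derive_Phi (is_derive_line (w p.1) d p.2) Gp.
  have := is_derive_curve dPhi (Acoef_differentiable i j (Uset_Phi g Gp)).
  move=> /(is_deriveZ (c' p.1 0 j)).
  by rewrite -ddir1_at.
- have GW0 : Gamma (W (t, 0)) by rewrite Wt0; exact: Gw.
  have comp (f : V -> R) : {for W (t, 0), continuous f} ->
      f (W p) @[p --> ((t, 0) : R * R)] --> f (W (t, 0)).
    by move=> cf; exact: (@continuous_comp _ _ _ W f ((t, 0) : R * R) cW cf).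
  have compPhi (f : X * R * X -> R) : {for Phi (W (t, 0)), continuous f} ->
      f (Phi (W p)) @[p --> ((t, 0) : R * R)] --> f (Phi (W (t, 0))).
    move=> cf; apply: (comp (f \o Phi)).
    exact: (@continuous_comp _ _ _ Phi f _ (Phi_continuous GW0) cf).
  have cA j v : ddir1 (Acoef i j) v (Phi (W p)) @[p --> ((t, 0) : R * R)] -->
      ddir1 (Acoef i j) v (Phi (W (t, 0))).
    apply/compPhi/differentiable_continuous.
    exact/Acoef_differentiable1/Uset_Phi.
  (* The direction [dP p] moves with [p], so the derivative of [A] along it is expanded in fixed
     directions, in which the derivatives of [A] are continuous. *)
  pose H j k p := D2 d (xdir (basis_vec k)) (W p) *
    ddir1 (Acoef i j) (pdir (basis_vec k)) (Phi (W p)).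
  pose G j p := c' p.1 0 j *
    (D1 d (W p) * ddir1 (Acoef i j) udir (Phi (W p)) + \sum_k H j k p).
  have GE p : Gamma (W p) -> \sum_j G j p =
      \sum_j c' p.1 0 j * ddir1 (Acoef i j) (dP p) (Phi (W p)).
    move=> Gp; apply: eq_bigr => j _; congr (_ * _).
    have dA := Acoef_differentiable i j (Uset_Phi g Gp).
    rewrite [RHS](ddir1_updir _ _ dA) (ddir1_pdir _ dA); congr (_ + _).
    by apply: eq_bigr => k _; rewrite [_ 0 k]mxE.
  rewrite /prop_for /continuous_at /= -(GE (t, 0))//.
  apply: (@cvg_trans _ (\sum_j G j p @[p --> ((t, 0) : R * R)])).
    apply: near_eq_cvg; near=> p; rewrite GE//.
    by near: p.
  apply: (@cvg_sum_ord _ (nbhs ((t, 0) : R * R)) _ _ G (G ^~ (t, 0))) => j; apply: cvgM.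
    have := @continuous_comp _ _ _ (fst : R * R -> R) (fun s => c' s 0 j) ((t, 0) : R * R).
    by apply; [exact: cvg_fst|exact: cc'].
  apply: cvgD.
    apply: cvgM => //; apply: comp; apply/differentiable_continuous.
    exact: (C2_differentiable1 gC2 d GW0).
  apply: (@cvg_sum_ord _ (nbhs ((t, 0) : R * R)) _ _ (H j) (H j ^~ (t, 0))) => k.
  apply: cvgM => //; apply: comp.
  exact: (C2_continuous2 gC2).
- near=> s.
  have Ts : T s by near: s; exact: open_nbhs_nbhs.
  have := is_derive_curve (is_derive_line (w s) d 0)
    (C2_differentiable1 gC2 (xdir (basis_vec i)) _).
  by rewrite scale0r addr0 => /(_ (Gw Ts)); rewrite -ddir2_at.
Unshelve. all: by end_near. Qed.

Variables (q0 dq : X).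
Hypothesis wQ : forall t j, T t ->
  - ((D1 zdir (w t))^-1 * D1 (ydir (basis_vec j)) (w t)) = q0 0 j + t * dq 0 j.

Definition m_of (s : R) : R := - D1 zdir (w s).
Definition dm_of (s : R) : R := - D2 (xdir (c' s)) zdir (w s).
Notation m := m_of.
Notation dm := dm_of.

Lemma m_neq0 t : T t -> m t != 0.
Proof. by move=> Tt; rewrite oppr_eq0; exact: (g_z_neq0 hg (Gw Tt)). Qed.

Lemma is_derive_D1_curve v t : T t ->
  is_derive t 1 (fun s => D1 v (w s)) (D2 (xdir (c' t)) v (w t)).
Proof.
move=> Tt; rewrite ddir2_at.
exact: (is_derive_curve (is_derive_lift_curve y z Tt) (C2_differentiable1 gC2 v (Gw Tt))).
Qed.

Lemma is_derive_m t : T t -> is_derive t 1 m (dm t).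
Proof. by move=> Tt; apply: is_deriveN; exact: is_derive_D1_curve. Qed.

Lemma dm_continuous t : T t -> {for t, continuous dm}.
Proof.
move=> Tt.
pose h i s := c' s 0 i * D2 (xdir (basis_vec i)) zdir (w s).
have hE s : T s -> - \sum_i h i s = dm s.
  by move=> Ts; rewrite /dm_of (ddir2_coordl hg zdir (c' s) xdir_linear (Gw Ts)).
rewrite /prop_for /continuous_at -(hE t Tt).
apply: (@cvg_trans _ (- \sum_i h i s @[s --> t])).
  have nearT : \forall s \near t, T s by exact: open_nbhs_nbhs.
  apply: near_eq_cvg; near=> s; rewrite hE//.
  by near: s.
suff cs : {for t, continuous (fun s => \sum_i h i s)} by exact: (continuousN cs).
apply: (@cvg_sum_ord _ (nbhs t) _ _ h (h ^~ t)) => i.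
apply: cvgM; first exact: cc'.
have cw : {for t, continuous w}.
  by apply/differentiable_continuous/derivable1_diffP; have [] := is_derive_lift_curve y z Tt.
apply: (@continuous_comp _ _ _ w (D2 (xdir (basis_vec i)) zdir)) => //.
exact: (C2_continuous2 gC2 (Gw Tt)).
Unshelve. all: by end_near. Qed.

(* [D1 (0, eta, zeta) / m] is affine along a curve on which [Q] is affine. *)
Lemma linearised_quotient_derivative (eta : X) (zeta t : R) : T t ->
  (\sum_i c' t 0 i * D2 (0, eta, zeta) (xdir (basis_vec i)) (w t)) / m t -
  D1 (0, eta, zeta) (w t) * (dm t / m t ^+ 2) = \sum_j eta 0 j * dq 0 j.
Proof.
move=> Tt; have m0 := m_neq0 Tt.
(* As [g_y = m Q] on the curve, [g_y . eta + zeta g_z = m (Q . eta - zeta)]. *)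
pose psi (s : R) := \sum_j eta 0 j * (q0 0 j + s * dq 0 j) - zeta.
have phiE s : T s -> D1 (0, eta, zeta) (w s) = m s * psi s.
  move=> Ts; have z0 := g_z_neq0 hg (Gw Ts).
  rewrite (ddir1_yz hg)//; last exact: Gw.
  rewrite (ddir1_coord hg eta ydir_linear (Gw Ts)) /psi mulrBr; congr (_ + _).
    rewrite mulr_sumr; apply: eq_bigr => j _.
    by rewrite -wQ// /m_of; field.
  by rewrite /m_of; ring.
have dphi : D2 (xdir (c' t)) (0, eta, zeta) (w t) =
    dm t * psi t + m t * \sum_j eta 0 j * dq 0 j.
  apply: is_derive_unique (is_derive_D1_curve (0, eta, zeta) Tt) _.
  have dpsi : is_derive t 1 psi (\sum_j eta 0 j * dq 0 j).
    have h j : is_derive t 1 (fun s : R => eta 0 j * (q0 0 j + s * dq 0 j)) (eta 0 j * dq 0 j).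
      exact: (is_deriveZ (eta 0 j) (is_derive_line (q0 0 j) (dq 0 j) t)).
    have := is_deriveB (is_derive_bigsum (index_enum 'I_n) h) (is_derive_cst zeta t 1).
    by rewrite subr0.
  have := is_deriveM (is_derive_m Tt) dpsi.
  rewrite -[_ *: _ + _]/(_ * _ + _ * _) addrC (mulrC (psi t)).
  apply: near_eq_is_derive; near=> s; rewrite phiE//.
  by near: s; exact: open_nbhs_nbhs.
have -> : \sum_i c' t 0 i * D2 (0, eta, zeta) (xdir (basis_vec i)) (w t) =
    dm t * psi t + m t * \sum_j eta 0 j * dq 0 j.
  rewrite -dphi (ddir2_coordl hg (0, eta, zeta) (c' t) xdir_linear (Gw Tt)).
  by apply: eq_bigr => i _; rewrite (ddir2_sym oG gC2 (0, eta, zeta) _ (Gw Tt)).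
by rewrite phiE//; field.
Unshelve. all: by end_near. Qed.

Variables (y1 : X) (z1 : R).
Let w1 (s : R) : V := (c s, y1, z1).
Hypothesis Gw1 : forall t, T t -> Gamma (w1 t).

Definition k_of (s : R) : R := g (w1 s) - g (w s).
Definition dgx_of (s : R) : X := gx (w1 s) - gx (w s).
Definition dk_of (s : R) : R := \sum_i dgx_of s 0 i * c' s 0 i.
Notation k := k_of.
Notation pi := dgx_of.
Notation dk := dk_of.

Lemma pi_coord s i : pi s 0 i = D1 (xdir (basis_vec i)) (w1 s) - D1 (xdir (basis_vec i)) (w s).
Proof. by rewrite -!gxE /dgx_of [LHS]mxE [X in _ + X]mxE. Qed.

Definition v_of (s : R) : R := k s / m s.
Definition dv_of (s : R) : R := dk s / m s - k s * (dm s / m s ^+ 2).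

Lemma is_derive_k t : T t -> is_derive t 1 k (dk t).
Proof.
move=> Tt.
have dg y' z' : Gamma (c t, y', z') ->
    is_derive t 1 (fun s => g (c s, y', z')) (D1 (xdir (c' t)) (c t, y', z')).
  move=> G; rewrite ddir1_at.
  exact: (is_derive_curve (is_derive_lift_curve y' z' Tt) (C2_differentiable gC2 G)).
have h := is_deriveB (dg _ _ (Gw1 Tt)) (dg _ _ (Gw Tt)).
apply: (is_derive_eq h); rewrite /dk_of.
rewrite (ddir1_coord hg (c' t) xdir_linear (Gw1 Tt)).
rewrite (ddir1_coord hg (c' t) xdir_linear (Gw Tt)) -sumrB.
by apply: eq_bigr => i _; rewrite pi_coord; ring.
Qed.

Lemma is_derive_v t : T t -> is_derive t 1 v_of (dv_of t).
Proof.
move=> Tt; have m0 := m_neq0 Tt.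
have h := is_deriveM (is_derive_k Tt) (is_derive_inv (is_derive_m Tt) m0).
apply: (is_derive_eq h); rewrite -[_ *: _ + _]/(_ * _ + _ * _) /dv_of.
by ring.
Qed.

(** Since [Phi (w1 t) - Phi (w t) = (0, k t, pi t)], this is the remainder of the first order
    expansion of [A] at [Phi (w t)], contracted twice with the velocity. *)
Definition W_of (t : R) : R := \sum_i \sum_j c' t 0 i * c' t 0 j *
  (Acoef i j (Phi (w1 t)) - Acoef i j (Phi (w t)) -
   ddir1 (Acoef i j) (0, k t, pi t) (Phi (w t))).

(* Only [c'], not [c''], is available: in [v'] the factor multiplying [c' s - c' t] vanishes at [t], so continuity of [c'] suffices. *)
Lemma is_derive_dv t : T t -> is_derive t 1 dv_of (W_of t / m t).
Proof.
move=> Tt; have m0 := m_neq0 Tt.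
(* The variation [(eta, zeta)] reproduces [k] and [pi] at the single time [t] and contributes a
   constant to [v']. What is left of [v'] is the sum of the [rho i * b i] minus [r * beta], where
   every [rho i] and [r] vanish at [t]. *)
have [eta [zeta [eD1 eD2]]] := yz_derivative_surjective hg hA2 (pi t) (k t) (Gw Tt).
set d : V := (0, eta, zeta) in eD1 eD2.
pose rho i (s : R) := pi s 0 i - D2 d (xdir (basis_vec i)) (w s).
pose r (s : R) := k s - D1 d (w s).
pose b i (s : R) := c' s 0 i / m s.
pose beta (s : R) := dm s / m s ^+ 2.
pose drho i := \sum_j c' t 0 j * (Acoef i j (Phi (w1 t)) - Acoef i j (Phi (w t)) -
   ddir1 (Acoef i j) (0, k t, pi t) (Phi (w t))).
have rho0 i : rho i t = 0 by rewrite /rho eD2 subrr.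
have r0 : r t = 0 by rewrite /r eD1 subrr.
have cm : {for t, continuous m}.
  by apply/differentiable_continuous/derivable1_diffP; have [] := is_derive_m Tt.
have cmV : {for t, continuous (fun s => (m s)^-1)} by exact: (@continuousV _ _ m t m0 cm).
have cb i : {for t, continuous (b i)} by exact: (continuousM (@cc' t Tt i) cmV).
have cbeta : {for t, continuous beta}.
  have -> : beta = (fun s => dm s * ((m s)^-1 * (m s)^-1)).
    by apply/funext => s; rewrite /beta -invfM expr2.
  exact: (continuousM (dm_continuous Tt) (continuousM cmV cmV)).
have dD1 i y' z' : Gamma (c t, y', z') ->
    is_derive t 1 (fun s => D1 (xdir (basis_vec i)) (c s, y', z'))
      (\sum_j c' t 0 j * Acoef i j (Phi (c t, y', z'))).
  move=> G.
  have := is_derive_curve (is_derive_lift_curve y' z' Tt)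
    (C2_differentiable1 gC2 (xdir (basis_vec i)) G).
  rewrite -ddir2_at (ddir2_coordl hg _ _ xdir_linear G).
  by under eq_bigr do rewrite -Acoef_Phi//.
have drhoP i : is_derive t 1 (rho i) (drho i).
  have := is_deriveB (is_deriveB (dD1 i _ _ (Gw1 Tt)) (dD1 i _ _ (Gw Tt)))
    (is_derive_D2_curve eta zeta i Tt).
  rewrite (_ : \row_k _ = pi t); last by apply/rowP => l; rewrite mxE eD2.
  rewrite eD1 -!sumrB => h.
  rewrite /drho; under eq_bigr do rewrite !mulrBr.
  by move: h; apply: near_eq_is_derive; near=> s; rewrite /rho pi_coord.
have drP : is_derive t 1 r 0.
  have h := is_deriveB (is_derive_k Tt) (is_derive_D1_curve d Tt).
  apply: (is_derive_eq h).
  rewrite (ddir2_coordl hg d (c' t) xdir_linear (Gw Tt)) /dk_of -sumrB big1// => i _.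
  by rewrite (ddir2_sym oG gC2 _ d (Gw Tt)) eD2; ring.
have dsum := is_derive_bigsum (index_enum 'I_n)
  (fun i => is_derive_vanishing_mul (drhoP i) (rho0 i) (cb i)).
have := is_deriveB (is_deriveD dsum (is_derive_cst (\sum_j eta 0 j * dq 0 j) t 1))
  (is_derive_vanishing_mul drP r0 cbeta).
rewrite mul0r addr0 subr0.
rewrite (_ : \sum_i drho i * b i t = W_of t / m t); last first.
  rewrite /W_of mulr_suml; apply: eq_bigr => i _.
  rewrite /drho /b !mulr_suml; apply: eq_bigr => j _.
  by ring.
apply: near_eq_is_derive; near=> s.
have Ts : T s by near: s; exact: open_nbhs_nbhs.
rewrite -(linearised_quotient_derivative eta zeta Ts) -[LHS]/(\sum_i rho i s * b i s + _ - r s * beta s).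
rewrite /dv_of /dk_of /r /beta mulr_suml mulr_suml.
rewrite addrA -big_split/=.
rewrite (eq_bigr (fun i => pi s 0 i * c' s 0 i / m s)); last first.
  by move=> i _; rewrite /rho /b; ring.
by rewrite -/d; ring.
Unshelve. all: by end_near. Qed.

End AlongCurve.
End SecondDerivative.

(** * Convexity of [A] in codimension one *)

Section CodimensionOneConvexity.
Context {R : realType} {n : nat}.
Notation X := 'rV[R]_n.
Notation V := (X * X * R)%type.
Notation VU := (X * R * X)%type.
Variables (Gamma : set V) (g : V -> R).
Hypotheses (hg : generating_function Gamma g) (hA1 : A1 Gamma g)
  (hA2 : A2 Gamma g) (hA : A_twice_differentiable Gamma g) (hA3w : A3w Gamma g).

Notation U := (Uset Gamma g).
Notation A := (Acoef Gamma g).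
Let oU : open U. Proof. exact: Uset_open. Qed.

Definition qform (xi : X) (P : VU) : R :=
  \sum_i \sum_j xi 0 i * xi 0 j * A i j P.

Lemma qform_differentiable xi P : U P -> differentiable (qform xi) P.
Proof.
move=> UP; apply: differentiable_bigsum => i; apply: differentiable_bigsum => j.
exact/differentiableZ/Acoef_differentiable.
Qed.

Lemma is_derive_qform xi v P : U P ->
  is_derive P v (qform xi) (\sum_i \sum_j xi 0 i * xi 0 j * ddir1 (A i j) v P).
Proof.
move=> UP; apply: is_derive_bigsum => i; apply: is_derive_bigsum => j.
apply: is_deriveZ; rewrite ddir1_at.
exact/derivableP/diff_derivable/Acoef_differentiable.
Qed.

Lemma ddir1_qform xi v P : U P ->
  ddir1 (qform xi) v P = \sum_i \sum_j xi 0 i * xi 0 j * ddir1 (A i j) v P.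
Proof. by move=> UP; rewrite ddir1_at; have [_ ->] := is_derive_qform xi v UP. Qed.

Lemma derive_pslice (f : VU -> R) x u p v :
  'D_v (fun q => f (x, u, q)) p = 'D_(pdir v) f (x, u, p).
Proof.
rewrite /derive.
have -> : (fun h : R => h^-1 *: (((fun q => f (x, u, q)) \o shift p) (h *: v) - f (x, u, p))) =
    (fun h : R => h^-1 *: ((f \o shift (x, u, p)) (h *: pdir v) - f (x, u, p))).
  apply/funext => h; congr (_ *: (f _ - _)).
  by congr (_, _, _); rewrite /= scaler0 add0r.
by [].
Qed.

Lemma ddir2_pdir i j (eta : X) P : U P ->
  ddir2 (A i j) (pdir eta) (pdir eta) P = \sum_k \sum_l
    eta 0 k * eta 0 l * ddir2 (A i j) (pdir (basis_vec k)) (pdir (basis_vec l)) P.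
Proof.
move=> UP; rewrite ddir2_at (derive_coord eta pdir_linear); last exact: Acoef_differentiable1.
apply: eq_bigr => k _.
rewrite (@near_eq_derive _ _ _ _
  (fun P => \sum_l eta 0 l * ddir1 (A i j) (pdir (basis_vec l)) P)); last first.
  near=> Q; rewrite ddir1_pdir//; apply: Acoef_differentiable => //; near: Q.
  exact: open_nbhs_nbhs.
have h l : is_derive P (pdir (basis_vec k))
    (fun P => eta 0 l * ddir1 (A i j) (pdir (basis_vec l)) P)
    (eta 0 l * ddir2 (A i j) (pdir (basis_vec k)) (pdir (basis_vec l)) P).
  apply: is_deriveZ; rewrite ddir2_at.
  exact/derivableP/diff_derivable/Acoef_differentiable1.
have [_ ->] := is_derive_bigsum (index_enum 'I_n) h.
by rewrite mulr_sumr; apply: eq_bigr => l _; rewrite mulrA.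
Unshelve. all: by end_near. Qed.

Lemma A3w_qform xi eta P : U P -> dotv xi eta = 0 ->
  0 <= \sum_i \sum_j xi 0 i * xi 0 j * ddir2 (A i j) (pdir eta) (pdir eta) P.
Proof.
case: P => [[x u] p] UP xe; have := hA3w UP xe.
suff -> : \sum_i \sum_j xi 0 i * xi 0 j * ddir2 (A i j) (pdir eta) (pdir eta) (x, u, p) =
  \sum_i \sum_j \sum_k \sum_l
      'D_(basis_vec k) ('D_(basis_vec l) (fun q => Amx Gamma g x u q i j)) p
        * xi 0 i * xi 0 j * eta 0 k * eta 0 l by [].
apply: eq_bigr => i _; apply: eq_bigr => j _.
rewrite ddir2_pdir// mulr_sumr; apply: eq_bigr => k _.
rewrite mulr_sumr; apply: eq_bigr => l _.
have -> : 'D_(basis_vec l) (fun q => Amx Gamma g x u q i j) =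
    (fun q => ddir1 (A i j) (pdir (basis_vec l)) (x, u, q)).
  by apply/funext => q; rewrite ddir1_at -derive_pslice.
by rewrite derive_pslice -ddir2_at; ring.
Qed.

Lemma qform_tangent xi eta P : dotv xi eta = 0 ->
  (forall s : R, 0 <= s <= 1 -> U (P + s *: pdir eta)) ->
  qform xi P + ddir1 (qform xi) (pdir eta) P <= qform xi (P + pdir eta).
Proof.
move=> xe US.
have US0 := US 0; rewrite scale0r addr0 lexx ler01 in US0.
pose f (s : R) := qform xi (P + s *: pdir eta).
pose f' (s : R) := \sum_i \sum_j xi 0 i * xi 0 j * ddir1 (A i j) (pdir eta) (P + s *: pdir eta).
pose f'' (s : R) := \sum_i \sum_j
  xi 0 i * xi 0 j * ddir2 (A i j) (pdir eta) (pdir eta) (P + s *: pdir eta).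
have df (s : R) : 0 <= s <= 1 -> is_derive s 1 f (f' s).
  move=> s01; rewrite /f'; have [_ <-] := is_derive_qform xi (pdir eta) (US s s01).
  apply: (is_derive_curve (is_derive_line P (pdir eta) s)).
  exact/qform_differentiable/US.
have df' (s : R) : 0 <= s <= 1 -> is_derive s 1 f' (f'' s).
  move=> s01; apply: is_derive_bigsum => i; apply: is_derive_bigsum => j.
  apply: is_deriveZ; rewrite ddir2_at.
  apply: (is_derive_curve (is_derive_line P (pdir eta) s)).
  exact/Acoef_differentiable1/US.
have := tangent_le df df' (fun s s01 => A3w_qform (US s s01) xe).
by rewrite /f /f' scale0r addr0 scale1r ddir1_qform//; exact: US0.
Qed.

Lemma dotv_gt0 (xi : X) : xi != 0 -> 0 < dotv xi xi.
Proof.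
move=> x0; rewrite lt_neqAle sumr_ge0 ?andbT => [|i _]; last by rewrite -expr2 sqr_ge0.
apply: contra_neq x0 => /esym e; apply/rowP => i; rewrite mxE.
apply/eqP; rewrite -[_ == _]orbb -mulf_eq0; apply/eqP.
by apply: (psumr_eq0P _ e) => // k _; rewrite -expr2 sqr_ge0.
Qed.

Lemma ball_segment (W : normedModType R) (c P v : W) (r s : R) : 0 <= s <= 1 ->
  `|c - P| < r -> `|c - (P + v)| < r -> `|c - (P + s *: v)| < r.
Proof.
move=> /andP[s0 s1] cP cPv.
have -> : c - (P + s *: v) = (1 - s) *: (c - P) + s *: (c - (P + v)).
  rewrite opprD addrA [in RHS]opprD [in RHS]addrA [in RHS](scalerBr s (c - P)) addrA -scalerDl.
  by rewrite subrK scale1r.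
rewrite (le_lt_trans (ler_normD _ _))// !normrZ (ger0_norm s0) ger0_norm ?subr_ge0//.
have [->|s0'] := eqVneq s 0; first by rewrite mul0r subr0 mul1r addr0.
have : 0 < s by rewrite lt_neqAle eq_sym s0'.
by nra.
Qed.

(* Split [pi] into a part orthogonal to [xi], along which [A] is convex, and a multiple of [xi], for which the oscillation of the first derivatives of [A] is enough. *)
Lemma qform_lower_bound (xi : X) (Pc P : VU) (r e k : R) (pi : X) :
  let cc := dotv pi xi / dotv xi xi in
  xi != 0 -> (forall Q, `|Pc - Q| < r -> U Q) ->
  (forall Q Q', `|Pc - Q| < r -> `|Pc - Q'| < r ->
     `|ddir1 (qform xi) udir Q - ddir1 (qform xi) udir Q'| <= e /\
     `|ddir1 (qform xi) (pdir xi) Q - ddir1 (qform xi) (pdir xi) Q'| <= e) ->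
  `|Pc - P| < r -> `|Pc - (P + pdir (pi - cc *: xi))| < r ->
  `|Pc - (P + (0, k, pi))| < r ->
  - (e * (`|k| + `|cc|)) <=
    qform xi (P + (0, k, pi)) - qform xi P - ddir1 (qform xi) (0, k, pi) P.
Proof.
have lin (q1 q0 qp d A1 A2 B1 B2 cc' : R) : q1 - qp = k * A1 + cc' * B1 ->
    q0 + d <= qp -> - (e * `|k|) <= k * (A1 - A2) ->
    - (e * `|cc'|) <= cc' * (B1 - B2) ->
    - (e * (`|k| + `|cc'|)) <= q1 - q0 - (k * A2 + cc' * B2 + d).
  by lra.
move=> cc xi0 BU osc hP hPp hPk; set pp := pi - cc *: xi in hPp.
have N0 := dotv_gt0 xi0.
have xpp : dotv xi pp = 0.
  have -> : dotv xi pp = dotv pi xi - cc * dotv xi xi.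
    by rewrite /dotv mulr_sumr -sumrB; apply: eq_bigr => i _; rewrite !mxE; ring.
  by rewrite /cc mulfVK ?subrr// gt_eqF.
(* From [P] to [P + pdir pp] convexity applies. The remaining displacement [(0, k, cc *: xi)] is
   treated by the mean value theorem, and the derivative found at [Q] is compared with the one at
   [P]. *)
have t1 := qform_tangent xpp (fun s s01 => BU _ (ball_segment s01 hP hPp)).
have e1 : P + pdir pp + (0, k, cc *: xi) = P + (0, k, pi).
  rewrite -addrA; congr (_ + _); congr (_, _, _); rewrite /= ?addr0 ?add0r//.
  by rewrite /pp subrK.
have hs (s : R) : 0 <= s <= 1 -> `|Pc - (P + pdir pp + s *: (0, k, cc *: xi))| < r.
  by move=> s01; apply: ball_segment => //; rewrite e1.
have [s /andP[s0 s1] es] := @MVT_line R VU (qform xi) (P + pdir pp) (0, k, cc *: xi)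
  (fun s s01 => qform_differentiable xi (BU _ (hs s s01))).
have s01 : 0 <= s <= 1 by rewrite !ltW.
rewrite e1 -ddir1_at in es; set Q := P + pdir pp + _ in es.
have hQ : `|Pc - Q| < r by exact: hs.
have dQ := qform_differentiable xi (BU _ hQ).
have dP := qform_differentiable xi (BU _ hP).
have dirE Q' : differentiable (qform xi) Q' ->
    ddir1 (qform xi) (pdir (cc *: xi)) Q' = cc * ddir1 (qform xi) (pdir xi) Q'.
  have -> : pdir (cc *: xi) = cc *: pdir xi by congr (_, _, _); rewrite /= scaler0.
  by move=> dQ'; rewrite !ddir1_at; exact: deriveZdir.
have e2 : ddir1 (qform xi) (0, k, pi) P = k * ddir1 (qform xi) udir P +
    cc * ddir1 (qform xi) (pdir xi) P + ddir1 (qform xi) (pdir pp) P.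
  rewrite (ddir1_updir _ _ dP) -(dirE P dP) -addrA; congr (_ + _).
  have -> : pdir pi = pdir (cc *: xi) + pdir pp.
    by congr (_, _, _); rewrite /= ?addr0// /pp addrC subrK.
  by rewrite !ddir1_at; exact: deriveDdir.
have e3 : ddir1 (qform xi) (0, k, cc *: xi) Q =
    k * ddir1 (qform xi) udir Q + cc * ddir1 (qform xi) (pdir xi) Q.
  by rewrite (ddir1_updir _ _ dQ) dirE.
have [h1 h2] := osc _ _ hQ hP.
rewrite e2; rewrite e3 in es.
set a1 := ddir1 _ udir Q in es h1; set a2 := ddir1 _ udir P in h1 *.
set b1 := ddir1 _ (pdir xi) Q in es h2; set b2 := ddir1 _ (pdir xi) P in h2 *.
have k1 : - (e * `|k|) <= k * (a1 - a2).
  rewrite lerNl (le_trans (ler_norm _))// normrN normrM mulrC.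
  by rewrite ler_wpM2r.
have k2 : - (e * `|cc|) <= cc * (b1 - b2).
  rewrite lerNl (le_trans (ler_norm _))// normrN normrM mulrC.
  by rewrite ler_wpM2r.
exact: lin es t1 k1 k2.
Qed.

End CodimensionOneConvexity.

Lemma differentiable_snd (R : realType) (U W : normedModType R) (p : U * W) :
  differentiable (snd : U * W -> W) p.
Proof.
have /linear_differentiable : continuous (snd : {linear (U * W)%type -> W}).
  by move=> q; exact: cvg_snd.
exact.
Qed.

(** * The lower bound for [v''], locally in time and in [(y, z)] *)

Section LocalInequality.
Context {R : realType} {n : nat}.
Notation X := 'rV[R]_n.
Notation V := (X * X * R)%type.
Notation VU := (X * R * X)%type.
Variables (Gamma : set V) (g : V -> R).
Hypotheses (hg : generating_function Gamma g) (hA1 : A1 Gamma g)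
  (hA2 : A2 Gamma g)
  (hA : A_twice_differentiable Gamma g) (hA3w : A3w Gamma g).

Notation U := (Uset Gamma g).
Notation A := (Acoef Gamma g).
Notation Phi := (Phi g).
Let oG : open Gamma. Proof. by case: hg => -[]. Qed.
Let oU : open U. Proof. exact: Uset_open. Qed.

Lemma dotv_le (a b : X) : `|dotv a b| <= n%:R * `|a| * `|b|.
Proof.
rewrite /dotv (le_trans (ler_norm_sum _ _ _))//.
apply: (@le_trans _ _ (\sum_(i < n) `|a| * `|b|)); last first.
  by rewrite sumr_const card_ord -mulrA mulr_natl.
by apply: ler_sum => i _; rewrite normrM ler_pM// coord_le_mx_norm.
Qed.

Lemma norm_sqr_le_dotv (a : X) : `|a| ^+ 2 <= dotv a a.
Proof.
have [[i <-]|a0] : (exists i, `|a 0 i| = `|a|) \/ `|a| = 0.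
  have [a0|an0] := eqVneq (`|a|) 0; [by right|left].
  have [[i j] e] := mx_norm_neq0 an0.
  by exists j; rewrite -[RHS]/(mx_norm a) e (ord1 i).
- rewrite real_normK ?num_real// /dotv (bigD1 i)//= -expr2 lerDl.
  by rewrite sumr_ge0// => j _; rewrite -expr2 sqr_ge0.
- by rewrite a0 expr0n/= sumr_ge0// => j _; rewrite -expr2 sqr_ge0.
Qed.

Section Local.
Variables (c c' : R -> X) (T : set R) (oT : open T).
Hypothesis dc : forall t, T t -> is_derive t 1 c (c' t).
Hypothesis cc' : forall t, T t -> forall j, {for t, continuous (fun s => c' s 0 j)}.
Hypothesis c'0 : forall t, T t -> c' t != 0.
Variables (y : X) (z : R).
Hypothesis Gw : forall t, T t -> Gamma (c t, y, z).
Notation m := (m_of g c y z).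
Notation dm := (dm_of g c c' y z).

Let N t := dotv (c' t) (c' t).
(** Chosen so that [|k| + |cc| <= C * m * (|v| + |v'|)], where [cc] is the coefficient of [pi] along
    the velocity. It comes from [k = m v] and [pi . c' = k' = m v' + v m']. *)
Let C t := (m t + (m t + `|dm t|) / N t) / m t.

Lemma m_gt0 t : T t -> 0 < m t.
Proof.
move=> Tt; rewrite /m_of oppr_gt0 -g_zE.
by case: hg => _ _ _; apply; exact: Gw.
Qed.

Let C_continuous t : T t -> {for t, continuous C}.
Proof.
move=> Tt.
have cm : {for t, continuous m}.
  apply/differentiable_continuous/derivable1_diffP.
  by have [] := is_derive_m hg dc Gw Tt.
have m0 : m t != 0 by rewrite gt_eqF// m_gt0.
have N0 : N t != 0 by rewrite gt_eqF// dotv_gt0// c'0.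
have cN : {for t, continuous N}.
  apply: (@cvg_sum_ord _ _ (nbhs t) _ _ (fun i s => c' s 0 i * c' s 0 i)) => i.
  by apply: cvgM; exact: cc'.
have cdm := dm_continuous hg oT dc cc' Gw Tt.
have cadm : {for t, continuous (fun s => `|dm s|)} by exact: (cvg_norm cdm).
have cmV : {for t, continuous (fun s => (m s)^-1)} by exact: (@continuousV _ _ m t m0 cm).
have cNV : {for t, continuous (fun s => (N s)^-1)} by exact: (@continuousV _ _ N t N0 cN).
exact: (continuousM (continuousD cm (continuousM (continuousD cm cadm) cNV)) cmV).
Qed.

(** Near [Phi (c t0, y, z)] the relevant first derivatives of [A] oscillate by at most a small [e],
    and [C] converts the resulting error into [|v| + |v'|]. The neighbourhood is taken jointly in
    the time and in [(y, z)], as a compactness argument over [[0, 1]] requires. *)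
Lemma W_lower_near t0 : T t0 ->
  \forall p \near ((t0, (y, z)) : R * (X * R)), T p.1 /\
    Gamma (c p.1, p.2.1, p.2.2) /\
    - (4%:R^-1 * (`|v_of g c y z p.2.1 p.2.2 p.1| + `|dv_of g c c' y z p.2.1 p.2.2 p.1|)) <=
    W_of Gamma g c c' y z p.2.1 p.2.2 p.1 / m p.1.
Proof.
move=> Tt0; pose Pc := Phi (c t0, y, z).
have UPc : U Pc by apply: Uset_Phi; exact: Gw.
have mt0 := m_gt0 Tt0.
have C0 : 0 <= C t0.
  rewrite divr_ge0 ?(ltW mt0)// addr_ge0 ?(ltW mt0)// divr_ge0//.
    by rewrite addr_ge0 ?(ltW mt0).
  by rewrite ltW// dotv_gt0// c'0.
pose K := C t0 + 1; have K0 : 0 < K by rewrite ltr_wpDl.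
(* [C <= K] near [t0], so that [e * C <= 1/4] there. *)
pose e : R := (4%:R * K)^-1; have e0 : 0 < e by rewrite invr_gt0 mulr_gt0.
(* [G1] and [G2] are the derivatives of [qform (c' t)] in the directions [udir] and [pdir (c' t)],
   regarded as functions of [t] and the point together: the quadratic form itself changes with
   time. *)
pose G1 (p : R * VU) := \sum_i \sum_j c' p.1 0 i * c' p.1 0 j * ddir1 (A i j) udir p.2.
pose G2 (p : R * VU) := \sum_i \sum_j c' p.1 0 i * c' p.1 0 j *
  \sum_k c' p.1 0 k * ddir1 (A i j) (pdir (basis_vec k)) p.2.
have cfst i : (fun p : R * VU => c' p.1 0 i) @ ((t0, Pc) : R * VU) --> c' t0 0 i.
  have := @continuous_comp _ _ _ (fst : R * VU -> R) (fun s => c' s 0 i) ((t0, Pc) : R * VU).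
  by apply; [exact: cvg_fst|exact: cc'].
have csnd i j v : (fun p : R * VU => ddir1 (A i j) v p.2) @ ((t0, Pc) : R * VU) --> ddir1 (A i j) v Pc.
  have := @continuous_comp _ _ _ (snd : R * VU -> VU) (ddir1 (A i j) v) ((t0, Pc) : R * VU).
  apply; first exact: cvg_snd.
  exact/differentiable_continuous/Acoef_differentiable1.
have cG1 : G1 @ ((t0, Pc) : R * VU) --> G1 (t0, Pc).
  apply: (@cvg_sum_ord _ _ (nbhs ((t0, Pc) : R * VU)) _ _
    (fun i p => \sum_j c' p.1 0 i * c' p.1 0 j * ddir1 (A i j) udir p.2)) => i.
  apply: (@cvg_sum_ord _ _ (nbhs ((t0, Pc) : R * VU)) _ _
    (fun j p => c' p.1 0 i * c' p.1 0 j * ddir1 (A i j) udir p.2)) => j.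
  by apply: cvgM => //; exact: cvgM.
have cG2 : G2 @ ((t0, Pc) : R * VU) --> G2 (t0, Pc).
  apply: (@cvg_sum_ord _ _ (nbhs ((t0, Pc) : R * VU)) _ _
    (fun i p => \sum_j c' p.1 0 i * c' p.1 0 j *
       \sum_k c' p.1 0 k * ddir1 (A i j) (pdir (basis_vec k)) p.2)) => i.
  apply: (@cvg_sum_ord _ _ (nbhs ((t0, Pc) : R * VU)) _ _
    (fun j p => c' p.1 0 i * c' p.1 0 j *
       \sum_k c' p.1 0 k * ddir1 (A i j) (pdir (basis_vec k)) p.2)) => j.
  apply: cvgM; first exact: cvgM.
  apply: (@cvg_sum_ord _ _ (nbhs ((t0, Pc) : R * VU)) _ _
    (fun k p => c' p.1 0 k * ddir1 (A i j) (pdir (basis_vec k)) p.2)) => k.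
  exact: cvgM.
have e20 : 0 < e / 2%:R by rewrite divr_gt0.
have : \forall p \near ((t0, Pc) : R * VU), [/\ U p.2,
    `|G1 (t0, Pc) - G1 p| < e / 2%:R & `|G2 (t0, Pc) - G2 p| < e / 2%:R].
  have nU : \forall p \near ((t0, Pc) : R * VU), U p.2.
    by apply: cvg_snd; exact: open_nbhs_nbhs.
  near=> p; split.
  - by near: p.
  - by near: p; move: (e / 2%:R) e20; apply/cvgrPdist_lt.
  - by near: p; move: (e / 2%:R) e20; apply/cvgrPdist_lt.
move=> /nbhs_normP[r /= r0 Hr].
(* If both points are within [r'] of [Pc], then [|pi| < 2 r']. In the sup norm the part of [pi]
   orthogonal to the velocity is at most [(n + 1) |pi|], so the intermediate point of the splitting
   is within [r' + 2 (n + 1) r' = r] of [Pc]. *)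
pose r' := r / (2%:R * n%:R + 3%:R).
have d0 : 0 < (2%:R * n%:R + 3%:R : R) by rewrite ltr_wpDl.
have r'0 : 0 < r' by rewrite divr_gt0.
have r'r : (2%:R * n%:R + 3%:R) * r' = r by rewrite /r' mulrC divfK// gt_eqF.
have dc1 : differentiable (fun p : R * (X * R) => c p.1) (t0, (y, z)).
  apply: (@differentiable_comp _ _ _ _ (fst : R * (X * R) -> R) c).
    exact: differentiable_fst.
  by apply/derivable1_diffP; have [] := dc Tt0.
have lec : {for ((t0, (y, z)) : R * (X * R)), continuous (fun p : R * (X * R) => (c p.1, p.2.1, p.2.2) : V)}.
  apply: differentiable_continuous; apply: differentiable_pair; first apply: differentiable_pair => //.
  - apply: (@differentiable_comp _ _ _ _ (snd : R * (X * R) -> X * R) (fst : X * R -> X)).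
      exact: differentiable_snd.
    exact: differentiable_fst.
  - apply: (@differentiable_comp _ _ _ _ (snd : R * (X * R) -> X * R) (snd : X * R -> R)).
      exact: differentiable_snd.
    exact: differentiable_snd.
have lec0 : {for ((t0, (y, z)) : R * (X * R)), continuous (fun p : R * (X * R) => (c p.1, y, z) : V)}.
  apply: differentiable_continuous; apply: differentiable_pair; last exact: differentiable_cst.
  by apply: differentiable_pair => //; exact: differentiable_cst.
have cPc : {for (c t0, y, z), continuous Phi} by apply: (Phi_continuous hg); exact: Gw.
have cP1 : \forall p \near ((t0, (y, z)) : R * (X * R)), `|Pc - Phi (c p.1, p.2.1, p.2.2)| < r'.
  have /cvgrPdist_lt/(_ r' r'0) := @continuous_comp _ _ _ _ Phi ((t0, (y, z)) : R * (X * R)) lec cPc.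
  exact.
have cP0 : \forall p \near ((t0, (y, z)) : R * (X * R)), `|Pc - Phi (c p.1, y, z)| < r'.
  have /cvgrPdist_lt/(_ r' r'0) := @continuous_comp _ _ _ _ Phi ((t0, (y, z)) : R * (X * R)) lec0 cPc.
  exact.
have nG : \forall p \near ((t0, (y, z)) : R * (X * R)), Gamma (c p.1, p.2.1, p.2.2).
  by apply: lec; apply: open_nbhs_nbhs; split=> //; exact: Gw.
have nfst (P : set R) : nbhs t0 P -> \forall p \near ((t0, (y, z)) : R * (X * R)), P p.1.
  exact: cvg_fst.
have nT : \forall p \near ((t0, (y, z)) : R * (X * R)), T p.1.
  by apply: (nfst T); exact: open_nbhs_nbhs.
have nr : \forall p \near ((t0, (y, z)) : R * (X * R)), `|t0 - p.1| < r.
  by apply: (nfst [set t | `|t0 - t| < r]); apply/nbhs_normP; exists r.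
have nC : \forall p \near ((t0, (y, z)) : R * (X * R)), C p.1 <= K.
  apply: (nfst [set t | C t <= K]); near=> t.
  have : `|C t0 - C t| < 1.
    near: t; have /cvgrPdist_lt/(_ 1 ltr01) := C_continuous Tt0.
    exact.
  by rewrite ltr_norml => /andP[+ _]; rewrite /= /K; move: (C t) (C t0) => a b; lra.
near=> p.
have Tp : T p.1 by near: p.
have G0 := Gw Tp.
have Gp : Gamma (c p.1, p.2.1, p.2.2) by near: p.
split=> //; split=> //.
have h0 : `|Pc - Phi (c p.1, y, z)| < r' by near: p.
have h1 : `|Pc - Phi (c p.1, p.2.1, p.2.2)| < r' by near: p.
have hr : `|t0 - p.1| < r by near: p.
have hC : C p.1 <= K by near: p.
have mp := m_gt0 Tp.
have Np : 0 < N p.1 by apply/dotv_gt0/c'0.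
set P0 := Phi (c p.1, y, z) in h0; set P1 := Phi (c p.1, p.2.1, p.2.2) in h1.
pose k := k_of g c y z p.2.1 p.2.2 p.1.
pose pi := dgx_of g c y z p.2.1 p.2.2 p.1.
pose cc := dotv pi (c' p.1) / N p.1.
have P1E : P0 + (0, k, pi) = P1.
  congr (_, _, _); rewrite /= ?addr0//.
    by rewrite /k /k_of addrC subrK.
  by rewrite /pi /dgx_of addrC subrK.
have hpi : `|pi| < 2%:R * r'.
  have : `|P1 - P0| < 2%:R * r'.
    have -> : P1 - P0 = (Pc - P0) - (Pc - P1) by rewrite opprB [RHS]addrC subrKA.
    by rewrite (le_lt_trans (ler_normB _ _))//; lra.
  apply: le_lt_trans; rewrite -P1E addrC addKr prod_normE le_max.
  by rewrite lexx orbT.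
have hpp : `|pi - cc *: c' p.1| <= (n%:R + 1) * `|pi|.
  rewrite (le_trans (ler_normB _ _))// mulrDl mul1r addrC lerD2r normrZ.
  have -> : `|cc| = `|dotv pi (c' p.1)| / N p.1.
    by rewrite normrM [X in _ * X]ger0_norm// invr_ge0 ltW.
  rewrite mulrAC ler_pdivrMr//.
  apply: (@le_trans _ _ (n%:R * `|pi| * `|c' p.1| * `|c' p.1|)).
    by rewrite ler_wpM2r// dotv_le.
  by rewrite -mulrA -expr2 ler_wpM2l ?norm_sqr_le_dotv// mulr_ge0.
have r'_le : r' <= r.
  rewrite -r'r ler_peMl ?(ltW r'0)//.
  by have : 0 <= n%:R :> R by []; lra.
have inR Q : `|Pc - Q| < r -> `|(t0, Pc) - (p.1, Q)| < r.
  by move=> hQ; rewrite prod_normE gt_max hr.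
have BU Q : `|Pc - Q| < r -> U Q by move=> /inR/Hr[].
have G1E Q : U Q -> ddir1 (qform Gamma g (c' p.1)) udir Q = G1 (p.1, Q).
  by move=> UQ; rewrite (ddir1_qform hA).
have G2E Q : U Q -> ddir1 (qform Gamma g (c' p.1)) (pdir (c' p.1)) Q = G2 (p.1, Q).
  move=> UQ; rewrite (ddir1_qform hA)//.
  apply: eq_bigr => i _; apply: eq_bigr => j _; congr (_ * _).
  by rewrite ddir1_pdir//; exact: Acoef_differentiable.
have osc (f : R * VU -> R) Q Q' : `|f (t0, Pc) - f (p.1, Q)| < e / 2%:R ->
    `|f (t0, Pc) - f (p.1, Q')| < e / 2%:R -> `|f (p.1, Q) - f (p.1, Q')| <= e.
  move=> fQ fQ'.
  have -> : f (p.1, Q) - f (p.1, Q') = (f (t0, Pc) - f (p.1, Q')) - (f (t0, Pc) - f (p.1, Q)).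
    by ring.
  rewrite (le_trans (ler_normB _ _))// (splitr e) lerD// ltW//.
have low := @qform_lower_bound R n Gamma g hg hA1 hA2 hA hA3w (c' p.1) Pc P0 r e k pi (c'0 Tp).
have {}low : - (e * (`|k| + `|cc|)) <= W_of Gamma g c c' y z p.2.1 p.2.2 p.1.
  have -> : W_of Gamma g c c' y z p.2.1 p.2.2 p.1 =
      qform Gamma g (c' p.1) (P0 + (0, k, pi)) - qform Gamma g (c' p.1) P0 -
      ddir1 (qform Gamma g (c' p.1)) (0, k, pi) P0.
    rewrite (ddir1_qform hA); last exact/Uset_Phi.
    rewrite P1E /qform -!sumrB; apply: eq_bigr => i _.
    by rewrite -!sumrB; apply: eq_bigr => j _; rewrite !mulrBr.
  apply: low => //.
  - move=> Q Q' hQ hQ'; rewrite !(G1E _ (BU _ _))// !(G2E _ (BU _ _))//.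
    have [_ a1 a2] := Hr _ (inR _ hQ); have [_ b1 b2] := Hr _ (inR _ hQ').
    by split; exact: osc.
  - exact: lt_le_trans r'_le.
  - rewrite opprD addrA (le_lt_trans (ler_normB _ _))// -r'r.
    have -> : `|pdir (pi - cc *: c' p.1)| = `|pi - cc *: c' p.1|.
      by rewrite /pdir !prod_normE/= !normr0 !max_r.
    have : (n%:R + 1) * `|pi| <= (n%:R + 1) * (2%:R * r').
      by rewrite ler_wpM2l ?ltW// addr_ge0.
    by move: h0 hpp; lra.
  - by rewrite P1E; exact: lt_le_trans r'_le.
pose v := v_of g c y z p.2.1 p.2.2 p.1.
pose dv := dv_of g c c' y z p.2.1 p.2.2 p.1.
have m0 : m p.1 != 0 by rewrite gt_eqF.
have kE : k = m p.1 * v by rewrite /v /v_of -/k mulrC divfK.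
have ccE : cc * N p.1 = m p.1 * dv + v * dm p.1.
  rewrite /cc divfK ?gt_eqF// /dv /dv_of /v /v_of -/k -[dotv _ _]/(dk_of g c c' y z p.2.1 p.2.2 p.1).
  by field.
have hk : `|k| = m p.1 * `|v| by rewrite kE normrM (gtr0_norm mp).
have hcc : `|cc| <= (m p.1 * `|dv| + `|v| * `|dm p.1|) / N p.1.
  rewrite ler_pdivlMr// -{1}(gtr0_norm Np) -normrM ccE.
  by rewrite (le_trans (ler_normD _ _))// !normrM (gtr0_norm mp).
have CE : C p.1 * m p.1 = m p.1 + (m p.1 + `|dm p.1|) / N p.1 by rewrite /C divfK.
rewrite -/v -/dv.
have sum_le : `|k| + `|cc| <= C p.1 * m p.1 * (`|v| + `|dv|).
  rewrite CE; apply: (le_trans (lerD (lexx _) hcc)); rewrite hk.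
  rewrite -subr_ge0.
  have -> : (m p.1 + (m p.1 + `|dm p.1|) / N p.1) * (`|v| + `|dv|) -
      (m p.1 * `|v| + (m p.1 * `|dv| + `|v| * `|dm p.1|) / N p.1) =
      m p.1 * `|dv| + (m p.1 * `|v| + `|dm p.1| * `|dv|) / N p.1 by ring.
  by rewrite addr_ge0 ?divr_ge0 ?addr_ge0 ?mulr_ge0// ltW.
rewrite ler_pdivlMr//; apply: le_trans low.
rewrite mulNr lerN2 (le_trans (ler_wpM2l (ltW e0) sum_le))//.
have -> : e * (C p.1 * m p.1 * (`|v| + `|dv|)) = (e * C p.1) * (m p.1 * (`|v| + `|dv|)).
  by ring.
rewrite [leRHS]mulrAC -[leRHS]mulrA ler_wpM2r//.
  by rewrite mulr_ge0 ?addr_ge0// ltW.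
by rewrite /e invfM -mulrA ler_piMr ?invr_ge0// mulrC ler_pdivrMr// mul1r.
Unshelve. all: by end_near. Qed.

End Local.
End LocalInequality.

(** * Comparison with nearby functions at the far end of the curve *)

Section LocalComparison.
Context {R : realType} {n : nat}.
Notation X := 'rV[R]_n.
Notation V := (X * X * R)%type.
Variables (Gamma : set V) (g : V -> R).
Hypotheses (hg : generating_function Gamma g) (hA1 : A1 Gamma g)
  (hA2 : A2 Gamma g) (hA1star : A1star Gamma g)
  (hA : A_twice_differentiable Gamma g) (hA3w : A3w Gamma g).

Let oG : open Gamma. Proof. by case: hg => -[]. Qed.

(** The vector [xi] is the initial velocity of the curve and is fixed before the competitor [q]. At
    [x0] the two functions agree, so [v] starts at [0] with slope [s / m], and the one-variable
    bound carries the sign of [s] over to [x1]. *)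
Lemma local_comparison (y : X) (z : R) (x0 x1 : X) :
  Gamma (x0, y, z) -> Gamma (x1, y, z) -> x0 != x1 ->
  (forall t : R, 0 <= t <= 1 -> exists2 x, Gamma (x, y, z) &
     Qmap g y z x = (1 - t) *: Qmap g y z x0 + t *: Qmap g y z x1) ->
  exists xi : X, \forall q \near ((y, z) : X * R),
    g (x0, q.1, q.2) = g (x0, y, z) ->
    let s := dotv (gx g (x0, q.1, q.2) - gx g (x0, y, z)) xi in
    0 <= s -> g (x1, y, z) <= g (x1, q.1, q.2) /\
      (0 < s -> g (x1, y, z) < g (x1, q.1, q.2)).
Proof.
move=> G0 G1 x01 seg.
have [c [c' [T [dq [oT T01 c0 c1 hc]]]]] :=
  Q_curve hg hA2 hA1star G0 G1 x01 seg.
have dc t : T t -> is_derive t 1 c (c' t) by move=> /hc[].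
have c'0 t : T t -> c' t != 0 by move=> /hc[].
have cc' t : T t -> forall j, {for t, continuous (fun s => c' s 0 j)} by move=> /hc[].
have Gw t : T t -> Gamma (c t, y, z) by move=> /hc[].
pose q0 : X := \row_j (- ((ddir1 g zdir (x0, y, z))^-1 * ddir1 g (ydir (basis_vec j)) (x0, y, z))).
have wQ t j : T t -> - ((ddir1 g zdir (c t, y, z))^-1 * ddir1 g (ydir (basis_vec j)) (c t, y, z)) =
    q0 0 j + t * dq 0 j.
  by move=> /hc[_ _ _ _ ->]; rewrite [q0 0 j]mxE.
exists (c' 0).
pose Pt (q : X * R) (t : R) := T t /\ Gamma (c t, q.1, q.2) /\
    - (4%:R^-1 * (`|v_of g c y z q.1 q.2 t| + `|dv_of g c c' y z q.1 q.2 t|)) <=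
    W_of Gamma g c c' y z q.1 q.2 t / m_of g c y z t.
(* The bound holds near each [(t, (y, z))]; compactness of [[0, 1]] makes the neighbourhood of
   [(y, z)] independent of [t]. *)
have nearq : \forall q \near ((y, z) : X * R), `[(0:R), 1]%classic `<=` Pt q.
  have /compact_near_coveringP cov := @segment_compact R 0 1.
  apply: (cov _ (nbhs ((y, z) : X * R)) Pt) => t; rewrite /= in_itv/= => /T01 Tt.
  exact: (W_lower_near hg hA1 hA2 hA hA3w oT dc cc' c'0 Gw Tt).
near=> q; move=> eg0; set s := dotv _ _; move=> s0.
have hq (t : R) : 0 <= t <= 1 -> Pt q t.
  move=> t01; have h : `[(0:R), 1]%classic `<=` Pt q by near: q.
  by apply: h; rewrite /= in_itv/=.
(* The times at which the competitor is defined as well; this set is open and still contains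
   [[0, 1]]. *)
pose Tq := [set t | T t /\ Gamma (c t, q.1, q.2)].
have oTq : open Tq.
  rewrite openE => t [Tt Gt].
  have cl : {for t, continuous (fun s => (c s, q.1, q.2) : V)}.
    apply/differentiable_continuous/derivable1_diffP.
    by have [] := is_derive_lift_curve dc q.1 q.2 Tt.
  have n1 : \forall s \near t, T s by exact: open_nbhs_nbhs.
  have n2 : \forall s \near t, Gamma (c s, q.1, q.2) by apply: cl; exact: open_nbhs_nbhs.
  suff : \forall s \near t, Tq s by [].
  by near=> s'; split; near: s'.
have dcq t : Tq t -> is_derive t 1 c (c' t) by move=> [/dc].
have ccq t : Tq t -> forall j, {for t, continuous (fun s => c' s 0 j)} by move=> [/cc'].
have Gwq t : Tq t -> Gamma (c t, y, z) by move=> [/Gw].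
have Gw1q t : Tq t -> Gamma (c t, q.1, q.2) by move=> [].
have wQq t j : Tq t -> - ((ddir1 g zdir (c t, y, z))^-1 * ddir1 g (ydir (basis_vec j)) (c t, y, z)) =
    q0 0 j + t * dq 0 j by move=> [/wQ].
have Tq01 (t : R) : 0 <= t <= 1 -> Tq t by move=> /hq[? [? _]].
have T0 : Tq 0 by apply: Tq01; rewrite lexx ler01.
have T1 : Tq 1 by apply: Tq01; rewrite lexx ler01.
have m0 := m_gt0 hg Gwq T0.
have m1 := m_gt0 hg Gwq T1.
have k0 : k_of g c y z q.1 q.2 0 = 0 by rewrite /k_of c0 eg0 subrr.
have dk0 : dk_of g c c' y z q.1 q.2 0 = s by rewrite /dk_of /dgx_of c0.
have dv0 : dv_of g c c' y z q.1 q.2 0 = s / m_of g c y z 0.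
  by rewrite /dv_of k0 dk0 mul0r subr0.
have := @small_lower_bound_ge0 R (v_of g c y z q.1 q.2) (dv_of g c c' y z q.1 q.2)
  (fun t => W_of Gamma g c c' y z q.1 q.2 t / m_of g c y z t)
  (fun t t01 => is_derive_v hg dcq Gwq Gw1q (Tq01 t t01))
  (fun t t01 => is_derive_dv hg hA1 hA2 hA oTq dcq ccq Gwq wQq Gw1q (Tq01 t t01))
  (fun t t01 => (hq t t01).2.2).
rewrite dv0 {1}/v_of k0 mul0r => /(_ erefl (divr_ge0 s0 (ltW m0))).
rewrite /v_of => h.
have k1 : k_of g c y z q.1 q.2 1 = g (x1, q.1, q.2) - g (x1, y, z) by rewrite /k_of c1.
rewrite k1 in h.
split=> [|sp].
  rewrite -subr_ge0 -(pmulr_lge0 _ (_ : 0 < (m_of g c y z 1)^-1)) ?invr_gt0//.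
  by apply: le_trans h; rewrite !divr_ge0// ltW.
rewrite -subr_gt0 -(pmulr_lgt0 _ (_ : 0 < (m_of g c y z 1)^-1)) ?invr_gt0//.
by apply: lt_le_trans h; rewrite !divr_gt0.
Unshelve. all: by end_near. Qed.

End LocalComparison.

(** * Gradients of supporting functions *)

Section SupportingGradients.
Context {R : realType} {n : nat}.
Notation X := 'rV[R]_n.
Notation V := (X * X * R)%type.
Notation VU := (X * R * X)%type.

Lemma convex_hull_segment (A : set X) (a b : X) (t : R) :
  A a -> A b -> 0 <= t <= 1 -> convex_hull A ((1 - t) *: a + t *: b).
Proof.
move=> Aa Ab /andP[t0 t1] B [cB AB].
have := cB b a (Itv01 t0 t1); rewrite !inE => /(_ (AB _ Ab) (AB _ Aa)).
by rewrite addrC.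
Qed.

Lemma dotvDl (a b v : X) : dotv (a + b) v = dotv a v + dotv b v.
Proof. by rewrite /dotv -big_split; apply: eq_bigr => i _; rewrite mxE mulrDl. Qed.

Lemma dotvZl k (a v : X) : dotv (k *: a) v = k * dotv a v.
Proof. by rewrite /dotv mulr_sumr; apply: eq_bigr => i _; rewrite mxE mulrA. Qed.

Lemma dotvC (a b : X) : dotv a b = dotv b a.
Proof. by apply: eq_bigr => i _; rewrite mulrC. Qed.

Lemma dotvBl (a b v : X) : dotv (a - b) v = dotv a v - dotv b v.
Proof. by rewrite dotvDl -scaleN1r dotvZl mulN1r. Qed.

Lemma subdifferential_convex (u : X -> R) (x0 p0 p1 : X) (t : R) : 0 <= t <= 1 ->
  subdifferential u x0 p0 -> subdifferential u x0 p1 ->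
  subdifferential u x0 (p0 + t *: (p1 - p0)).
Proof.
move=> /andP[t0 t1] s0 s1 e e0; near=> x.
have h0 : u x0 + dotv p0 (x - x0) - e * `|x - x0| <= u x by near: x; exact: s0.
have h1 : u x0 + dotv p1 (x - x0) - e * `|x - x0| <= u x by near: x; exact: s1.
rewrite dotvDl dotvZl dotvBl.
move: h0 h1; move: (dotv p0 _) (dotv p1 _) (e * _) (u x0) (u x) => a b k U W h0 h1.
have : 0 <= (1 - t) * (W - (U + a - k)) + t * (W - (U + b - k)).
  by rewrite addr_ge0// mulr_ge0// subr_ge0.
by lra.
Unshelve. all: by end_near. Qed.

Lemma subdifferential_closed (u : X -> R) (x0 : X) : closed (subdifferential u x0).
Proof.
move=> p clp e e0.
have d0 : 0 < e / 2%:R / (n%:R + 1) by rewrite !divr_gt0// ltr_wpDl.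
have near_p : \forall q \near (p : X), `|p - q| < e / 2%:R / (n%:R + 1).
  by apply/nbhs_normP; exists (e / 2%:R / (n%:R + 1)).
have [q [sq /= hpq]] := clp _ near_p.
have e20 : 0 < e / 2%:R by rewrite divr_gt0.
have := sq _ e20; apply: filterS => x; apply: le_trans.
rewrite -lerBlDr opprK.
have : dotv p (x - x0) - dotv q (x - x0) <= e / 2%:R * `|x - x0|.
  rewrite -dotvBl (le_trans (ler_norm _))// (le_trans (dotv_le _ _))//.
  rewrite ler_wpM2r//.
  rewrite ltr_pdivlMr ?ltr_wpDl// in hpq.
  by apply: le_trans (ltW hpq); rewrite mulrDr mulr1 mulrC lerDl.
have -> : e * `|x - x0| = e / 2%:R * `|x - x0| + e / 2%:R * `|x - x0|.
  by rewrite -mulrDl -splitr.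
by lra.
Qed.

Variables (Gamma : set V) (g : V -> R) (Omega : set X) (u : X -> R) (x0 : X).
Hypotheses (hg : generating_function Gamma g) (hA1 : A1 Gamma g)
  (hA2 : A2 Gamma g) (hA1star : A1star Gamma g)
  (hA : A_twice_differentiable Gamma g) (hA3w : A3w Gamma g).
Hypotheses (hx0 : Omega x0)
  (hsubdiff : forall p, subdifferential u x0 p -> Uset Gamma g (x0, u x0, p))
  (hsub : forall y, Sigma0 Gamma g u x0 y ->
     sub_g_convex Gamma g Omega y (g_star Gamma g x0 y (u x0))).

Let oG : open Gamma. Proof. by case: hg => -[]. Qed.
Let gC2 : C2_on Gamma g. Proof. by case: hg. Qed.

Let Y p := Ymap Gamma g x0 (u x0) p.
Let Z p := Zmap Gamma g x0 (u x0) p.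

Lemma subdiff_Gamma p : subdifferential u x0 p ->
  [/\ Gamma (x0, Y p, Z p), g (x0, Y p, Z p) = u x0, gx g (x0, Y p, Z p) = p,
     g_star Gamma g x0 (Y p) (u x0) = Z p &
     sub_g_convex Gamma g Omega (Y p) (Z p)].
Proof.
move=> sp; have [] := Phi_Psi hA1 (hsubdiff sp).
rewrite /Psi/= -/(Y p) -/(Z p) => G0 [eg egx].
have gs : g_star Gamma g x0 (Y p) (u x0) = Z p by rewrite -eg; exact: g_star_eq.
split=> //; rewrite -gs; apply: hsub.
by exists p.
Qed.

(** The set [S] of the overview. *)
Definition supporting p := subdifferential u x0 p /\
  forall x, Omega x -> g (x, Y p, Z p) <= u x.

Lemma Psi_slice_continuous p : subdifferential u x0 p ->
  {for p, continuous (fun p => (Y p, Z p) : X * R)}.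
Proof.
move=> sp.
have c1 : {for p, continuous (fun p : X => (x0, u x0, p) : VU)}.
  apply: differentiable_continuous; apply: differentiable_pair.
    exact: differentiable_cst.
  by have di : differentiable (id : X -> X) p by exact: ex_diff.
have c2 := @continuous_comp _ _ _ (fun p : X => (x0, u x0, p) : VU) (Psi Gamma g) p c1
  (Psi_continuous hg hA1 hA2 (hsubdiff sp)).
have c3 (w : V) : {for w, continuous (fun w : V => (w.1.2, w.2) : X * R)}.
  apply: differentiable_continuous; apply: differentiable_pair.
    apply: (@differentiable_comp _ _ _ _ (fst : V -> X * X) (snd : X * X -> X)).
      exact: differentiable_fst.
    exact: differentiable_snd.
  exact: differentiable_snd.
exact: (@continuous_comp _ _ _ _ (fun w : V => (w.1.2, w.2) : X * R) p c2 (c3 _)).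
Qed.

Lemma g_slice_continuous x (q : X * R) : Gamma (x, q.1, q.2) ->
  {for q, continuous (fun q : X * R => g (x, q.1, q.2))}.
Proof.
move=> G; have c1 : {for q, continuous (fun q : X * R => (x, q.1, q.2) : V)}.
  apply: differentiable_continuous; apply: differentiable_pair; last exact: differentiable_snd.
  apply: differentiable_pair; last exact: differentiable_fst.
  exact: differentiable_cst.
apply: (@continuous_comp _ _ _ (fun q : X * R => (x, q.1, q.2) : V) g q c1).
exact/differentiable_continuous/(C2_differentiable gC2).
Qed.

Lemma supporting_segment p0 p1 (t : R) : supporting p0 -> supporting p1 ->
  0 <= t <= 1 -> supporting (p0 + t *: (p1 - p0)).
Proof.
move=> [s0 sup0] [s1 sup1] t01.
pose pt (s : R) := p0 + s *: (p1 - p0).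
have spt s : 0 <= s <= 1 -> subdifferential u x0 (pt s).
  by move=> s01; exact: subdifferential_convex.
split; first exact: spt.
move=> x Ox; rewrite -/(pt t).
have [<-|x0x] := eqVneq x0 x; first by have [_ ->] := subdiff_Gamma (spt _ t01).
pose q s : X * R := (Y (pt s), Z (pt s)).
pose h s := g (x, (q s).1, (q s).2).
have Gx s : 0 <= s <= 1 -> Gamma (x, (q s).1, (q s).2).
  by move=> s01; have [_ _ _ _ [IO _]] := subdiff_Gamma (spt _ s01); exact: IO.
have cq s : 0 <= s <= 1 -> {for s, continuous q}.
  move=> s01; apply: (@continuous_comp _ _ _ pt (fun p => (Y p, Z p) : X * R) s).
    apply/differentiable_continuous/derivable1_diffP.
    by have [] := is_derive_line p0 (p1 - p0) s.
  exact/Psi_slice_continuous/spt.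
have ch s : 0 <= s <= 1 -> {for s, continuous h}.
  move=> s01; apply: (@continuous_comp _ _ _ q (fun q : X * R => g (x, q.1, q.2)) s).
    exact: cq.
  exact/g_slice_continuous/Gx.
rewrite -[leLHS]/(h t) leNgt; apply/negP => uht.
have [c] : exists2 c, c \in `[0, 1]%R & forall s, s \in `[0, 1]%R -> h s <= h c.
  apply: EVT_max => //; apply: continuous_in_subspaceT => s.
  by rewrite inE/= in_itv/= => /ch.
rewrite in_itv/= => c01 maxc.
have {}maxc (s : R) : 0 <= s <= 1 -> h s <= h c by move=> s01; apply: maxc; rewrite in_itv.
pose A := [set s : R | 0 <= s <= 1 /\ h c <= h s].
have cA : compact A.
  apply: (subclosed_compact _ (@segment_compact R 0 1)); last first.
    by move=> s [s01 _]; rewrite /= in_itv.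
  move=> s cls.
  have s01 : 0 <= s <= 1.
    have : closed `[(0:R), 1]%classic by exact: itv_closed.
    move=> /(_ s); rewrite /= in_itv/=; apply.
    by move=> B /cls[r [[r01 _] Br]]; exists r; split=> //; rewrite /= in_itv.
  split=> //; rewrite leNgt; apply/negP => hsc.
  have : \forall r \near s, h r < h c by exact: (cvgr_lt _ (ch s s01)).
  by move=> /cls[r [[_ +] /=]]; rewrite leNgt => /negP.
have [c1] : exists2 c1, c1 \in A & forall s, s \in A -> c1 <= s.
  apply: compact_EVT_min => //; first by exists c; split.
  by apply: continuous_in_subspaceT => s _; exact: cvg_id.
rewrite inE => -[c1_01 hc1] minc1.
have hc1E : h c1 = h c by apply/eqP; rewrite eq_le hc1 maxc.
(* The maximum exceeds [u x], whereas [h] is at most [u x] at both ends. Hence [c1] is interior and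
   can be moved in either direction. *)
have uhc : u x < h c by apply: lt_le_trans uht _; exact: maxc.
have [c10 c11] := andP c1_01.
have c1_gt0 : 0 < c1.
  rewrite lt_neqAle c10 andbT; apply/eqP => e0; move: uhc; rewrite -hc1E -e0 ltNge.
  by rewrite /h /q /pt scale0r addr0 sup0.
have c1_lt1 : c1 < 1.
  rewrite lt_neqAle c11 andbT; apply/eqP => e1; move: uhc; rewrite -hc1E e1 ltNge.
  by rewrite /h /q /pt scale1r addrC subrK sup1.
have [G0 eg0 egx0 _ [IO hull]] := subdiff_Gamma (spt _ c1_01).
have seg (s : R) : 0 <= s <= 1 -> exists2 x', Gamma (x', Y (pt c1), Z (pt c1)) &
    Qmap g (Y (pt c1)) (Z (pt c1)) x' =
    (1 - s) *: Qmap g (Y (pt c1)) (Z (pt c1)) x0 + s *: Qmap g (Y (pt c1)) (Z (pt c1)) x.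
  move=> s01.
  have : convex_hull (Qmap g (Y (pt c1)) (Z (pt c1)) @` Omega)
     ((1 - s) *: Qmap g (Y (pt c1)) (Z (pt c1)) x0 + s *: Qmap g (Y (pt c1)) (Z (pt c1)) x).
    by apply: convex_hull_segment.
  by move=> /hull[x' Gx' <-]; exists x'.
have [xi near_q] := local_comparison hg hA1 hA2 hA1star hA hA3w G0 (Gx _ c1_01) x0x seg.
pose a := dotv (p1 - p0) xi.
pose Pq (r : X * R) :=
  g (x0, r.1, r.2) = g (x0, Y (pt c1), Z (pt c1)) ->
  0 <= dotv (gx g (x0, r.1, r.2) - gx g (x0, Y (pt c1), Z (pt c1))) xi ->
  h c1 <= g (x, r.1, r.2) /\
  (0 < dotv (gx g (x0, r.1, r.2) - gx g (x0, Y (pt c1), Z (pt c1))) xi ->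
   h c1 < g (x, r.1, r.2)).
have near_Pq : \forall s \near (c1 : R), Pq (q s) by exact: (cq _ c1_01 Pq near_q).
have near_s : \forall s \near (c1 : R), 0 <= s <= 1 -> 0 <= (s - c1) * a ->
    h c1 <= h s /\ (0 < (s - c1) * a -> h c1 < h s).
  near=> s => s01; have hs : Pq (q s) by near: s.
  have [_ egs egxs _ _] := subdiff_Gamma (spt _ s01).
  move: hs; rewrite /Pq /q/= egs eg0 egxs egx0 => /(_ erefl).
  have -> : pt s - pt c1 = (s - c1) *: (p1 - p0).
    by rewrite /pt opprD addrACA subrr add0r -scalerBl.
  by rewrite dotvZl.
move: near_s => /nbhs_normP[r /= r0 Hr].
(* For [a = 0] only the weak inequality is available, on either side of [c1]. It does not contradict
   maximality, but to the left it contradicts the choice of [c1] as the least maximiser. *)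
have [a0|a0] := leP a 0.
  pose s := c1 - Num.min (r / 2%:R) (c1 / 2%:R).
  have d0 : 0 < Num.min (r / 2%:R) (c1 / 2%:R) by rewrite lt_min !divr_gt0.
  have dr : Num.min (r / 2%:R) (c1 / 2%:R) <= r / 2%:R by rewrite ge_min lexx.
  have dc : Num.min (r / 2%:R) (c1 / 2%:R) <= c1 / 2%:R by rewrite ge_min lexx orbT.
  have s01 : 0 <= s <= 1 by apply/andP; rewrite /s; split; lra.
  have hs : `|c1 - s| < r by rewrite /s opprB addrC subrK gtr0_norm//; lra.
  have sA : s \in A.
    rewrite inE; split=> //; have [|+ _] := Hr s hs s01; last by rewrite hc1E.
    by rewrite mulr_le0// /s; lra.
  by have := minc1 _ sA; rewrite /s; lra.
pose s := c1 + Num.min (r / 2%:R) ((1 - c1) / 2%:R).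
have d0 : 0 < Num.min (r / 2%:R) ((1 - c1) / 2%:R) by rewrite lt_min !divr_gt0// subr_gt0.
have dr : Num.min (r / 2%:R) ((1 - c1) / 2%:R) <= r / 2%:R by rewrite ge_min lexx.
have dc : Num.min (r / 2%:R) ((1 - c1) / 2%:R) <= (1 - c1) / 2%:R by rewrite ge_min lexx orbT.
have s01 : 0 <= s <= 1 by apply/andP; rewrite /s; split; lra.
have hs : `|c1 - s| < r by rewrite /s opprD addrA subrr sub0r normrN gtr0_norm//; lra.
have sa : 0 < (s - c1) * a by rewrite mulr_gt0// /s; lra.
have [|_ /(_ sa)] := Hr s hs s01; first exact: ltW.
by rewrite hc1E ltNge maxc.
Unshelve. all: by end_near. Qed.

End SupportingGradients.

(** * Semiconvexity and limits of gradients of supports *)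

Section Semiconvexity.
Context {R : realType} {n : nat}.
Notation X := 'rV[R]_n.

Lemma derive_le0_right (f : R -> R) (l : R) : is_derive (0 : R) (1 : R) f l -> f 0 = 0 ->
  (forall s : R, 0 < s < 1 -> f s <= 0) -> l <= 0.
Proof.
move=> [/cvg_ex[/= l' cl] el] f0 fs.
have {el} el : l' = l by rewrite -el; apply/esym/cvg_lim.
rewrite {}el in cl; rewrite leNgt; apply/negP => l0.
have near_right : \forall h \near (0 : R)^'+, 0 < h^-1 * f h.
  move/cvg_dnbhs_at_right/cvgrPdist_lt : cl => /(_ l l0); apply: filterS => h.
  rewrite /= addr0 [h *: 1]mulr1 f0 subr0 -[_ *: _]/(_ * _) ltr_norml.
  by move=> /andP[_ +]; move: (_ * _) => a; lra.
near (0 : R)^'+ => h.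
have h0 : 0 < h by near: h; exact: nbhs_right_gt.
have h1 : h < 1 by near: h; exact: nbhs_right_lt.
have : 0 < h^-1 * f h by near: h.
by rewrite pmulr_rgt0 ?invr_gt0// ltNge fs ?h0.
Unshelve. all: by end_near. Qed.

(** Turns convexity of [u + C |.|^2] into a chord inequality for [u] with error
    [C s (1 - s) |b - a|^2]. *)
Lemma dotv_sqr_segment (a b : X) (s : R) :
  dotv (a + s *: (b - a)) (a + s *: (b - a)) =
  (1 - s) * dotv a a + s * dotv b b - s * (1 - s) * dotv (b - a) (b - a).
Proof.
rewrite /dotv !mulr_sumr -big_split -sumrB; apply: eq_bigr => i _.
by rewrite !mxE /=; ring.
Qed.

(** The minorant [f] touches [u] at [x], so the chord inequality for [u] bounds [f] on the segment
    from [x] to [w], and differentiating at [x] gives the claim. The ball and [C] do not depend on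
    [x], which lets the inequality pass to the limit when [x] tends to [x0]. *)
Lemma semiconvex_subgradient (u f : X -> R) (x0 : X) (r C : R) (x w p : X) :
  convex_function (ball x0 r) (fun w => u w + C * dotv w w) ->
  (forall y, ball x0 r y -> f y <= u y) -> f x = u x ->
  ball x0 r x -> ball x0 r w ->
  differentiable f x -> (forall v, 'D_v f x = dotv p v) ->
  u x + dotv p (w - x) - C * dotv (w - x) (w - x) <= u w.
Proof.
move=> cvx fu fx bx bw df dfE.
pose D := dotv (w - x) (w - x).
pose b (s : R) := u w - u x + C * (1 - s) * D.
(* [phi <= 0] on []0, 1[] is the chord inequality with [u] replaced by [f] at the moving point; the
   slope of [phi] at [0] is [dotv p (w - x) - b 0]. *)
pose phi (s : R) := (f (x + s *: (w - x)) - f x) - s * b s.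
have cb : {for (0 : R), continuous b}.
  have -> : b = (fun s => (u w - u x + C * D) + s *: (- (C * D))).
    by apply/funext => s; rewrite /b -[_ *: _]/(_ * _); ring.
  apply/differentiable_continuous/derivable1_diffP.
  by have [] := is_derive_line (u w - u x + C * D) (- (C * D)) 0.
have dfl : is_derive (0 : R) (1 : R) (fun s : R => f (x + s *: (w - x))) (dotv p (w - x)).
  have x00 : x + (0 : R) *: (w - x) = x by rewrite scale0r addr0.
  have := is_derive_curve (is_derive_line x (w - x) 0) (_ : differentiable f _).
  by rewrite x00 dfE; apply.
have dphi := is_deriveB (is_deriveB dfl (is_derive_cst (f x) (0 : R) (1 : R)))
  (is_derive_vanishing_mul (is_derive_id (0 : R) (1 : R)) erefl cb).
have := derive_le0_right dphi; rewrite !subr0 mul1r.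
have -> : b 0 = u w - u x + C * D by rewrite /b subr0 mulr1.
rewrite -/D => H; have {}H : dotv p (w - x) - (u w - u x + C * D) <= 0.
  apply: H; first by rewrite -[LHS]/(phi 0) /phi scale0r addr0 subrr mul0r subr0.
  move=> s /andP[s0 s1]; rewrite -[leLHS]/(phi s) /phi.
  have ws : s *: w + (1 - s) *: x = x + s *: (w - x).
    by apply/rowP => i; rewrite !mxE; ring.
  have bws : ball x0 r (x + s *: (w - x)).
    rewrite -ball_normE/=; apply: ball_segment; rewrite ?ltW// ?(addrC x) ?subrK.
      by move: bx; rewrite -ball_normE.
    by move: bw; rewrite -ball_normE.
  have := cvx (Itv01 (ltW s0) (ltW s1)) w x; rewrite !inE => /(_ bw bx).
  move=> h; have {}h : u (s *: w + (1 - s) *: x) +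
      C * dotv (s *: w + (1 - s) *: x) (s *: w + (1 - s) *: x) <=
      s * (u w + C * dotv w w) + (1 - s) * (u x + C * dotv x x) by exact: h.
  rewrite ws dotv_sqr_segment -/D in h.
  have hf := fu _ bws; rewrite /b fx.
  move: h hf; move: (f _) (u (x + _)) (dotv x x) (dotv w w) (u w) (u x) => F U1 X2 W2 Uw Ux h hf.
  nra.
by move: H; rewrite /D; lra.
Qed.

Lemma dotv_cvg (T : Type) (F : set_system T) (FF : Filter F) (a b : T -> X) (a0 b0 : X) :
  a x @[x --> F] --> a0 -> b x @[x --> F] --> b0 ->
  dotv (a x) (b x) @[x --> F] --> dotv a0 b0.
Proof.
move=> ca cb; apply: (@cvg_sum_ord _ _ F _ _ (fun i x => a x 0 i * b x 0 i)
  (fun i => a0 0 i * b0 0 i)) => i.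
apply: cvgM.
  exact: (cvg_comp _ _ ca (@coord_continuous _ 1 n 0 i a0)).
exact: (cvg_comp _ _ cb (@coord_continuous _ 1 n 0 i b0)).
Qed.

End Semiconvexity.

Section SupportDirection.
Context {R : realType} {n : nat}.
Notation X := 'rV[R]_n.
Notation V := (X * X * R)%type.
Notation VU := (X * R * X)%type.
Variables (Gamma : set V) (g : V -> R) (Omega : set X) (u : X -> R) (x0 : X).
Hypotheses (hg : generating_function Gamma g) (hA1 : A1 Gamma g)
  (hA2 : A2 Gamma g) (hA1star : A1star Gamma g)
  (hA : A_twice_differentiable Gamma g) (hA3w : A3w Gamma g).
Hypotheses (oOmega : open Omega) (hu_cont : {within Omega, continuous u})
  (hu_convex : g_convex Gamma g Omega u)
  (hu_semiconvex : locally_semiconvex Omega u).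
Hypotheses (hx0 : Omega x0)
  (hsubdiff : forall p, subdifferential u x0 p -> Uset Gamma g (x0, u x0, p))
  (hsub : forall y, Sigma0 Gamma g u x0 y ->
     sub_g_convex Gamma g Omega y (g_star Gamma g x0 y (u x0))).

Let oG : open Gamma. Proof. by case: hg => -[]. Qed.
Let gC2 : C2_on Gamma g. Proof. by case: hg. Qed.
Notation Y := (Ymap Gamma g x0 (u x0)).
Notation Z := (Zmap Gamma g x0 (u x0)).
Notation supporting := (supporting Gamma g Omega u x0).

Lemma supporting_closed : closed [set p | supporting p].
Proof.
move=> p clp; have sp : subdifferential u x0 p.
  by apply: subdifferential_closed => B /clp[q [[sq _] Bq]]; exists q.
split=> // x Ox; rewrite leNgt; apply/negP => ux.
have [_ _ _ _ [IO _]] := subdiff_Gamma hg hA1 hsubdiff hsub sp.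
have := @continuous_comp _ _ _ (fun p => (Y p, Z p) : X * R) (fun q : X * R => g (x, q.1, q.2)) p
  (Psi_slice_continuous hg hA1 hA2 hsubdiff sp) (g_slice_continuous hg (IO x Ox)).
move=> cgx.
have near_p : \forall q \near (p : X), u x < g (x, Y q, Z q).
  exact: (cvgr_gt _ cgx).
have [q [[_ sup] /= uq]] := clp _ near_p.
by have := sup x Ox; rewrite leNgt uq.
Qed.

Lemma yz_projection_continuous (w : V) :
  {for w, continuous (fun w : V => (w.1.2, w.2) : X * R)}.
Proof.
apply: differentiable_continuous; apply: differentiable_pair.
  apply: (@differentiable_comp _ _ _ _ (fst : V -> X * X) (snd : X * X -> X)).
    exact: differentiable_fst.
  exact: differentiable_snd.
exact: differentiable_snd.
Qed.

Lemma u_continuous_at x : Omega x -> {for x, continuous u}.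
Proof.
by move=> Ox; move: hu_cont; rewrite continuous_open_subspace// => /(_ x); apply; rewrite inE.
Qed.

(** Let [P] be the gradient of a support at [x0 + t e]. Evaluated at [x0], its semiconvex inequality
    reads [u(x0) >= u(x0 + t e) - t P . e - C t^2 |e|^2], while [p] gives
    [u(x0 + t e) >= u(x0) + t p . e - o(t)]. Adding and dividing by [t] yields
    [P . e >= p . e - o(1)], which a cluster point of the [P] inherits. *)
Lemma support_direction p e : subdifferential u x0 p ->
  exists2 pb, supporting pb & dotv p e <= dotv pb e.
Proof.
move=> sp; have [r [C [r0 ballO cvx]]] := hu_semiconvex hx0.
have /choice[yz Hyz] : forall x, exists yz : X * R, Omega x ->
    [/\ I_Omega Gamma Omega yz.1 yz.2, u x = g (x, yz.1, yz.2)
      & forall x', Omega x' -> g (x', yz.1, yz.2) <= u x'].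
  move=> x; have [Ox|nOx] := pselect (Omega x); last by exists (0, 0).
  by have [y [z H]] := hu_convex Ox; exists (y, z).
pose P (x : X) : X := gx g (x, (yz x).1, (yz x).2).
have Gx x : Omega x -> Gamma (x, (yz x).1, (yz x).2).
  by move=> Ox; have [IO _ _] := Hyz x Ox; exact: IO.
have sub x w : ball x0 r x -> ball x0 r w ->
    u x + dotv (P x) (w - x) - C * dotv (w - x) (w - x) <= u w.
  move=> bx bw; have Ox := ballO _ bx; have [IO ux sup] := Hyz x Ox.
  apply: (@semiconvex_subgradient R n u (fun x' => g (x', (yz x).1, (yz x).2)) x0 r C) => //.
  - by move=> x' /ballO; exact: sup.
  - apply: differentiable_slice; apply: (C2_differentiable gC2); exact: Gx.
  - move=> v; rewrite derive_xslice -ddir1_at.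
    by rewrite (ddir1_xdir hg)//; exact: Gx.
pose xt (t : R) := x0 + t *: e.
have cxt : xt t @[t --> (0 : R)^'+] --> x0.
  have c0 : {for (0 : R), continuous xt}.
    apply/differentiable_continuous/derivable1_diffP.
    by have [] := is_derive_line x0 e 0.
  have xt0 : xt 0 = x0 by rewrite /xt scale0r addr0.
  by have := cvg_at_right_filter c0; rewrite xt0.
have cu : u (xt t) @[t --> (0 : R)^'+] --> u x0.
  exact: (cvg_comp _ _ cxt (u_continuous_at hx0)).
have nball : \forall t \near (0 : R)^'+, ball x0 r (xt t).
  exact: (cxt _ (nbhsx_ballx x0 r r0)).
have [B B0 HB] : exists2 B : R, 0 < B & \forall t \near (0 : R)^'+, `|P (xt t)| < B.
  have /cvgrPdist_lt/(_ 1 ltr01)/nbhs_normP[r1 /= r10 Hr1] := u_continuous_at hx0.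
  (* Each coordinate of [P (xt t)] is bounded by testing the semiconvex inequality at distance [d]
     from [xt t] in both directions of the axis. The factor [3] keeps these test points in the balls
     around [x0] where the inequality holds and [u] varies by less than [1]. *)
  pose d := Num.min r r1 / 3%:R.
  have d0 : 0 < d by rewrite divr_gt0// lt_min r0.
  have dr : 3%:R * d <= r by rewrite /d mulrC divfK// ge_min lexx.
  have dr1 : 3%:R * d <= r1 by rewrite /d mulrC divfK// ge_min lexx orbT.
  exists ((2%:R + `|C| * d ^+ 2) / d + 1).
    by rewrite ltr_wpDl// divr_ge0 ?(ltW d0)// addr_ge0// mulr_ge0// sqr_ge0.
  have nd : \forall t \near (0 : R)^'+, `|x0 - xt t| < d.
    by move/cvgrPdist_lt : cxt; apply.
  near=> t.
  have td : `|x0 - xt t| < d by near: t.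
  have bt : ball x0 r (xt t) by near: t.
  have bnd (s : R) i : `|s| = d -> s * P (xt t) 0 i <= 2%:R + `|C| * d ^+ 2.
    move=> sd; pose w := xt t + s *: basis_vec i.
    have wx0 : `|x0 - w| < 3%:R * d.
      rewrite /w opprD addrA (le_lt_trans (ler_normB _ _))// normrZ sd.
      have : `|basis_vec i : X| < 2%:R.
        apply: mx_norm_lt => // k l; rewrite mxE normr_nat ltr_nat.
        by case: (_ && _).
      by move: td d0; nra.
    have bw : ball x0 r w by rewrite -ball_normE/=; exact: lt_le_trans dr.
    have := sub _ _ bt bw.
    have -> : w - xt t = s *: basis_vec i by rewrite /w addrC addKr.
    have dotvE (a : X) : dotv a (s *: basis_vec i) = s * a 0 i.
      rewrite dotvC dotvZl /dotv (bigD1 i)//= big1 ?addr0 => [|k ki].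
        by rewrite mxE !eqxx mul1r.
      by rewrite mxE eqxx (negbTE ki) mul0r.
    have bE : (s *: basis_vec i : X) 0 i = s by rewrite !mxE !eqxx mulr1.
    rewrite !dotvE bE => h.
    have u1 : `|u x0 - u w| < 1 by apply: Hr1 => /=; exact: lt_le_trans dr1.
    have u2 : `|u x0 - u (xt t)| < 1.
      by apply: Hr1 => /=; apply: lt_trans td _; move: d0 dr1; lra.
    have Cs : C * (s * s) <= `|C| * d ^+ 2.
      by rewrite -sd -normrX -normrM expr2 ler_norm.
    move: u1 u2; rewrite !ltr_norml => /andP[u1 u1'] /andP[u2 u2'].
    move: h Cs u1 u1' u2 u2'.
    move: (u w) (u x0) (u (xt t)) (s * (P (xt t) 0 i)) (C * (s * s)) (`|C| * d ^+ 2) =>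
      Uw U0 Ut a b k; lra.
  apply: mx_norm_lt => [|k i].
    by rewrite ltr_wpDl// divr_ge0 ?(ltW d0)// addr_ge0// mulr_ge0// sqr_ge0.
  rewrite (ord1 k) ltr_pwDr// ler_pdivlMr// -{1}(gtr0_norm d0) -normrM ler_norml.
  have := bnd d i (gtr0_norm d0); have := bnd (- d) i.
  by rewrite normrN (gtr0_norm d0) => /(_ erefl); rewrite mulNr mulrC => h1 h2; apply/andP; split; lra.
have cK : compact (closed_ball (0 : X) B) by exact: closed_ball_rV_compact.
have [pb [_ clpb]] : closed_ball (0 : X) B `&` cluster (P (xt t) @[t --> (0 : R)^'+]) !=set0.
  apply: cK; apply: filterS HB => t Pt; rewrite closed_ballE// /closed_ball_/= sub0r normrN.
  exact: ltW.
(* Replaces the extraction of a subsequence: any property of small [t > 0] and any neighbourhood of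
   [pb] are met by a common [t]. *)
have clus (A : set R) (N : set X) : (\forall t \near (0 : R)^'+, A t) ->
    nbhs pb N -> exists t, A t /\ N (P (xt t)).
  move=> nA nN; have [|q [[t At <-] Nq]] := clpb [set P (xt t) | t in A] N _ nN.
    by apply: filterS nA => t At; exists t.
  by exists t.
have subpb w : ball x0 r w ->
    u x0 + dotv pb (w - x0) - C * dotv (w - x0) (w - x0) <= u w.
  move=> bw; rewrite leNgt; apply/negP => lt.
  pose F (tp : R * X) := u (xt tp.1) + dotv tp.2 (w - xt tp.1) -
    C * dotv (w - xt tp.1) (w - xt tp.1).
  have c1 : xt tp.1 @[tp --> filter_prod (0 : R)^'+ (nbhs pb)] --> x0.
    exact: (cvg_comp _ _ cvg_fst cxt).
  have c2 : u (xt tp.1) @[tp --> filter_prod (0 : R)^'+ (nbhs pb)] --> u x0.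
    exact: (cvg_comp _ _ c1 (u_continuous_at hx0)).
  have c3 : (w - xt tp.1) @[tp --> filter_prod (0 : R)^'+ (nbhs pb)] --> w - x0.
    by apply: cvgB => //; exact: cvg_cst.
  have cF : F tp @[tp --> filter_prod (0 : R)^'+ (nbhs pb)] -->
      u x0 + dotv pb (w - x0) - C * dotv (w - x0) (w - x0).
    apply: cvgB.
      by apply: cvgD => //; apply: dotv_cvg => //; exact: cvg_snd.
    by apply: cvgMr; exact: dotv_cvg.
  have [[A N] [/= nA nN] AN] : \forall tp \near filter_prod (0 : R)^'+ (nbhs pb), u w < F tp.
    exact: (cvgr_gt _ cF).
  have [t [[At bt] Nt]] := clus _ _ (filterI nA nball) nN.
  have /= := AN (t, P (xt t)) (conj At Nt); rewrite ltNge => /negP; apply.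
  exact: sub.
have spb : subdifferential u x0 pb.
  move=> e1 e10; near=> w.
  have bw : ball x0 r w by near: w; exact: nbhsx_ballx.
  apply: le_trans (subpb w bw); rewrite lerD2l lerN2.
  rewrite (le_trans (ler_norm _))// normrM (le_trans (ler_wpM2l _ (dotv_le _ _)))//.
  have K0 : 0 < `|C| * n%:R + 1 by rewrite ltr_wpDl// mulr_ge0.
  have : `|w - x0| < e1 / (`|C| * n%:R + 1).
    by near: w; apply: cvgr_distC_lt; [exact: cvg_id|exact: divr_gt0].
  rewrite ltr_pdivlMr// => wx.
  rewrite mulrA ler_wpM2r// mulrA (le_trans _ (ltW wx))// mulrC ler_wpM2l//.
  by rewrite lerDl.
exists pb.
  split=> // x Ox; rewrite leNgt; apply/negP => ux.
  have [G0 eg0 egx0 _ [IO _]] := subdiff_Gamma hg hA1 hsubdiff hsub spb.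
  pose w0 : V := (x0, Y pb, Z pb).
  have near_w0 : \forall w \near w0, u x < g (x, w.1.2, w.2).
    have := @continuous_comp _ _ _ (fun w : V => (w.1.2, w.2) : X * R)
      (fun q : X * R => g (x, q.1, q.2)) w0 (@yz_projection_continuous w0)
      (g_slice_continuous hg (IO x Ox)).
    by move=> cgx; exact: (cvgr_gt _ cgx).
  (* For suitable small [t], openness of [Phi] gives a preimage of [(xt t, u (xt t), P (xt t))]
     close to [w0], at which the function still exceeds [u x]. By injectivity this preimage carries
     the parameters of the chosen support at [xt t], which lies below [u]. *)
  have [e1 e10 He1] := Phi_open hg hA1 hA2 G0 near_w0.
  have [[A N] [/= nA nN] AN] : \forall tp \near filter_prod (0 : R)^'+ (nbhs pb),
      `|((xt tp.1, u (xt tp.1), tp.2) : VU) - Phi g w0| < e1.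
    have n1 : \forall t \near (0 : R)^'+, `|xt t - x0| < e1.
      by move/cvgrPdist_lt : cxt => /(_ e1 e10); apply: filterS => t; rewrite distrC.
    have n2 : \forall t \near (0 : R)^'+, `|u (xt t) - u x0| < e1.
      by move/cvgrPdist_lt : cu => /(_ e1 e10); apply: filterS => t; rewrite distrC.
    have n3 : \forall q \near (pb : X), `|q - pb| < e1.
      by apply/nbhs_normP; exists e1 => //= q pbq; rewrite distrC.
    exists ([set t | `|xt t - x0| < e1 /\ `|u (xt t) - u x0| < e1], [set q | `|q - pb| < e1]).
      by split => //=; exact: filterI.
    move=> [t q] [/= [h1 h2] h3].
    by rewrite /Phi /w0 eg0 egx0 prod_normE gt_max prod_normE gt_max /= h1 h2 h3.
  have [t [[At bt] Nt]] := clus _ _ (filterI nA nball) nN.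
  have /= := AN (t, P (xt t)) (conj At Nt) => /He1[w' [/= uw' Gw' ew']].
  have Ot := ballO _ bt; have [_ ut sup] := Hyz _ Ot.
  have w'E : w' = (xt t, (yz (xt t)).1, (yz (xt t)).2).
    by apply: (Phi_inj hA1 Gw' (Gx _ Ot)); rewrite ew' /Phi/= -ut.
  by move: uw'; rewrite w'E/= ltNge sup.
rewrite leNgt; apply/negP => lt.
(* Three errors are each made at most [eta / 4]: the [o(t)] term of [p], the quadratic term of the
   semiconvex inequality, and the excess of [P (xt t) . e] over [pb . e]. Their sum would have to be
   at least [eta]. *)
pose eta := dotv p e - dotv pb e; have eta0 : 0 < eta by rewrite subr_gt0.
pose D := dotv e e.
have D0 : 0 <= D by apply: sumr_ge0 => i _; rewrite -expr2 sqr_ge0.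
have CD0 : 0 < 4%:R * (`|C| * D + 1) by rewrite mulr_gt0// ltr_wpDl// mulr_ge0.
have e40 : 0 < 4%:R * (`|e| + 1) by rewrite mulr_gt0// ltr_wpDl.
have eps0 : 0 < eta / (4%:R * (`|e| + 1)) by rewrite divr_gt0.
have nsub : \forall t \near (0 : R)^'+, u x0 + dotv p (xt t - x0) -
    eta / (4%:R * (`|e| + 1)) * `|xt t - x0| <= u (xt t).
  exact: (cxt _ (sp _ eps0)).
have nt : \forall t \near (0 : R)^'+, t < eta / (4%:R * (`|C| * D + 1)).
  by apply: nbhs_right_lt; exact: divr_gt0.
have nt0 : \forall t \near (0 : R)^'+, 0 < t by exact: nbhs_right_gt.
have nq : \forall q \near pb, dotv q e < dotv pb e + eta / 4%:R.
  have cq : dotv q e @[q --> pb] --> dotv pb e.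
    exact: (@dotv_cvg R n X (nbhs pb) _ id (cst e) pb e (@cvg_id _ _) (@cvg_cst _ _ _ _ _)).
  by apply: (cvgr_lt _ cq); rewrite ltrDl divr_gt0.
have [t [[[t0 tlt] [tsub bt]] tq]] := clus _ _ (filterI (filterI nt0 nt) (filterI nsub nball)) nq.
have := sub _ _ bt (ballxx _ r0).
have xtE : xt t - x0 = t *: e by rewrite /xt addrC addKr.
have xtE' : x0 - xt t = (- t) *: e by rewrite -opprB xtE scaleNr.
rewrite xtE' -/(dotv _ _) (dotvC (P _)) !dotvZl (dotvC e) (dotvC e (- t *: e)) dotvZl -/D => hs.
rewrite xtE (dotvC p) dotvZl (dotvC e) normrZ (gtr0_norm t0) in tsub.
have b1 : eta / (4%:R * (`|e| + 1)) * `|e| <= eta / 4%:R.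
  have e1_gt0 : 0 < `|e| + 1 by rewrite ltr_wpDl.
  rewrite invfM mulrA -mulrA ler_piMr//; first by rewrite divr_ge0// ltW.
  by rewrite mulrC ler_pdivrMr// mul1r lerDl.
have b2 : C * (t * D) <= eta / 4%:R.
  rewrite (le_trans (ler_norm _))// normrM (ger0_norm (mulr_ge0 (ltW t0) D0)).
  rewrite ltr_pdivlMr// in tlt; have := normr_ge0 C; have := mulr_ge0 (normr_ge0 C) D0.
  by move: tlt t0; lra.
have key : t * (dotv p e - eta / (4%:R * (`|e| + 1)) * `|e| - dotv (P (xt t)) e - C * (t * D)) <= 0.
  by move: hs tsub; lra.
rewrite pmulr_rle0// in key.
by move: key b1 b2 tq; rewrite /= /eta; lra.
Unshelve. all: by end_near. Qed.

End SupportDirection.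

(** * Separation, and the two inclusions *)

Section NearestPoint.
Context {R : realType} {n : nat}.
Notation X := 'rV[R]_n.

(* If [p \notin S], let [q] be the point of [S] nearest to [p]; moving from [q] towards the point [pb] given by the support condition in direction [p - q] decreases the distance to [p]. *)
Lemma closed_convex_support (S : set X) (p : X) : closed S ->
  (forall a b (t : R), S a -> S b -> 0 <= t <= 1 -> S (a + t *: (b - a))) ->
  (forall e, exists2 pb, S pb & dotv p e <= dotv pb e) -> S p.
Proof.
move=> clS cvxS supS.
have [s0 Ss0 _] := supS 0.
pose d (q : X) := dotv (p - q) (p - q).
have d_ge0 q : 0 <= d q by apply: sumr_ge0 => i _; rewrite -expr2 sqr_ge0.
have cd : continuous d.
  move=> q; have cq : {for q, continuous (fun q' : X => p - q')}.
    have di : differentiable (id : X -> X) q by exact: ex_diff.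
    exact/differentiable_continuous/(differentiableB (differentiable_cst p q) di).
  exact: (@dotv_cvg R n X (nbhs q) _ (fun q' => p - q') (fun q' => p - q') _ _ cq cq).
pose K := S `&` [set q | d q <= d s0].
have cK : compact K.
  apply: bounded_closed_compact.
    exists (`|p| + (d s0 + 1)); split; first exact: num_real.
    move=> M pM q [_ /= dq]; apply: le_trans (ltW pM).
    rewrite -[q](subKr p) (le_trans (ler_normB _ _))// lerD2l.
    have := norm_sqr_le_dotv (p - q); rewrite -/(d q).
    by have := normr_ge0 (p - q); nra.
  apply: closedI => //.
  by apply: (@closed_comp _ _ d [set r | r <= d s0]) => [q _|]; [exact: cd|exact: closed_le].
have K0 : K !=set0 by exists s0; split=> //=.
have [q] : exists2 q, q \in K & forall q', q' \in K -> d q <= d q'.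
  by apply: compact_EVT_min => //; exact: continuous_subspaceT.
rewrite inE => -[Sq /= qs0] minq.
have [->//|pq] := eqVneq p q.
have dq0 : 0 < d q by apply: dotv_gt0; rewrite subr_eq0.
have [pb Spb pbe] := supS (p - q).
pose m := dotv (pb - q) (pb - q).
have m0 : 0 <= m by apply: sumr_ge0 => i _; rewrite -expr2 sqr_ge0.
have m1 : 0 < m + 1 by rewrite ltr_wpDl.
(* With this choice [t m <= d(q)], so [d] changes by at most [- 2 t d(q) + t^2 m <= - t d(q) < 0].
   Adding [1] to [m] avoids a division by zero. *)
pose t := Num.min 1 (d q / (m + 1)).
have t0 : 0 < t by rewrite lt_min ltr01 divr_gt0.
have t1 : t <= 1 by rewrite ge_min lexx.
have tm : t * (m + 1) <= d q by rewrite -ler_pdivlMr// ge_min lexx orbT.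
have dE : d (q + t *: (pb - q)) = d q - 2%:R * t * dotv (pb - q) (p - q) + t ^+ 2 * m.
  rewrite /d /m /dotv !mulr_sumr -sumrB -big_split; apply: eq_bigr => i _ /=.
  by rewrite !mxE; ring.
have pbq : d q <= dotv (pb - q) (p - q).
  by rewrite dotvBl lerBrDl; apply: le_trans pbe; rewrite /d dotvBl subrKC.
have lt : d (q + t *: (pb - q)) < d q by rewrite dE; nra.
have Sqt : S (q + t *: (pb - q)) by apply: cvxS => //; rewrite ltW.
have : d q <= d (q + t *: (pb - q)).
  by apply: minq; rewrite inE; split=> //=; exact: le_trans (ltW lt) qs0.
by rewrite leNgt lt.
Qed.

Lemma subdifferential_of_support (u f : X -> R) (x0 p : X) (Omega : set X) :
  open Omega -> Omega x0 -> (forall x, Omega x -> f x <= u x) -> f x0 = u x0 ->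
  differentiable f x0 -> (forall v, 'D_v f x0 = dotv p v) -> subdifferential u x0 p.
Proof.
move=> oO Ox0 fu f0 df dfE e e0.
have /nbhs_normP[r /= r0 Hr] : \forall h \near (0 : X),
    `|(f \o shift x0 - (cst (f x0) + 'd f x0)) h| <= e * `|h|.
  by move: e e0; apply/eqaddoP; exact: diff_locally.
near=> x.
have Ox : Omega x by near: x; exact: open_nbhs_nbhs.
have hx : `|x0 - x| < r.
  by near: x; apply: cvgr_dist_lt => //; exact: cvg_id.
have := Hr (x - x0); rewrite /= sub0r normrN distrC => /(_ hx).
rewrite -[(_ - _) _]/(f (x - x0 + x0) - (f x0 + 'd f x0 (x - x0))) subrK.
rewrite -deriveE// dfE ler_norml f0 => /andP[h _].
by have := fu _ Ox; move: h; lra.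
Unshelve. all: by end_near. Qed.

End NearestPoint.

Theorem lemma2p2 (R : realType) (n : nat)
    (Gamma : set ('rV[R]_n * 'rV[R]_n * R)) (g : 'rV[R]_n * 'rV[R]_n * R -> R)
    (Omega : set 'rV[R]_n) (u : 'rV[R]_n -> R) (x0 : 'rV[R]_n)
    (hg : generating_function Gamma g)
    (hA1 : A1 Gamma g) (hA2 : A2 Gamma g) (hA1star : A1star Gamma g)
    (hA : A_twice_differentiable Gamma g) (hA3w : A3w Gamma g)
    (hOmega : is_domain Omega) (hOmega_bounded : bounded_set Omega)
    (hu_cont : {within Omega, continuous u})
    (hu_convex : g_convex Gamma g Omega u)
    (hu_semiconvex : locally_semiconvex Omega u)
    (hx0 : Omega x0)
    (hsubdiff : forall p, subdifferential u x0 p ->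
       Uset Gamma g (x0, u x0, p))
    (hsub : forall y, Sigma0 Gamma g u x0 y ->
       sub_g_convex Gamma g Omega y (g_star Gamma g x0 y (u x0))) :
  g_normal_mapping Gamma g Omega u x0 = Sigma0 Gamma g u x0.
Proof.
have [oOmega _ _] := hOmega; have [_ _ gC2 _] := hg.
apply/seteqP; split=> [y0 [[z /= Gz egz] Gy sup]|y [p sp <-]].
  move: Gy sup; rewrite -egz (g_star_eq hg Gz) => Gy sup.
  pose p := gx g (x0, y0, z).
  have sp : subdifferential u x0 p.
    apply: (subdifferential_of_support (f := fun x => g (x, y0, z)) oOmega hx0) => //.
    - exact/differentiable_slice/(C2_differentiable gC2).
    - by move=> v; rewrite derive_xslice -ddir1_at (ddir1_xdir hg).
  exists p => //; have := Psi_Phi hA1 Gz.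
  by rewrite /Psi/= egz => -[].
have [G0 eg0 _ gs [IO _]] := subdiff_Gamma hg hA1 hsubdiff hsub sp.
rewrite /g_normal_mapping /= gs; split.
- by exists (Zmap Gamma g x0 (u x0) p).
- by move=> x Ox; exact: IO.
suff [_ sup] : supporting Gamma g Omega u x0 p by [].
apply: (@closed_convex_support R n [set p | supporting Gamma g Omega u x0 p]).
- exact: supporting_closed.
- by move=> a b t; exact: supporting_segment.
- by move=> e; exact: support_direction.
Qed.
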